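(* Let $\nu>0$ and $\sigma>\sigma_0$. Assume that $f$ is analytic inside and on a parabola $P_\rho$ for some $\rho>0$ and that, for some $\beta\in\mathbb{R}$ and some constant $\mathcal{K}>0$, $|f(z)|\le\mathcal{K}|z|^{\beta}\exp((\sigma-\nu/2)\Re(z))$ as $z\to\infty$ in the region $D_\rho$. Let $f_n$ be the approximation of $f$ produced by the Weeks method with parameters $\sigma,\nu$. Then, for fixed $t\ge0$, $$|f(t)-f_n(t)|=O\left(n^{1/4}e^{-2\rho\sqrt{\nu n}}\right),\qquad n\to\infty.$$
   Context: For $z\in\mathbb{C}\setminus[0,\infty)$, $\sqrt{-z}$ denotes the branch with cut along the positive real axis that is real and positive for $z<0$. $P_\rho=\{z\in\mathbb{C}:\Re(\sqrt{-z})=\rho\}$ is a parabola opening to the right with vertex $-\rho^2$ and focus $0$, and $D_\rho=\{z\in\mathbb{C}:\Re(\sqrt{-z})<\rho\}$ is its interior (which contains $[0,\infty)$). ''Analytic inside and on $P_\rho$'' means analytic in a neighbourhood of $D_\rho\cup P_\rho$. The Laplace transform is $(\mathcal{L}f)(s)=\int_0^\infty e^{-st}f(t)\,\mathrm{d}t$, and $\sigma_0$ is the real part of the right-most singularity of $\mathcal{L}f$. $L_k=L_k^{(0)}$ is the Laguerre polynomial of degree $k$, $L_k(x)=\sum_{j=0}^{k}\binom{k}{j}\frac{(-x)^j}{j!}$. Let $$\phi(\theta)=\Re\left[\frac{\nu}{2}\left(1+\mathrm{i}\cot\left(\frac{\theta}{2}\right)\right)(\mathcal{L}f)\left(\sigma+\mathrm{i}\frac{\nu}{2}\cot\left(\frac{\theta}{2}\right)\right)\right].$$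 Put $\tau_0=1/2$ and $\tau_k=1$ for $k\ge1$. The Weeks method computes, for $k=0,\ldots,n$, $$c_k^{w}=\frac{2\tau_k}{n+1}\sum_{j=0}^{n}\phi(\theta_j)\cos(k\theta_j),\qquad\theta_j=\frac{(j+1/2)\pi}{n+1},$$ and approximates $f$ by $$f_n(t)=e^{\sigma t}\sum_{k=0}^{n}c_k^{w}e^{-\nu t/2}L_k(\nu t).$$
   Formalization: The formal theorem also assumes f is real-valued on [0,∞); without this the claim fails, e.g. f(z)=i·exp(-z), ν=2, σ=0, since φ takes a real part and f_n(t) is always real. *)

(* Defs.v *)
From Stdlib Require Import Reals Lra Factorial.
From Coquelicot Require Import Coquelicot.

Open Scope R_scope.

Definition Cexp (z : C) : C := (exp (Re z) * cos (Im z), exp (Re z) * sin (Im z)).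

Definition cot (x : R) : R := cos x / sin x.

(* Principal square root: cut along the negative real axis, positive on the
   positive real axis; [Csqrt_sqr] and [Re_Csqrt_gt0] characterise it. *)
Definition Csqrt (w : C) : C :=
  (sqrt ((Cmod w + Re w) / 2),
   (if Rlt_dec (Im w) 0 then -1 else 1) * sqrt ((Cmod w - Re w) / 2)).

Lemma Csqrt_sqr (w : C) : Cmult (Csqrt w) (Csqrt w) = w.
Proof.
destruct w as [a b].
assert (Hm : 0 <= Cmod (a, b)) by apply Cmod_ge_0.
assert (Hm2 : Cmod (a, b) * Cmod (a, b) = a * a + b * b).
{ unfold Cmod; simpl fst; simpl snd; rewrite sqrt_sqrt; nra. }
unfold Csqrt, Cmult; simpl.
set (m := Cmod (a, b)) in *.
assert (Hp : 0 <= (m + a) / 2) by (assert (- a <= m) by nra; lra).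
assert (Hn : 0 <= (m - a) / 2) by (assert (a <= m) by nra; lra).
assert (Ep := sqrt_sqrt _ Hp).
assert (En := sqrt_sqrt _ Hn).
assert (E : sqrt ((m + a) / 2) * sqrt ((m - a) / 2) = Rabs b / 2).
{ rewrite <- sqrt_mult by assumption.
  replace ((m + a) / 2 * ((m - a) / 2)) with (Rsqr (b / 2))
    by (unfold Rsqr; nra).
  rewrite sqrt_Rsqr_abs, Rabs_div by lra.
  rewrite (Rabs_right 2) by lra; reflexivity. }
destruct (Rlt_dec b 0) as [Hb | Hb].
- rewrite (Rabs_left b Hb) in E; apply injective_projections; simpl; nra.
- rewrite (Rabs_right b) in E by lra; apply injective_projections; simpl; nra.
Qed.

Lemma Re_Csqrt_gt0 (w : C) : (Im w = 0 -> 0 < Re w) -> 0 < Re (Csqrt w).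
Proof.
destruct w as [a b]; simpl; intros H.
assert (Hm : 0 <= Cmod (a, b)) by apply Cmod_ge_0.
assert (Hm2 : Cmod (a, b) * Cmod (a, b) = a * a + b * b).
{ unfold Cmod; simpl fst; simpl snd; rewrite sqrt_sqrt; nra. }
apply sqrt_lt_R0.
destruct (Req_dec b 0) as [Hb | Hb].
- specialize (H Hb); lra.
- assert (0 < b * b) by (apply Rsqr_pos_lt; exact Hb).
  assert (- a < Cmod (a, b)) by nra; lra.
Qed.

Definition on_parabola (rho : R) (z : C) : Prop := Re (Csqrt (Copp z)) = rho.

(* On the cut [Re (Csqrt (- z))] is 0, so that this contains [0, +oo) as soon
   as [0 < rho]. *)
Definition in_parabola (rho : R) (z : C) : Prop := Re (Csqrt (Copp z)) < rho.

Definition analytic_on (U : C -> Prop) (f : C -> C) : Prop :=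
  forall z, U z -> ex_derive (K := C_AbsRing) (V := C_NormedModule) f z.

Definition analytic_in_nbhd_of (A : C -> Prop) (f : C -> C) : Prop :=
  exists U : C -> Prop,
    open U /\ (forall z, A z -> U z) /\ analytic_on U f.

Definition laplace_integrand (f : C -> C) (s : C) (t : R) : C :=
  Cmult (Cexp (Copp (Cmult s (RtoC t)))) (f (RtoC t)).

Definition is_laplace (f : C -> C) (s l : C) : Prop :=
  is_RInt_gen (V := C_R_NormedModule) (laplace_integrand f s)
    (at_point 0) (Rbar_locally p_infty) l.

Definition laplace (f : C -> C) (s : C) : C :=
  RInt_gen (V := C_R_CompleteNormedModule) (laplace_integrand f s)
    (at_point 0) (Rbar_locally p_infty).

(* [F] continues the Laplace transform of [f] analytically to [Re s > a]. *)
Definition laplace_continuation (f : C -> C) (a : R) (F : C -> C) : Prop :=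
  analytic_on (fun s => a < Re s) F /\
  exists b : R, forall s : C, b < Re s -> is_laplace f s (F s).

(* Real part of the right-most singularity of the Laplace transform, i.e. the
   edge of the largest right half-plane to which it continues analytically;
   [m_infty] if the continuation is entire, [p_infty] if the Laplace integral
   converges on no half-plane. *)
Definition laplace_sigma0 (f : C -> C) : Rbar :=
  Glb_Rbar (fun a : R => exists F : C -> C, laplace_continuation f a F).

Definition laguerre (k : nat) (x : R) : R :=
  sum_f_R0 (fun j => Binomial.C k j * ((- x) ^ j / INR (fact j))) k.

Definition weeks_phi (f : C -> C) (sigma nu theta : R) : R :=
  Re (Cmult
        (Cmult (RtoC (nu / 2)) (Cplus (RtoC 1) (Cmult Ci (RtoC (cot (theta / 2))))))
        (laplace f
           (Cplus (RtoC sigma) (Cmult Ci (RtoC (nu / 2 * cot (theta / 2))))))).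

Definition weeks_tau (k : nat) : R := if Nat.eqb k 0 then 1 / 2 else 1.

Definition weeks_node (n j : nat) : R := (INR j + 1 / 2) * PI / (INR n + 1).

Definition weeks_coef (f : C -> C) (sigma nu : R) (n k : nat) : R :=
  2 * weeks_tau k / (INR n + 1) *
  sum_f_R0 (fun j => weeks_phi f sigma nu (weeks_node n j)
                     * cos (INR k * weeks_node n j)) n.

Definition weeks_approx (f : C -> C) (sigma nu : R) (n : nat) (t : R) : R :=
  exp (sigma * t) *
  sum_f_R0 (fun k => weeks_coef f sigma nu n k * exp (- nu * t / 2)
                     * laguerre k (nu * t)) n.

Definition bigO_seq (u v : nat -> R) : Prop :=
  exists M : R, eventually (fun n => Rabs (u n) <= M * Rabs (v n)).

(* Main.v *)
(** Write [g(z) = f(z/nu) exp(- (sigma/nu - 1/2) z)] and [z = - zeta^2].  The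
    parabola becomes the line [Re zeta = r := rho sqrt nu], and [g(- zeta^2)] has
    polynomial growth in the strip [0 <= Re zeta <= r].  The Weeks method is the
    Laguerre expansion [g = sum c_k L_k], sampled through
    [P (L g)(P) = sum c_k ((P - 1)/P)^k] on [Re P = 1/2], so its error is at most
    twice the tail [sum_(k > n) |c_k|] times a bound of [|L_k(nu t)|] in [k]:
    the discrete cosine transform folds each frequency above [n] onto at most one
    below.

    Cauchy's formula on the strip reads
    [PI g(x) = int_R zeta g(- zeta^2) / (zeta^2 + x) dy] with [zeta = r + i y], so
    [c_k] is the integral of [zeta g(- zeta^2)] against
    [Q_k(zeta) = int_0^oo e^(-x) L_k(x) / (zeta^2 + x) dx
               = int_0^oo e^(- zeta u) u^k / (u + zeta)^(k+1) du].
    The modulus of the last integrand is at most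
    [e^(- r (v + k/v)) / v] up to a constant, where [v = u + r/2], times an
    arbitrarily high negative power of [1 + y^2]; the saddle point [v = sqrt k]
    gives [c_k = O(k^(-1/4) e^(- 2 r sqrt k))].  The same bound on [Q_k] and the
    Christoffel-Darboux formula show that the expansion converges to [g].  Since
    [g] need not decay, all this is done for [g(z) e^(- eps z)], uniformly in
    [eps]. *)

Require Import Defs.
From Stdlib Require Import Reals Lra Lia Factorial ClassicalEpsilon.
From Coquelicot Require Import Coquelicot.

Open Scope R_scope.

(** * Rectangle functions and bisection *)

(** The exponential and the power of n in the rate have different origins. The saddle point gives
    c_k the size k^(-1/4) e^(-2 r sqrt k); from k to k + 1 the exponent grows only by about r / sqrt
    k, so summing the tail costs a factor sqrt n, which turns n^(-1/4) into n^(1/4).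

    The obstacle is that g may grow, while Cauchy's formula on the strip asks for decay of zeta g.
    The decay of Q_k in y pays for this growth, but only once the order of integration has been
    exchanged, and the exchange is justified only for a decaying function. Hence the damping:
    constants that depend on eps sit in front of terms that vanish when the cut-off X of the
    x-integral tends to infinity, and every constant that survives is independent of eps. The limit
    X -> oo is taken before eps -> 0.

    All exchanges are made for proper Riemann integrals over rectangles, with explicit truncation
    errors. Goursat's and Fubini's theorems both say that some additive function of rectangles
    vanishes, and both follow by bisection. *)

(** Compactness as an induction principle: were [P] false, quartering would give nested rectangles
    on which it fails, shrinking to a point near which it holds. Degenerate rectangles are allowed,
    so that a segment is covered too. *)
Lemma rectangle_bisection (P : R -> R -> R -> R -> Prop) (a b c d : R) :
  a <= b -> c <= d ->
  (forall a' b' c' d', a <= a' -> a' <= b' -> b' <= b ->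
     c <= c' -> c' <= d' -> d' <= d ->
     P a' ((a' + b') / 2) c' ((c' + d') / 2) ->
     P ((a' + b') / 2) b' c' ((c' + d') / 2) ->
     P a' ((a' + b') / 2) ((c' + d') / 2) d' ->
     P ((a' + b') / 2) b' ((c' + d') / 2) d' -> P a' b' c' d') ->
  (forall x y, a <= x <= b -> c <= y <= d -> exists delta, 0 < delta /\
     forall a' b' c' d', a <= a' <= x -> x <= b' <= b ->
       c <= c' <= y -> y <= d' <= d -> b' - a' < delta -> d' - c' < delta ->
       P a' b' c' d') ->
  P a b c d.
Proof.
intros Hab Hcd Hsub Hloc.
apply NNPP; intros HnP.
set (Q := fun r : R * R * (R * R) =>
  P (fst (fst r)) (snd (fst r)) (fst (snd r)) (snd (snd r))).
(* [next] passes to a quarter on which [P] fails. If the first three quarters satisfy [P], the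
   fourth is taken untested: it cannot satisfy [P], since the whole rectangle does not. *)
set (next := fun r : R * R * (R * R) =>
  let '((a', b'), (c', d')) := r in
  let m := (a' + b') / 2 in let k := (c' + d') / 2 in
  if excluded_middle_informative (P a' m c' k) then
  if excluded_middle_informative (P m b' c' k) then
  if excluded_middle_informative (P a' m k d') then ((m, b'), (k, d'))
  else ((a', m), (k, d')) else ((m, b'), (c', k)) else ((a', m), (c', k))).
set (s := fix s n := match n with O => ((a, b), (c, d)) | S n => next (s n) end).
set (A := fun n => fst (fst (s n))). set (B := fun n => snd (fst (s n))).
set (C := fun n => fst (snd (s n))). set (D := fun n => snd (snd (s n))).
assert (Hinv : forall n, ~ P (A n) (B n) (C n) (D n) /\
  a <= A n /\ A n <= B n /\ B n <= b /\ c <= C n /\ C n <= D n /\ D n <= d).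
{ induction n as [|n IH]; [unfold A, B, C, D; simpl; repeat split; auto; lra|].
  unfold A, B, C, D in *; simpl.
  destruct (s n) as [[a' b'] [c' d']]; simpl in *.
  destruct IH as (H0 & H1 & H2 & H3 & H4 & H5 & H6).
  destruct (excluded_middle_informative _) as [P1|P1];
  [destruct (excluded_middle_informative _) as [P2|P2];
  [destruct (excluded_middle_informative _) as [P3|P3]|]|]; simpl;
  (split; [intros HP; auto|lra]). }
assert (Hstep : forall n, A n <= A (S n) /\ B (S n) <= B n /\ C n <= C (S n) /\
  D (S n) <= D n /\ B (S n) - A (S n) = (B n - A n) / 2 /\
  D (S n) - C (S n) = (D n - C n) / 2).
{ intros n; destruct (Hinv n) as (_ & H1 & H2 & H3 & H4 & H5 & H6).
  unfold A, B, C, D in *; simpl.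
  destruct (s n) as [[a' b'] [c' d']]; simpl in *.
  repeat destruct (excluded_middle_informative _); simpl; lra. }
assert (Hw : forall n, B n - A n = (b - a) / 2 ^ n /\ D n - C n = (d - c) / 2 ^ n).
{ induction n as [|n [IH1 IH2]]; [unfold A, B, C, D; simpl; lra|].
  destruct (Hstep n) as (_ & _ & _ & _ & E1 & E2).
  assert (2 ^ n <> 0) by (apply pow_nonzero; lra).
  rewrite E1, E2, IH1, IH2; simpl; split; field; auto. }
assert (Hlim : forall U V : nat -> R, (forall n, U n <= V n) ->
  (forall n, U n <= U (S n) /\ V (S n) <= V n) ->
  exists x, forall n, U n <= x <= V n).
{ intros U V HUV Hm.
  assert (Hmon : forall n k, U n <= U (n + k)%nat /\ V (n + k)%nat <= V n).
  { intros n; induction k as [|k IH]; [rewrite Nat.add_0_r; lra|].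
    rewrite Nat.add_succ_r; specialize (Hm (n + k)%nat); lra. }
  assert (Hub : forall n m, U n <= V m).
  { intros n m; destruct (Nat.le_ge_cases n m) as [H|H].
    - replace m with (n + (m - n))%nat by lia.
      destruct (Hmon n (m - n)%nat); specialize (HUV (n + (m - n))%nat); lra.
    - replace n with (m + (n - m))%nat by lia.
      destruct (Hmon m (n - m)%nat); specialize (HUV (m + (n - m))%nat); lra. }
  destruct (completeness (fun r => exists n, r = U n)) as [x [Hx1 Hx2]].
  - exists (V 0%nat); intros r [n ->]; apply Hub.
  - exists (U 0%nat), 0%nat; auto.
  - exists x; intros n; split; [apply Hx1; exists n; auto|].
    apply Hx2; intros r [m ->]; apply Hub. }
destruct (Hlim A B) as [x Hx].
{ intros n; apply (Hinv n). }
{ intros n; destruct (Hstep n); tauto. }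
destruct (Hlim C D) as [y Hy].
{ intros n; apply (Hinv n). }
{ intros n; destruct (Hstep n); tauto. }
destruct (Hloc x y (Hx 0%nat) (Hy 0%nat)) as [delta [Hd HP]].
(* The + 1 in the denominator keeps the threshold meaningful when the rectangle is a point. *)
destruct (pow_lt_1_zero (/ 2) ltac:(rewrite Rabs_pos_eq; lra)
   (delta / ((b - a) + (d - c) + 1))) as [n Hn].
{ apply Rdiv_lt_0_compat; lra. }
specialize (Hn n (le_n n)).
rewrite Rabs_pos_eq in Hn by (apply pow_le; lra).
rewrite pow_inv in Hn.
apply (Rmult_lt_compat_r ((b - a) + (d - c) + 1)) in Hn; [|lra].
replace (delta / (b - a + (d - c) + 1) * (b - a + (d - c) + 1)) with delta in Hn
  by (field; lra).
assert (Hp : 0 < / 2 ^ n) by (apply Rinv_0_lt_compat, pow_lt; lra).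
destruct (Hinv n) as (H0 & H1 & H2 & H3 & H4 & H5 & H6).
destruct (Hw n) as [W1 W2].
apply H0, HP; try (split; auto; first [apply Hx | apply Hy]).
- rewrite W1; unfold Rdiv; nra.
- rewrite W2; unfold Rdiv; nra.
Qed.

(** The common core of Goursat and Fubini. A bound by eps times the square of the half-perimeter
    survives the reassembly of four quarters, because each quarter has half the half-perimeter; so a
    local bound becomes global. *)
Lemma additive_rectangle_zero (Phi : R -> R -> R -> R -> C) (a b c d : R) :
  a <= b -> c <= d ->
  (forall a' m b' c' d', a <= a' -> a' <= m -> m <= b' -> b' <= b ->
     c <= c' -> c' <= d' -> d' <= d ->
     Phi a' b' c' d' = (Phi a' m c' d' + Phi m b' c' d')%C) ->
  (forall a' b' c' m d', a <= a' -> a' <= b' -> b' <= b ->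
     c <= c' -> c' <= m -> m <= d' -> d' <= d ->
     Phi a' b' c' d' = (Phi a' b' c' m + Phi a' b' m d')%C) ->
  (forall eps x y, 0 < eps -> a <= x <= b -> c <= y <= d ->
     exists delta, 0 < delta /\
     forall a' b' c' d', a <= a' <= x -> x <= b' <= b ->
       c <= c' <= y -> y <= d' <= d -> b' - a' < delta -> d' - c' < delta ->
       Cmod (Phi a' b' c' d') <= eps * ((b' - a') + (d' - c')) ^ 2) ->
  Phi a b c d = RtoC 0.
Proof.
intros Hab Hcd Hh Hv Hloc.
assert (Hall : forall eps, 0 < eps ->
  Cmod (Phi a b c d) <= eps * ((b - a) + (d - c)) ^ 2).
{ intros eps Heps.
  apply (rectangle_bisection (fun a b c d =>
    Cmod (Phi a b c d) <= eps * ((b - a) + (d - c)) ^ 2) a b c d Hab Hcd).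
  - intros a' b' c' d' H1 H2 H3 H4 H5 H6 Q1 Q2 Q3 Q4.
    rewrite (Hh a' ((a' + b') / 2) b') by lra.
    rewrite (Hv a' ((a' + b') / 2) c' ((c' + d') / 2)) by lra.
    rewrite (Hv ((a' + b') / 2) b' c' ((c' + d') / 2)) by lra.
    eapply Rle_trans; [apply Cmod_triangle|].
    eapply Rle_trans;
      [apply Rplus_le_compat; apply Cmod_triangle|].
    nra.
  - intros x y Hx Hy; apply (Hloc eps x y Heps Hx Hy). }
apply Cmod_eq_0, Rle_antisym; [|apply Cmod_ge_0].
apply Rnot_lt_le; intros H.
set (s := ((b - a) + (d - c)) ^ 2) in *.
assert (0 <= s) by (apply pow2_ge_0).
(* With this eps the bound reads |Phi| <= |Phi| / 2, which is absurd for a nonzero value. *)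
specialize (Hall (Cmod (Phi a b c d) / (2 * (s + 1)))).
assert (0 < Cmod (Phi a b c d) / (2 * (s + 1))) by (apply Rdiv_lt_0_compat; lra).
specialize (Hall H1).
assert (Cmod (Phi a b c d) / (2 * (s + 1)) * s <= Cmod (Phi a b c d) / 2).
{ apply Rle_trans with (Cmod (Phi a b c d) / (2 * (s + 1)) * (s + 1)).
  - apply Rmult_le_compat_l; lra.
  - right; field; lra. }
lra.
Qed.

(** * Complex continuity and differentiability *)

(** The target is pinned to the product uniform structure, whose balls bound the real and the
    imaginary part separately. *)
Definition Ccont {U : UniformSpace} (f : U -> C) (x : U) : Prop :=
  continuous (U := C_UniformSpace) f x.

Lemma Ccont_parts (U : UniformSpace) (f : U -> C) (x : U) :
  continuous (fun t => Re (f t)) x -> continuous (fun t => Im (f t)) x -> Ccont f x.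
Proof.
intros H1 H2 P [eps HP].
assert (K1 := H1 (ball (Re (f x)) eps) (locally_ball _ eps)).
assert (K2 := H2 (ball (Im (f x)) eps) (locally_ball _ eps)).
destruct K1 as [d1 K1]; destruct K2 as [d2 K2].
assert (Hd : 0 < Rmin d1 d2) by (apply Rmin_glb_lt; apply cond_pos).
exists (mkposreal _ Hd); intros t Ht; apply HP; split.
- apply K1; eapply ball_le; [|exact Ht]; apply Rmin_l.
- apply K2; eapply ball_le; [|exact Ht]; apply Rmin_r.
Qed.

Lemma Ccont_Re (U : UniformSpace) (f : U -> C) (x : U) :
  Ccont f x -> continuous (fun t => Re (f t)) x.
Proof.
intros H; apply (continuous_comp f (fst : C -> R)); [exact H|].
rewrite (surjective_pairing (f x)); apply continuous_fst.
Qed.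

Lemma Ccont_Im (U : UniformSpace) (f : U -> C) (x : U) :
  Ccont f x -> continuous (fun t => Im (f t)) x.
Proof.
intros H; apply (continuous_comp f (snd : C -> R)); [exact H|].
rewrite (surjective_pairing (f x)); apply continuous_snd.
Qed.

Lemma Ccont_plus (U : UniformSpace) (f g : U -> C) (x : U) :
  Ccont f x -> Ccont g x -> Ccont (fun t => (f t + g t)%C) x.
Proof.
intros Hf Hg; apply Ccont_parts; simpl.
- apply (continuous_plus (V := R_NormedModule)); apply Ccont_Re; assumption.
- apply (continuous_plus (V := R_NormedModule)); apply Ccont_Im; assumption.
Qed.

Lemma Ccont_opp (U : UniformSpace) (f : U -> C) (x : U) :
  Ccont f x -> Ccont (fun t => (- f t)%C) x.
Proof.
intros Hf; apply Ccont_parts; simpl.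
- apply (continuous_opp (V := R_NormedModule)); apply Ccont_Re; assumption.
- apply (continuous_opp (V := R_NormedModule)); apply Ccont_Im; assumption.
Qed.

Lemma Ccont_minus (U : UniformSpace) (f g : U -> C) (x : U) :
  Ccont f x -> Ccont g x -> Ccont (fun t => (f t - g t)%C) x.
Proof. intros Hf Hg; apply Ccont_plus; [|apply Ccont_opp]; assumption. Qed.

Lemma continuous_Rmult (U : UniformSpace) (f g : U -> R) (x : U) :
  continuous f x -> continuous g x -> continuous (fun t => f t * g t) x.
Proof. intros; apply (continuous_mult (K := R_AbsRing)); assumption. Qed.

Lemma continuous_Rplus (U : UniformSpace) (f g : U -> R) (x : U) :
  continuous f x -> continuous g x -> continuous (fun t => f t + g t) x.
Proof. intros; apply (continuous_plus (V := R_NormedModule)); assumption. Qed.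

Lemma continuous_Rminus (U : UniformSpace) (f g : U -> R) (x : U) :
  continuous f x -> continuous g x -> continuous (fun t => f t - g t) x.
Proof. intros; apply (continuous_minus (V := R_NormedModule)); assumption. Qed.

Lemma Ccont_mult (U : UniformSpace) (f g : U -> C) (x : U) :
  Ccont f x -> Ccont g x -> Ccont (fun t => (f t * g t)%C) x.
Proof.
intros Hf Hg; apply Ccont_parts; simpl.
- apply continuous_Rminus; apply continuous_Rmult; auto using Ccont_Re, Ccont_Im.
- apply continuous_Rplus; apply continuous_Rmult; auto using Ccont_Re, Ccont_Im.
Qed.

Lemma Ccont_const (U : UniformSpace) (c : C) (x : U) : Ccont (fun _ => c) x.
Proof. apply continuous_const. Qed.

Lemma Ccont_id (z : C) : Ccont (U := C_UniformSpace) (fun w => w) z.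
Proof. apply continuous_id. Qed.

Lemma Ccont_comp (U : UniformSpace) (f : U -> C) (g : C -> C) (x : U) :
  Ccont f x -> Ccont (U := C_UniformSpace) g (f x) -> Ccont (fun t => g (f t)) x.
Proof. intros Hf Hg; apply (continuous_comp f g); assumption. Qed.

Lemma Ccont_RtoC (U : UniformSpace) (f : U -> R) (x : U) :
  continuous f x -> Ccont (fun t => RtoC (f t)) x.
Proof. intros Hf; apply Ccont_parts; simpl; [exact Hf | apply continuous_const]. Qed.

Lemma Ccont_pair (U : UniformSpace) (f g : U -> R) (x : U) :
  continuous f x -> continuous g x -> Ccont (fun t => (f t, g t)) x.
Proof. intros Hf Hg; apply Ccont_parts; assumption. Qed.

Lemma continuous_Rinv' (U : UniformSpace) (f : U -> R) (x : U) :
  continuous f x -> f x <> 0 -> continuous (fun t => / f t) x.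
Proof.
intros Hf H0; apply (continuous_comp f Rinv); [exact Hf|].
apply continuity_pt_filterlim, continuity_pt_inv; [apply continuity_pt_id|exact H0].
Qed.

Lemma continuous_Cmod_sqr (U : UniformSpace) (f : U -> C) (x : U) :
  Ccont f x -> continuous (fun t => fst (f t) ^ 2 + snd (f t) ^ 2) x.
Proof.
intros Hf.
apply (continuous_ext (fun t => Re (f t) * Re (f t) + Im (f t) * Im (f t))).
{ intros t; unfold Re, Im; simpl; f_equal; f_equal; symmetry; apply Rmult_1_r. }
apply continuous_Rplus; apply continuous_Rmult; auto using Ccont_Re, Ccont_Im.
Qed.

Lemma Ccont_inv (U : UniformSpace) (f : U -> C) (x : U) :
  Ccont f x -> f x <> RtoC 0 -> Ccont (fun t => (/ f t)%C) x.
Proof.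
intros Hf H0.
assert (Hn : continuous (fun t => (fst (f t) ^ 2 + snd (f t) ^ 2)) x).
{ apply continuous_Cmod_sqr, Hf. }
assert (Hne : fst (f x) ^ 2 + snd (f x) ^ 2 <> 0).
{ intros E; apply H0, injective_projections; simpl; nra. }
apply Ccont_parts; unfold Re, Im, Cinv; simpl; apply continuous_Rmult.
- apply (Ccont_Re _ f); assumption.
- apply continuous_Rinv'; assumption.
- apply (continuous_opp (V := R_NormedModule)), (Ccont_Im _ f); assumption.
- apply continuous_Rinv'; assumption.
Qed.

Lemma Ccont_exp (U : UniformSpace) (f : U -> C) (x : U) :
  Ccont f x -> Ccont (fun t => Cexp (f t)) x.
Proof.
intros Hf; apply Ccont_parts; unfold Cexp; simpl; apply continuous_Rmult.
- apply (continuous_comp _ exp); [apply Ccont_Re, Hf | apply continuous_exp].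
- apply (continuous_comp _ cos); [apply Ccont_Im, Hf | apply continuous_cos].
- apply (continuous_comp _ exp); [apply Ccont_Re, Hf | apply continuous_exp].
- apply (continuous_comp _ sin); [apply Ccont_Im, Hf | apply continuous_sin].
Qed.

Lemma Cmod_le_parts (z : C) : Cmod z <= Rabs (Re z) + Rabs (Im z).
Proof.
destruct z as [x y]; unfold Cmod; simpl.
apply Rle_trans with (sqrt ((Rabs x + Rabs y) ^ 2)).
- apply sqrt_le_1_alt.
  generalize (Rabs_pos x) (Rabs_pos y) (pow2_abs x) (pow2_abs y); simpl; nra.
- rewrite sqrt_pow2; [lra|]; generalize (Rabs_pos x) (Rabs_pos y); lra.
Qed.

Lemma Im_le_Cmod (z : C) : Rabs (Im z) <= Cmod z.
Proof. eapply Rle_trans; [|apply (Rmax_Cmod z)]; apply Rmax_r. Qed.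

Lemma Ccont_eps (f : C -> C) (z : C) :
  Ccont (U := C_UniformSpace) f z -> forall eps, 0 < eps -> exists delta, 0 < delta /\
    forall w, Rabs (Re w - Re z) < delta -> Rabs (Im w - Im z) < delta ->
      Cmod (f w - f z) < eps.
Proof.
intros Hf eps He.
assert (H2 : 0 < eps / 2) by lra.
destruct (Hf _ (locally_ball (f z : C_UniformSpace) (mkposreal _ H2))) as [d Hd].
exists d; split; [apply cond_pos|]; intros w H1 H3.
destruct (Hd w) as [K1 K2]; [split; assumption|].
eapply Rle_lt_trans; [apply Cmod_le_parts|].
change (Rabs (Re (f w) - Re (f z)) < eps / 2) in K1.
change (Rabs (Im (f w) - Im (f z)) < eps / 2) in K2.
change (Rabs (Re (f w) - Re (f z)) + Rabs (Im (f w) - Im (f z)) < eps); lra.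
Qed.

Lemma eps_Ccont (f : C -> C) (z : C) :
  (forall eps, 0 < eps -> exists delta, 0 < delta /\
    forall w, Cmod (w - z) < delta -> Cmod (f w - f z) < eps) ->
  Ccont (U := C_UniformSpace) f z.
Proof.
intros H P [eps HP].
destruct (H eps (cond_pos eps)) as [d [Hd Hw]].
assert (H2 : 0 < d / 2) by lra.
exists (mkposreal _ H2); intros w [H1 H3].
change (Rabs (Re w - Re z) < d / 2) in H1.
change (Rabs (Im w - Im z) < d / 2) in H3.
assert (K : Cmod (f w - f z) < eps).
{ apply Hw; eapply Rle_lt_trans; [apply Cmod_le_parts|].
  change (Rabs (Re w - Re z) + Rabs (Im w - Im z) < d); lra. }
apply HP; split.
- change (Rabs (Re (f w) - Re (f z)) < eps).
  eapply Rle_lt_trans; [|exact K]; apply (re_le_Cmod (f w - f z)%C).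
- change (Rabs (Im (f w) - Im (f z)) < eps).
  eapply Rle_lt_trans; [|exact K]; apply (Im_le_Cmod (f w - f z)%C).
Qed.

(* Caratheodory's form of complex differentiability: products and compositions
   reduce to continuity. *)
Definition Cdiff (f : C -> C) (z : C) : Prop :=
  exists q : C -> C, Ccont (U := C_UniformSpace) q z /\
    forall w, f w = (f z + q w * (w - z))%C.

Lemma ex_derive_Cdiff (f : C -> C) (z : C) :
  ex_derive (K := C_AbsRing) (V := C_NormedModule) f z -> Cdiff f z.
Proof.
intros [l [_ Hl]].
specialize (Hl z (fun P H => H)).
(* The difference quotient, completed at [z] by the derivative: its continuity at [z] is
   differentiability. *)
set (q := fun w : C => if excluded_middle_informative (w = z) then l
                       else ((f w - f z) / (w - z))%C).
assert (Hne : forall w, w <> z -> (w - z)%C <> RtoC 0).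
{ intros w Hw E; apply Hw; replace w with (w - z + z)%C by ring.
  rewrite E; ring. }
exists q; split.
- apply eps_Ccont; intros eps He.
  assert (H2 : 0 < eps / 2) by lra.
  destruct (Hl (mkposreal _ H2)) as [d Hd].
  exists d; split; [apply cond_pos|]; intros w Hw.
  unfold q; destruct (excluded_middle_informative (z = z)) as [_|]; [|tauto].
  destruct (excluded_middle_informative (w = z)) as [E|E].
  { replace (l - l)%C with (RtoC 0) by ring; rewrite Cmod_0; exact He. }
  assert (Hpos : 0 < Cmod (w - z)) by (apply Cmod_gt_0; auto).
  replace ((f w - f z) / (w - z) - l)%C
    with ((f w - f z - (w - z) * l) / (w - z))%C
    by (field; auto).
  rewrite Cmod_div by auto.
  apply Rle_lt_trans with (eps / 2); [|lra].
  apply Rmult_le_reg_r with (Cmod (w - z)); [exact Hpos|].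
  unfold Rdiv at 1; rewrite Rmult_assoc, Rinv_l, Rmult_1_r by lra.
  exact (Hd w Hw).
- intros w; unfold q.
  destruct (excluded_middle_informative (w = z)) as [->|E]; [ring|].
  field; auto.
Qed.

Lemma Cdiff_cont (f : C -> C) (z : C) : Cdiff f z -> Ccont (U := C_UniformSpace) f z.
Proof.
intros [q [Hq Hf]].
apply (continuous_ext (fun w => (f z + q w * (w - z))%C)).
{ intros w; symmetry; apply Hf. }
apply Ccont_plus; [apply Ccont_const|apply Ccont_mult; [exact Hq|]].
apply Ccont_minus; [apply Ccont_id | apply Ccont_const].
Qed.

Lemma Cdiff_const (c z : C) : Cdiff (fun _ => c) z.
Proof. exists (fun _ => RtoC 0); split; [apply Ccont_const | intros w; ring]. Qed.

Lemma Cdiff_id (z : C) : Cdiff (fun w => w) z.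
Proof. exists (fun _ => RtoC 1); split; [apply Ccont_const | intros w; ring]. Qed.

Lemma Cdiff_plus (f g : C -> C) (z : C) :
  Cdiff f z -> Cdiff g z -> Cdiff (fun w => (f w + g w)%C) z.
Proof.
intros [p [Hp Ef]] [q [Hq Eg]].
exists (fun w => (p w + q w)%C); split; [apply Ccont_plus; assumption|].
intros w; rewrite (Ef w), (Eg w); ring.
Qed.

Lemma Cdiff_mult (f g : C -> C) (z : C) :
  Cdiff f z -> Cdiff g z -> Cdiff (fun w => (f w * g w)%C) z.
Proof.
intros Hf Hg; assert (Hc := Cdiff_cont _ _ Hg).
destruct Hf as [p [Hp Ef]]; destruct Hg as [q [Hq Eg]].
exists (fun w => (p w * g w + f z * q w)%C); split.
- apply Ccont_plus; apply Ccont_mult; auto using Ccont_const.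
- intros w; rewrite (Ef w), (Eg w); ring.
Qed.

Lemma Cdiff_opp (f : C -> C) (z : C) : Cdiff f z -> Cdiff (fun w => (- f w)%C) z.
Proof.
intros [p [Hp Ef]]; exists (fun w => (- p w)%C); split; [apply Ccont_opp, Hp|].
intros w; rewrite (Ef w); ring.
Qed.

Lemma Cdiff_minus (f g : C -> C) (z : C) :
  Cdiff f z -> Cdiff g z -> Cdiff (fun w => (f w - g w)%C) z.
Proof. intros Hf Hg; apply Cdiff_plus; [|apply Cdiff_opp]; assumption. Qed.

Lemma Cdiff_comp (f g : C -> C) (z : C) :
  Cdiff f z -> Cdiff g (f z) -> Cdiff (fun w => g (f w)) z.
Proof.
intros Hf [q [Hq Eg]]; assert (Hc := Cdiff_cont _ _ Hf).
destruct Hf as [p [Hp Ef]].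
exists (fun w => (q (f w) * p w)%C); split.
- apply Ccont_mult; [|exact Hp]; apply (Ccont_comp _ f); assumption.
- intros w; rewrite (Eg (f w)); rewrite (Ef w) at 2; ring.
Qed.

Lemma Cinv_0 : (/ 0)%C = RtoC 0.
Proof. unfold Cinv, RtoC; simpl; apply injective_projections; simpl; unfold Rdiv; ring. Qed.

Lemma Cdiff_inv (z : C) : z <> RtoC 0 -> Cdiff Cinv z.
Proof.
intros Hz.
assert (Hpos : 0 < Cmod z) by (apply Cmod_gt_0; exact Hz).
(* The identity in [Cdiff] must hold at every [w]. At [w = 0], where [Cinv] takes the value 0, it
   forces the quotient to be [/ (z * z)]. *)
exists (fun w => if excluded_middle_informative (w = RtoC 0) then (/ (z * z))%C
                 else (- (/ (z * w)))%C); split.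
- refine (continuous_ext_loc (T := C_UniformSpace) (U := C_UniformSpace) _ (fun w => (- (/ (z *
    w)))%C) z _ _).
  + assert (H2 : 0 < Cmod z / 2) by lra.
    exists (mkposreal _ H2); intros w [H1 H3].
    change (Rabs (Re w - Re z) < Cmod z / 2) in H1.
    change (Rabs (Im w - Im z) < Cmod z / 2) in H3.
    destruct (excluded_middle_informative _) as [E|]; [exfalso|reflexivity].
    rewrite E in H1, H3.
    generalize (Cmod_le_parts z); simpl in H1, H3.
    rewrite Rminus_0_l, Rabs_Ropp in H1, H3; lra.
  + apply Ccont_opp, Ccont_inv; [apply Ccont_mult; [apply Ccont_const|apply Ccont_id]|].
    apply Cmult_neq_0; exact Hz.
- intros w; destruct (excluded_middle_informative (w = RtoC 0)) as [->|Hw].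
  + rewrite Cinv_0; field; exact Hz.
  + field; split; assumption.
Qed.

(** * The complex exponential *)

Lemma Cexp_plus (z w : C) : Cexp (z + w) = (Cexp z * Cexp w)%C.
Proof.
unfold Cexp, Cmult, Re, Im; simpl; rewrite exp_plus, cos_plus, sin_plus.
apply injective_projections; simpl; rewrite ?exp_plus, ?cos_plus, ?sin_plus; unfold Re, Im; ring.
Qed.

Lemma Cmod_Cexp (z : C) : Cmod (Cexp z) = exp (Re z).
Proof.
unfold Cmod, Cexp; simpl.
symmetry; rewrite <- (sqrt_pow2 (exp (Re z))) at 1 by (left; apply exp_pos).
f_equal; symmetry; transitivity (exp (Re z) ^ 2 * (Rsqr (sin (Im z)) + Rsqr (cos (Im z)))).
- unfold Rsqr; ring.
- rewrite sin2_cos2; ring.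
Qed.

Lemma exp_taylor_bound (a : R) : Rabs a <= 1 / 2 -> Rabs (exp a - 1 - a) <= 2 * a ^ 2.
Proof.
intros Ha; apply Rabs_le_between in Ha.
assert (H1 := exp_ineq1_le a); assert (H2 := exp_ineq1_le (- a)).
assert (H3 : exp a * exp (- a) = 1) by (rewrite <- exp_plus, Rplus_opp_r; apply exp_0).
assert (Hp := exp_pos a).
rewrite Rabs_pos_eq by lra.
assert (exp a * (1 - a) <= 1) by nra.
nra.
Qed.

(** Quadratic remainders are all that differentiability at 0 asks for. The cosine follows from 1 -
    cos x = 2 sin(x/2)^2, then the sine from the mean value theorem. *)
Lemma sin_taylor_bound (b : R) : Rabs (sin b - b) <= b ^ 2 /\ Rabs (cos b - 1) <= b ^ 2.
Proof.
assert (Hc : forall x, 1 - cos x <= x ^ 2 /\ 0 <= 1 - cos x).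
{ intros x; generalize (COS_bound x); intros Hcb; split; [|lra].
  replace (cos x) with (cos (2 * (x / 2))) by (f_equal; field).
  rewrite cos_2a_sin.
  assert (Hs : Rabs (sin (x / 2)) <= Rabs (x / 2)).
  { destruct (Rle_dec 0 (x / 2)) as [H0|H0].
    - destruct (Req_dec (x / 2) 0) as [->|]; [rewrite sin_0; lra|].
      rewrite (Rabs_pos_eq (x / 2)) by exact H0; apply Rabs_le; split.
      + destruct (Rle_dec (x / 2) PI).
        * generalize (sin_ge_0 (x / 2)); lra.
        * generalize (SIN_bound (x / 2)) PI_RGT_0 PI2_1; lra.
      + left; apply sin_lt_x; lra.
    - rewrite <- Rabs_Ropp, <- sin_neg, <- (Rabs_Ropp (x / 2)).
      rewrite (Rabs_pos_eq (- (x / 2))) by lra; apply Rabs_le; split.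
      + destruct (Rle_dec (- (x / 2)) PI).
        * generalize (sin_ge_0 (- (x / 2))); lra.
        * generalize (SIN_bound (- (x / 2))) PI_RGT_0 PI2_1; lra.
      + left; apply sin_lt_x; lra. }
  apply Rsqr_le_abs_1 in Hs; unfold Rsqr in Hs; nra. }
split; [|destruct (Hc b); rewrite Rabs_minus_sym, Rabs_pos_eq; lra].
assert (Hpos : forall x, 0 <= x -> Rabs (sin x - x) <= x ^ 2).
{ intros x [Hx|<-]; [|rewrite sin_0, Rminus_0_r, Rabs_R0; simpl; lra].
  destruct (MVT_gen (fun t => sin t - t) 0 x (fun t => cos t - 1)) as [c [Hcr E]].
  - intros t _; auto_derive; [auto|ring].
  - intros t _; apply continuity_pt_minus; [apply continuity_sin|apply continuity_pt_id].
  - rewrite Rmin_left, Rmax_right in Hcr by lra.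
    rewrite sin_0 in E; replace (sin x - x) with ((cos c - 1) * x) by lra.
    destruct (Rle_dec x 2) as [H2|H2].
    + rewrite Rabs_mult, (Rabs_pos_eq x) by lra; rewrite Rabs_minus_sym.
      destruct (Hc (c / 1)) as [K1 K2]; destruct (Hc c) as [K3 K4].
      rewrite Rabs_pos_eq by lra.
      assert (1 - cos c <= x).
      { destruct (MVT_gen cos 0 c (fun t => - sin t)) as [e [He E2]].
        - intros t _; auto_derive; [auto|ring].
        - intros t _; apply continuity_cos.
        - rewrite cos_0 in E2; generalize (SIN_bound e); nra. }
      nra.
    + rewrite Rabs_mult, (Rabs_pos_eq x) by lra; rewrite Rabs_minus_sym.
      generalize (COS_bound c); intros; rewrite Rabs_pos_eq by lra; nra. }
destruct (Rle_dec 0 b) as [H|H]; [auto|].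
rewrite <- Rabs_Ropp; replace (- (sin b - b)) with (sin (- b) - (- b))
  by (rewrite sin_neg; ring).
eapply Rle_trans; [apply Hpos; lra|simpl; nra].
Qed.

Lemma Cexp_taylor_bound (h : C) : Cmod h <= 1 / 2 ->
  Cmod (Cexp h - 1 - h) <= 9 * Cmod h ^ 2.
Proof.
intros Hh; destruct h as [a b].
assert (Ha := re_le_Cmod (a, b)); assert (Hb := Im_le_Cmod (a, b)); simpl in Ha, Hb.
assert (Hm := Cmod2_alt (a, b)); unfold Re, Im in Hm; cbn [fst snd] in Hm.
assert (H1 := exp_taylor_bound a ltac:(lra)).
destruct (sin_taylor_bound b) as [H2 H3].
assert (Ha' : Rabs a <= 1 / 2) by lra; apply Rabs_le_between in Ha'.
apply Rabs_le_between in H1; apply Rabs_le_between in H2; apply Rabs_le_between in H3.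
rewrite Hm.
eapply Rle_trans; [apply Cmod_le_parts|]; unfold Cminus, Cexp; simpl Re; simpl Im.
unfold Re, Im; simpl.
assert (Hea : 0 < exp a <= 2) by (split; [apply exp_pos | simpl in H1; nra]).
replace (exp a * cos b + - (1) + - a) with ((exp a - 1 - a) + exp a * (cos b - 1)) by ring.
replace (exp a * sin b + -0 + - b) with (exp a * (sin b - b) + (exp a - 1) * b) by ring.
assert (K1 : Rabs (exp a - 1 - a + exp a * (cos b - 1)) <= 2 * a ^ 2 + 2 * b ^ 2).
{ apply Rabs_le; simpl in *; nra. }
assert (K2 : Rabs ((exp a - 1) * b) <= 2 * (a ^ 2 + b ^ 2)).
{ rewrite Rabs_mult.
  assert (K0 : Rabs (exp a - 1) <= 2 * Rabs a).
  { replace (exp a - 1) with ((exp a - 1 - a) + a) by ring.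
    eapply Rle_trans; [apply Rabs_triang|].
    assert (H : Rabs (exp a - 1 - a) <= 2 * a ^ 2) by (apply Rabs_le; lra).
    rewrite <- pow2_abs in H.
    assert (H0 : 0 <= Rabs a <= 1 / 2) by (split; [apply Rabs_pos | apply Rabs_le; lra]).
    set (p := Rabs a) in *; clearbody p; simpl in H; nra. }
  rewrite <- (pow2_abs a), <- (pow2_abs b).
  generalize (Rabs_pos a) (Rabs_pos b); intros G1 G2.
  apply Rle_trans with (2 * Rabs a * Rabs b); [apply Rmult_le_compat_r; lra|].
  generalize (Rle_0_sqr (Rabs a - Rabs b)); unfold Rsqr; simpl; nra. }
assert (K3 : Rabs (exp a * (sin b - b)) <= 2 * b ^ 2).
{ apply Rabs_le; simpl in *; nra. }
generalize (Rabs_triang (exp a * (sin b - b)) ((exp a - 1) * b)); simpl in *; nra.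
Qed.

Lemma Cexp_0 : Cexp (RtoC 0) = RtoC 1.
Proof.
unfold Cexp; simpl; rewrite exp_0, cos_0, sin_0.
apply injective_projections; simpl; ring.
Qed.

(** The quadratic remainder gives the derivative at 0, and the functional equation carries it to
    [z]. *)
Lemma Cdiff_exp (z : C) : Cdiff Cexp z.
Proof.
set (q := fun h : C => if excluded_middle_informative (h = RtoC 0) then RtoC 1
                   else ((Cexp h - 1) / h)%C).
assert (Hq : Ccont (U := C_UniformSpace) q (RtoC 0)).
{ apply eps_Ccont; intros eps He.
  exists (Rmin (1 / 2) (eps / 9)); split; [apply Rmin_glb_lt; lra|].
  intros h Hh; replace (h - 0)%C with h in Hh by ring.
  unfold q; destruct (excluded_middle_informative (RtoC 0 = RtoC 0)) as [_|]; [|tauto].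
  destruct (excluded_middle_informative (h = RtoC 0)) as [E|E].
  { replace (1 - 1)%C with (RtoC 0) by ring; rewrite Cmod_0; exact He. }
  assert (H1 := Rmin_l (1 / 2) (eps / 9)); assert (H2 := Rmin_r (1 / 2) (eps / 9)).
  assert (Hpos : 0 < Cmod h) by (apply Cmod_gt_0; exact E).
  replace ((Cexp h - 1) / h - 1)%C
    with ((Cexp h - 1 - h) / h)%C by (field; exact E).
  rewrite Cmod_div by exact E.
  apply Rle_lt_trans with (9 * Cmod h); [|lra].
  apply Rmult_le_reg_r with (Cmod h); [exact Hpos|].
  unfold Rdiv at 1; rewrite Rmult_assoc, Rinv_l, Rmult_1_r by lra.
  eapply Rle_trans; [apply Cexp_taylor_bound; lra|simpl; lra]. }
exists (fun w => (Cexp z * q (w - z)%C)%C); split.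
- apply Ccont_mult; [apply Ccont_const|].
  apply (Ccont_comp _ (fun w => (w - z)%C) q).
  + apply Ccont_minus; [apply Ccont_id|apply Ccont_const].
  + replace (z - z)%C with (RtoC 0) by ring; exact Hq.
- intros w; unfold q.
  destruct (excluded_middle_informative ((w - z)%C = RtoC 0)) as [E|E].
  + replace w with (w - z + z)%C by ring; rewrite E.
    replace (0 + z)%C with z by ring; ring.
  + replace w with (z + (w - z))%C at 1 by ring; rewrite Cexp_plus; field; exact E.
Qed.

(** * Integrals of complex functions, Goursat and Fubini on rectangles *)

Definition is_CInt (f : R -> C) (a b : R) (l : C) : Prop :=
  is_RInt (V := C_R_NormedModule) f a b l.

Definition CInt (f : R -> C) (a b : R) : C := RInt (V := C_R_CompleteNormedModule) f a b.

Lemma is_CInt_parts (f : R -> C) (a b : R) (l : C) :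
  is_RInt (fun t => Re (f t)) a b (Re l) -> is_RInt (fun t => Im (f t)) a b (Im l) ->
  is_CInt f a b l.
Proof.
intros H1 H2; rewrite (surjective_pairing l).
apply (is_RInt_fct_extend_pair (U := R_NormedModule) (V := R_NormedModule)); assumption.
Qed.

Lemma is_CInt_Re (f : R -> C) (a b : R) (l : C) :
  is_CInt f a b l -> is_RInt (fun t => Re (f t)) a b (Re l).
Proof.
intros H; apply (is_RInt_fct_extend_fst (U := R_NormedModule) (V := R_NormedModule)) in H.
exact H.
Qed.

Lemma is_CInt_Im (f : R -> C) (a b : R) (l : C) :
  is_CInt f a b l -> is_RInt (fun t => Im (f t)) a b (Im l).
Proof.
intros H; apply (is_RInt_fct_extend_snd (U := R_NormedModule) (V := R_NormedModule)) in H.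
exact H.
Qed.

Lemma is_CInt_unique (f : R -> C) (a b : R) (l : C) : is_CInt f a b l -> CInt f a b = l.
Proof. intros H; apply (is_RInt_unique (V := C_R_CompleteNormedModule)), H. Qed.

Lemma is_CInt_eq (f : R -> C) (a b : R) (l l' : C) :
  is_CInt f a b l -> is_CInt f a b l' -> l = l'.
Proof. intros H H'; rewrite <- (is_CInt_unique _ _ _ _ H); apply is_CInt_unique, H'. Qed.

Lemma CInt_correct (f : R -> C) (a b : R) : a <= b ->
  (forall t, a <= t <= b -> Ccont f t) -> is_CInt f a b (CInt f a b).
Proof.
intros Hab Hf; apply (RInt_correct (V := C_R_CompleteNormedModule)).
apply (ex_RInt_continuous (V := C_R_CompleteNormedModule)).
intros t; rewrite Rmin_left, Rmax_right by assumption; apply Hf.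
Qed.

Lemma is_CInt_ext (f g : R -> C) (a b : R) (l : C) : a <= b ->
  (forall t, a <= t <= b -> f t = g t) -> is_CInt f a b l -> is_CInt g a b l.
Proof.
intros Hab H; apply is_RInt_ext; intros t; rewrite Rmin_left, Rmax_right by assumption.
intros Ht; apply H; lra.
Qed.

Lemma CInt_ext (f g : R -> C) (a b : R) : a <= b ->
  (forall t, a <= t <= b -> f t = g t) -> CInt f a b = CInt g a b.
Proof.
intros Hab H; apply (RInt_ext (V := C_R_CompleteNormedModule)); intros t.
rewrite Rmin_left, Rmax_right by assumption; intros Ht; apply H; lra.
Qed.

Lemma is_CInt_plus (f g : R -> C) (a b : R) (l m : C) :
  is_CInt f a b l -> is_CInt g a b m -> is_CInt (fun t => (f t + g t)%C) a b (l + m)%C.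
Proof. intros Hf Hg; exact (is_RInt_plus (V := C_R_NormedModule) f g a b l m Hf Hg). Qed.

Lemma is_CInt_mult_l (c : C) (f : R -> C) (a b : R) (l : C) :
  is_CInt f a b l -> is_CInt (fun t => (c * f t)%C) a b (c * l)%C.
Proof.
intros Hf; assert (H1 := is_CInt_Re _ _ _ _ Hf); assert (H2 := is_CInt_Im _ _ _ _ Hf).
apply is_CInt_parts; simpl.
- exact (is_RInt_minus (V := R_NormedModule) _ _ a b _ _
    (is_RInt_scal (V := R_NormedModule) _ a b (fst c) _ H1)
    (is_RInt_scal (V := R_NormedModule) _ a b (snd c) _ H2)).
- exact (is_RInt_plus (V := R_NormedModule) _ _ a b _ _
    (is_RInt_scal (V := R_NormedModule) _ a b (fst c) _ H2)
    (is_RInt_scal (V := R_NormedModule) _ a b (snd c) _ H1)).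
Qed.

Lemma is_CInt_minus (f g : R -> C) (a b : R) (l m : C) :
  is_CInt f a b l -> is_CInt g a b m -> is_CInt (fun t => (f t - g t)%C) a b (l - m)%C.
Proof. intros Hf Hg; exact (is_RInt_minus (V := C_R_NormedModule) f g a b l m Hf Hg). Qed.

Lemma is_CInt_const (c : C) (a b : R) : is_CInt (fun _ => c) a b (RtoC (b - a) * c)%C.
Proof.
apply is_CInt_parts; simpl.
- replace ((b - a) * fst c - 0 * snd c) with (scal (b - a) (fst c))
    by (unfold scal; simpl; unfold mult; simpl; ring).
  apply (is_RInt_const (V := R_NormedModule)).
- replace ((b - a) * snd c + 0 * fst c) with (scal (b - a) (snd c))
    by (unfold scal; simpl; unfold mult; simpl; ring).
  apply (is_RInt_const (V := R_NormedModule)).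
Qed.

Lemma is_CInt_Chasles (f : R -> C) (a b c : R) (l m : C) :
  is_CInt f a b l -> is_CInt f b c m -> is_CInt f a c (l + m)%C.
Proof. intros Hf Hg; exact (is_RInt_Chasles (V := C_R_NormedModule) f a b c l m Hf Hg). Qed.

Lemma CInt_Chasles (f : R -> C) (a b c : R) : a <= b -> b <= c ->
  (forall t, a <= t <= c -> Ccont f t) -> CInt f a c = (CInt f a b + CInt f b c)%C.
Proof.
intros Hab Hbc Hf; apply is_CInt_unique, (is_CInt_Chasles _ _ b);
  apply CInt_correct; try assumption; intros t Ht; apply Hf; lra.
Qed.

Lemma is_CInt_Cmod_le (f : R -> C) (g : R -> R) (a b : R) (l : C) (m : R) : a <= b ->
  (forall t, a <= t <= b -> Cmod (f t) <= g t) ->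
  is_CInt f a b l -> is_RInt g a b m -> Cmod l <= m.
Proof.
intros Hab Hfg Hf Hg; rewrite Cmod_norm.
apply (norm_RInt_le (V := C_R_NormedModule) f g a b); auto.
intros t Ht; specialize (Hfg t Ht); rewrite Cmod_norm in Hfg; exact Hfg.
Qed.

Lemma is_CInt_Cmod_le_const (f : R -> C) (a b : R) (l : C) (M : R) : a <= b ->
  (forall t, a <= t <= b -> Cmod (f t) <= M) -> is_CInt f a b l -> Cmod l <= (b - a) * M.
Proof.
intros Hab Hf Hl; apply (is_CInt_Cmod_le f (fun _ => M) a b); auto.
apply (is_RInt_const (V := R_NormedModule)).
Qed.

Lemma is_CInt_derive (F f : R -> C) (a b : R) : a <= b ->
  (forall t, a <= t <= b -> is_derive (fun t => Re (F t)) t (Re (f t))) ->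
  (forall t, a <= t <= b -> is_derive (fun t => Im (F t)) t (Im (f t))) ->
  (forall t, a <= t <= b -> Ccont f t) ->
  is_CInt f a b (F b - F a)%C.
Proof.
intros Hab H1 H2 Hf.
apply is_CInt_parts.
- apply (is_RInt_derive (V := R_CompleteNormedModule) (fun t => Re (F t)));
    intros t; rewrite Rmin_left, Rmax_right by assumption; intros Ht; auto.
  apply Ccont_Re; auto.
- apply (is_RInt_derive (V := R_CompleteNormedModule) (fun t => Im (F t)));
    intros t; rewrite Rmin_left, Rmax_right by assumption; intros Ht; auto.
  apply Ccont_Im; auto.
Qed.

Lemma is_RInt_continuous_le (f : R -> R) (a b : R) : a <= b ->
  (forall t, a <= t <= b -> continuous f t) -> is_RInt f a b (RInt f a b).
Proof.
intros Hab Hf; apply (RInt_correct (V := R_CompleteNormedModule)).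
apply (ex_RInt_continuous (V := R_CompleteNormedModule)).
intros t; rewrite Rmin_left, Rmax_right by assumption; apply Hf.
Qed.

(** * Contour integrals over rectangles and Goursat's theorem *)

Lemma Ccont_horizontal (f : C -> C) (x y : R) :
  Ccont (U := C_UniformSpace) f (x, y) -> Ccont (fun t => f (t, y)) x.
Proof.
intros Hf; apply (Ccont_comp _ (fun t => (t, y)) f); [|exact Hf].
apply Ccont_pair; [apply continuous_id|apply continuous_const].
Qed.

Lemma Ccont_vertical (f : C -> C) (x y : R) :
  Ccont (U := C_UniformSpace) f (x, y) -> Ccont (fun t => f (x, t)) y.
Proof.
intros Hf; apply (Ccont_comp _ (fun t => (x, t)) f); [|exact Hf].
apply Ccont_pair; [apply continuous_const|apply continuous_id].
Qed.

(** The counterclockwise contour integral, with dz = dx on the horizontal sides and dz = i dy on the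
    vertical ones. *)
Definition boundary_integral (f : C -> C) (a b c d : R) : C :=
  (CInt (fun x => f (x, c)) a b + Ci * CInt (fun y => f (b, y)) c d - (CInt (fun x => f (x, d)) a b
      + Ci * CInt (fun y => f (a, y)) c d))%C.

Lemma boundary_integral_affine (p q : C) (a b c d : R) : a <= b -> c <= d ->
  boundary_integral (fun z => (p + q * z)%C) a b c d = RtoC 0.
Proof.
intros Hab Hcd.
set (F := fun z : C => (p * z + q * RtoC (1 / 2) * (z * z))%C).
assert (Hh : forall y, CInt (fun x => (p + q * (x, y))%C) a b = (F (b, y) - F (a, y))%C).
{ intros y; apply is_CInt_unique.
  apply (is_CInt_derive (fun x => F (x, y))); [exact Hab| | |].
  - intros t _; unfold F; simpl; auto_derive; [auto|field].
  - intros t _; unfold F; simpl; auto_derive; [auto|field].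
  - intros t _; apply (Ccont_horizontal (fun z => (p + q * z)%C)).
    apply Ccont_plus; [apply Ccont_const|apply Ccont_mult; [apply Ccont_const|apply Ccont_id]]. }
assert (Hv : forall x, (Ci * CInt (fun y => (p + q * (x, y))%C) c d)%C =
   (F (x, d) - F (x, c))%C).
{ intros x.
  rewrite (is_CInt_unique _ _ _ (- Ci * F (x, d) - - Ci * F (x, c))%C).
  - replace (Ci * (- Ci * F (x, d) - - Ci * F (x, c)))%C
      with (- (Ci * Ci) * (F (x, d) - F (x, c)))%C by ring.
    replace (- (Ci * Ci))%C with (RtoC 1); [ring|].
    apply injective_projections; simpl; ring.
  - apply (is_CInt_derive (fun y => (- Ci * F (x, y))%C)); [exact Hcd| | |].
    + intros t _; unfold F; simpl; auto_derive; [auto|field].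
    + intros t _; unfold F; simpl; auto_derive; [auto|field].
    + intros t _; apply (Ccont_vertical (fun z => (p + q * z)%C)).
      apply Ccont_plus; [apply Ccont_const|apply Ccont_mult; [apply Ccont_const|apply Ccont_id]]. }
unfold boundary_integral; rewrite !Hh, !Hv; ring.
Qed.

Lemma is_boundary_integral_minus (f g : C -> C) (a b c d : R) : a <= b -> c <= d ->
  (forall x y, a <= x <= b -> c <= y <= d -> Ccont (U := C_UniformSpace) f (x, y)) ->
  (forall x y, a <= x <= b -> c <= y <= d -> Ccont (U := C_UniformSpace) g (x, y)) ->
  boundary_integral (fun z => (f z - g z)%C) a b c d =
  (boundary_integral f a b c d - boundary_integral g a b c d)%C.
Proof.
intros Hab Hcd Hf Hg; unfold boundary_integral.
assert (Hh : forall y, c <= y <= d ->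
  CInt (fun x => (f (x, y) - g (x, y))%C) a b =
  (CInt (fun x => f (x, y)) a b - CInt (fun x => g (x, y)) a b)%C).
{ intros y Hy; apply is_CInt_unique, is_CInt_minus; apply CInt_correct; try assumption;
    intros t Ht; [apply (Ccont_horizontal f)|apply (Ccont_horizontal g)]; auto. }
assert (Hv : forall x, a <= x <= b ->
  CInt (fun y => (f (x, y) - g (x, y))%C) c d =
  (CInt (fun y => f (x, y)) c d - CInt (fun y => g (x, y)) c d)%C).
{ intros y Hy; apply is_CInt_unique, is_CInt_minus; apply CInt_correct; try assumption;
    intros t Ht; [apply (Ccont_vertical f)|apply (Ccont_vertical g)]; auto. }
rewrite !Hh, !Hv by lra; ring.
Qed.

Lemma boundary_integral_bound (f : C -> C) (a b c d M : R) : a <= b -> c <= d ->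
  (forall x y, a <= x <= b -> c <= y <= d -> Ccont (U := C_UniformSpace) f (x, y)) ->
  (forall x y, a <= x <= b -> c <= y <= d -> Cmod (f (x, y)) <= M) ->
  Cmod (boundary_integral f a b c d) <= 2 * ((b - a) + (d - c)) * M.
Proof.
intros Hab Hcd Hf HM; unfold boundary_integral.
assert (Hh : forall y, c <= y <= d -> Cmod (CInt (fun x => f (x, y)) a b) <= (b - a) * M).
{ intros y Hy; apply (is_CInt_Cmod_le_const (fun x => f (x, y))); [exact Hab|auto|].
  apply CInt_correct; [exact Hab|]; intros t Ht; apply (Ccont_horizontal f); auto. }
assert (Hv : forall x, a <= x <= b -> Cmod (Ci * CInt (fun y => f (x, y)) c d) <= (d - c) * M).
{ intros x Hx; rewrite Cmod_mult, Cmod_Ci, Rmult_1_l.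
  apply (is_CInt_Cmod_le_const (fun y => f (x, y))); [exact Hcd|auto|].
  apply CInt_correct; [exact Hcd|]; intros t Ht; apply (Ccont_vertical f); auto. }
unfold Cminus at 1; eapply Rle_trans; [apply Cmod_triangle|]; rewrite Cmod_opp.
eapply Rle_trans; [apply Rplus_le_compat; apply Cmod_triangle|].
generalize (Hh c ltac:(lra)) (Hh d ltac:(lra)) (Hv a ltac:(lra)) (Hv b ltac:(lra)); lra.
Qed.

Theorem goursat_rectangle (f : C -> C) (a b c d : R) : a <= b -> c <= d ->
  (forall x y, a <= x <= b -> c <= y <= d -> Cdiff f (x, y)) ->
  boundary_integral f a b c d = RtoC 0.
Proof.
intros Hab Hcd Hf.
assert (Hc : forall x y, a <= x <= b -> c <= y <= d -> Ccont (U := C_UniformSpace) f (x, y))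
  by (intros; apply Cdiff_cont; auto).
apply additive_rectangle_zero; [exact Hab|exact Hcd| | |].
- intros a' m b' c' d' H1 H2 H3 H4 H5 H6 H7; unfold boundary_integral.
  rewrite !(CInt_Chasles _ a' m b'); try assumption; [ring| |];
    intros t Ht; apply (Ccont_horizontal f), Hc; lra.
- intros a' b' c' m d' H1 H2 H3 H4 H5 H6 H7; unfold boundary_integral.
  rewrite !(CInt_Chasles _ c' m d'); try assumption; [ring| |];
    intros t Ht; apply (Ccont_vertical f), Hc; lra.
- intros eps x y He Hx Hy.
  destruct (Hf x y Hx Hy) as [q [Hq Ef]].
  destruct (Ccont_eps _ _ Hq (eps / 2) ltac:(lra)) as [delta [Hd Hqd]].
  exists delta; split; [exact Hd|].
  intros a' b' c' d' Ha' Hb' Hc' Hd' H1 H2.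
  set (z := (x, y)) in *.
  (* The first-order Taylor polynomial of [f] at [z]: its boundary integral vanishes, and [f - p] is
     [(q w - q z) (w - z)]. *)
  set (p := fun w : C => (f z - q z * z + q z * w)%C).
  assert (Hp : forall w, Ccont (U := C_UniformSpace) p w).
  { intros w; apply Ccont_plus; [apply Ccont_const|].
    apply Ccont_mult; [apply Ccont_const|apply Ccont_id]. }
  replace (boundary_integral f a' b' c' d')
    with (boundary_integral (fun w => (f w - p w)%C) a' b' c' d').
  2: { rewrite is_boundary_integral_minus; [|lra|lra| |].
       - unfold p at 1; rewrite boundary_integral_affine by lra; ring.
       - intros; apply Hc; lra.
       - intros; apply Hp. }
  eapply Rle_trans.
  (* With s the half-perimeter, an integrand at most (eps/2) s over a perimeter 2 s gives eps
     s^2. *)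
  + apply (boundary_integral_bound _ a' b' c' d' (eps / 2 * ((b' - a') + (d' - c')))); [lra|lra| |].
    * intros; apply Ccont_minus; [apply Hc; lra|apply Hp].
    * intros u v Hu Hv.
      replace (f (u, v) - p (u, v))%C
        with ((q (u, v) - q z) * ((u, v) - z))%C
        by (unfold p; rewrite (Ef (u, v)); ring).
      rewrite Cmod_mult; apply Rmult_le_compat; try apply Cmod_ge_0.
      { left; apply Hqd; unfold z; simpl; apply Rabs_lt_between; lra. }
      eapply Rle_trans; [apply Cmod_le_parts|]; unfold z; simpl.
      apply Rplus_le_compat; apply Rabs_le_between; lra.
  + right; simpl; field.
Qed.

(** * Parameter integrals and Fubini's theorem *)

Lemma eps_Ccont_R (f : R -> C) (x : R) :
  (forall eps, 0 < eps -> exists delta, 0 < delta /\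
    forall t, Rabs (t - x) < delta -> Cmod (f t - f x) < eps) ->
  Ccont f x.
Proof.
intros H P [eps HP].
destruct (H eps (cond_pos eps)) as [d [Hd Hw]].
exists (mkposreal _ Hd); intros w H1; specialize (Hw w H1).
apply HP; split.
- change (Rabs (Re (f w) - Re (f x)) < eps).
  eapply Rle_lt_trans; [|exact Hw]; apply (re_le_Cmod (f w - f x)%C).
- change (Rabs (Im (f w) - Im (f x)) < eps).
  eapply Rle_lt_trans; [|exact Hw]; apply (Im_le_Cmod (f w - f x)%C).
Qed.

(** Heine's theorem along a vertical segment, bisected as the degenerate rectangle [x, x] x [c, d].
    Continuity is assumed at the points of the segment only, while [x'] is free to leave it; this is
    what a limit onto the edge of a domain requires. *)
Lemma uniform_continuity_fibre (F : C -> C) (x c d eps : R) : c <= d ->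
  (forall y, c <= y <= d -> Ccont (U := C_UniformSpace) F (x, y)) -> 0 < eps ->
  exists delta, 0 < delta /\ forall x' y, Rabs (x' - x) < delta -> c <= y <= d ->
    Cmod (F (x', y) - F (x, y)) < eps.
Proof.
intros Hcd HF He.
apply (rectangle_bisection (fun _ _ c d => exists delta, 0 < delta /\
  forall x' y, Rabs (x' - x) < delta -> c <= y <= d ->
    Cmod (F (x', y) - F (x, y)) < eps) x x c d (Rle_refl x) Hcd).
- intros a' b' c' d' _ _ _ _ _ _ [e1 [He1 H1]] _ [e2 [He2 H2]] _.
  exists (Rmin e1 e2); split; [apply Rmin_glb_lt; assumption|].
  intros x' y Hx Hy.
  assert (M1 := Rmin_l e1 e2); assert (M2 := Rmin_r e1 e2).
  destruct (Rle_dec y ((c' + d') / 2)); [apply H1|apply H2]; lra.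
- intros x0 y Hx0 Hy; replace x0 with x in * by lra; clear x0 Hx0.
  destruct (Ccont_eps _ _ (HF y Hy) (eps / 2) ltac:(lra)) as [e [He' H]].
  exists e; split; [exact He'|].
  intros a' b' c' d' _ _ Hc Hd _ Hw.
  exists e; split; [exact He'|]; intros x' v Hx' Hv.
  replace (F (x', v) - F (x, v))%C
    with (F (x', v) - F (x, y) + - (F (x, v) - F (x, y)))%C by ring.
  eapply Rle_lt_trans; [apply Cmod_triangle|]; rewrite Cmod_opp.
  assert (K1 : Cmod (F (x', v) - F (x, y)) < eps / 2).
  { apply H; simpl; [exact Hx'|apply Rabs_lt_between; lra]. }
  assert (K2 : Cmod (F (x, v) - F (x, y)) < eps / 2).
  { apply H; simpl; [rewrite Rminus_diag, Rabs_R0; exact He'|apply Rabs_lt_between; lra]. }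
  lra.
Qed.

Lemma Ccont_CInt_param (F : C -> C) (x c d : R) : c <= d ->
  (forall z, Ccont (U := C_UniformSpace) F z) ->
  Ccont (fun x => CInt (fun y => F (x, y)) c d) x.
Proof.
intros Hcd HF; apply eps_Ccont_R; intros eps He.
assert (He' : 0 < eps / (d - c + 1)) by (apply Rdiv_lt_0_compat; lra).
destruct (uniform_continuity_fibre F x c d _ Hcd (fun y _ => HF (x, y)) He') as [e [Hep H]].
exists e; split; [exact Hep|]; intros t Ht.
apply Rle_lt_trans with ((d - c) * (eps / (d - c + 1))).
- apply (is_CInt_Cmod_le_const (fun y => (F (t, y) - F (x, y))%C)); [exact Hcd| |].
  + intros y Hy; left; auto.
  + apply is_CInt_minus; apply CInt_correct; try assumption; intros y _;
      apply Ccont_vertical, HF.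
- apply Rlt_le_trans with ((d - c + 1) * (eps / (d - c + 1))).
  + apply Rmult_lt_compat_r; lra.
  + right; field; lra.
Qed.

Definition Cswap (z : C) : C := (snd z, fst z).

Lemma Ccont_swap (F : C -> C) :
  (forall z, Ccont (U := C_UniformSpace) F z) ->
  forall z, Ccont (U := C_UniformSpace) (fun w => F (Cswap w)) z.
Proof.
intros HF z; apply (Ccont_comp _ Cswap F); [|apply HF].
apply Ccont_pair; [apply (Ccont_Im _ (fun w => w))|apply (Ccont_Re _ (fun w => w))];
  apply Ccont_id.
Qed.

Lemma Ccont_CInt_param' (F : C -> C) (y a b : R) : a <= b ->
  (forall z, Ccont (U := C_UniformSpace) F z) ->
  Ccont (fun y => CInt (fun x => F (x, y)) a b) y.
Proof.
intros Hab HF; apply (Ccont_CInt_param (fun w => F (Cswap w)) y a b Hab).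
apply Ccont_swap, HF.
Qed.

Lemma CInt_CInt_near_const (F : C -> C) (p : C) (a b c d eps : R) : a <= b -> c <= d ->
  (forall z, Ccont (U := C_UniformSpace) F z) ->
  (forall x y, a <= x <= b -> c <= y <= d -> Cmod (F (x, y) - p) <= eps) ->
  Cmod (CInt (fun x => CInt (fun y => F (x, y)) c d) a b - RtoC (b - a) * (RtoC (d - c) * p)) <= (b
      - a) * ((d - c) * eps).
Proof.
intros Hab Hcd HF He.
apply (is_CInt_Cmod_le_const (fun x => (CInt (fun y => F (x, y)) c d - RtoC (d - c) * p)%C));
    [exact Hab| |].
- intros x Hx; apply (is_CInt_Cmod_le_const (fun y => (F (x, y) - p)%C)); [exact Hcd|auto|].
  apply is_CInt_minus; [|apply is_CInt_const].
  apply CInt_correct; [exact Hcd|]; intros; apply Ccont_vertical, HF.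
- apply is_CInt_minus; [|apply is_CInt_const].
  apply CInt_correct; [exact Hab|]; intros; apply Ccont_CInt_param; assumption.
Qed.

(** The difference of the iterated integrals is additive in the rectangle. On a small rectangle each
    of them is the area times the value of [F] at the point, up to eps times the area. *)
Theorem fubini_rectangle (F : C -> C) (a b c d : R) : a <= b -> c <= d ->
  (forall z, Ccont (U := C_UniformSpace) F z) ->
  CInt (fun x => CInt (fun y => F (x, y)) c d) a b =
  CInt (fun y => CInt (fun x => F (x, y)) a b) c d.
Proof.
intros Hab Hcd HF.
set (Phi := fun a b c d => (CInt (fun x => CInt (fun y => F (x, y)) c d) a b - CInt (fun y => CInt
    (fun x => F (x, y)) a b) c d)%C).
(* Stated for every [G], so that the transposed function yields the splitting in the other
   direction. *)
assert (Hsplit : forall (G : C -> C) a m b c d, a <= m -> m <= b -> c <= d ->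
  (forall z, Ccont (U := C_UniformSpace) G z) ->
  CInt (fun x => CInt (fun y => G (x, y)) c d) a b =
    (CInt (fun x => CInt (fun y => G (x, y)) c d) a m + CInt (fun x => CInt (fun y => G (x, y)) c
        d) m b)%C /\
  CInt (fun y => CInt (fun x => G (x, y)) a b) c d =
    (CInt (fun y => CInt (fun x => G (x, y)) a m) c d + CInt (fun y => CInt (fun x => G (x, y)) m
        b) c d)%C).
{ clear - a; intros G a' m b' c' d' H1 H2 H3 HG; split.
  - apply CInt_Chasles; try assumption; intros; apply Ccont_CInt_param; assumption.
  - rewrite (CInt_ext _ (fun y => (CInt (fun x => G (x, y)) a' m + CInt (fun x => G (x, y)) m
      b')%C)); [|exact H3|].
    + apply is_CInt_unique, is_CInt_plus; apply CInt_correct; try assumption;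
        intros; apply Ccont_CInt_param'; assumption.
    + intros y _; apply CInt_Chasles; try assumption; intros; apply Ccont_horizontal, HG. }
assert (E : Phi a b c d = RtoC 0).
{ apply additive_rectangle_zero; [exact Hab|exact Hcd| | |].
  - intros a' m b' c' d' H1 H2 H3 H4 H5 H6 H7; unfold Phi.
    destruct (Hsplit F a' m b' c' d') as [-> ->]; auto; ring.
  - intros a' b' c' m d' H1 H2 H3 H4 H5 H6 H7; unfold Phi.
    destruct (Hsplit (fun w => F (Cswap w)) c' m d' a' b') as [E1 E2]; auto.
    { apply Ccont_swap, HF. }
    unfold Cswap in E1, E2; simpl in E1, E2; rewrite E1, E2; ring.
  - intros eps x y He Hx Hy.
    destruct (Ccont_eps _ _ (HF (x, y)) eps He) as [delta [Hd Hqd]].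
    exists delta; split; [exact Hd|].
    intros a' b' c' d' Ha' Hb' Hc' Hd' H1 H2.
    assert (Hn : forall u v, a' <= u <= b' -> c' <= v <= d' ->
      Cmod (F (u, v) - F (x, y)) <= eps).
    { intros u v Hu Hv; left; apply Hqd; simpl; apply Rabs_lt_between; lra. }
    assert (K1 := CInt_CInt_near_const F (F (x, y)) a' b' c' d' eps ltac:(lra) ltac:(lra) HF Hn).
    assert (K2 := CInt_CInt_near_const (fun w => F (Cswap w)) (F (x, y)) c' d' a' b' eps
      ltac:(lra) ltac:(lra) (Ccont_swap F HF) (fun u v Hu Hv => Hn v u Hv Hu)).
    unfold Cswap in K2; simpl in K2.
    unfold Phi.
    match goal with |- Cmod (?P - ?Q) <= _ =>
      replace (P - Q)%C with (P - RtoC (b' - a') * (RtoC (d' - c') * F (x, y)) + - (Q - RtoC (d' -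
          c') * (RtoC (b' - a') * F (x, y))))%C by ring
    end.
    eapply Rle_trans; [apply Cmod_triangle|]; rewrite Cmod_opp.
    eapply Rle_trans; [apply Rplus_le_compat; [exact K1|exact K2]|].
    replace ((b' - a') * ((d' - c') * eps) + (d' - c') * ((b' - a') * eps))
      with (eps * (2 * (b' - a') * (d' - c'))) by ring.
    apply Rmult_le_compat_l; [lra|].
    generalize (pow2_ge_0 (b' - a')) (pow2_ge_0 (d' - c')); lra. }
unfold Phi in E.
match goal with |- ?P = ?Q => replace P with (P - Q + Q)%C by ring end.
rewrite E; ring.
Qed.

(** * Laguerre polynomials *)

(** The derivation lemmas leave equations typed in the carrier of a Coquelicot structure; restating
    them in [R] lets [ring] find its ring. *)
Ltac ring_R := match goal with |- @eq _ ?a ?b => change (@eq R a b); ring end.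

(** The derivative of [laguerre k], as [laguerre_derive] confirms. Taking the classical relation
    between consecutive derivatives as the definition avoids differentiating the explicit sum. *)
Fixpoint laguerre_deriv (k : nat) (x : R) : R :=
  match k with
  | O => 0
  | S k => laguerre_deriv k x - laguerre k x
  end.

Lemma Binomial_C_diag (n : nat) : Binomial.C n n = 1.
Proof.
unfold Binomial.C; rewrite Nat.sub_diag; simpl; field; apply INR_fact_neq_0.
Qed.

Lemma Binomial_C_0 (n : nat) : Binomial.C n 0 = 1.
Proof.
unfold Binomial.C; rewrite Nat.sub_0_r; simpl; field; apply INR_fact_neq_0.
Qed.

Lemma Binomial_C_absorb (n j : nat) : (j <= n)%nat ->
  Binomial.C (S n) (S j) = INR (S n) / INR (S j) * Binomial.C n j.
Proof.
intros H; unfold Binomial.C.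
replace (S n - S j)%nat with (n - j)%nat by lia.
rewrite !fact_simpl, !mult_INR.
field; repeat split; try apply INR_fact_neq_0; apply not_0_INR; lia.
Qed.

Lemma laguerre_0 (x : R) : laguerre 0 x = 1.
Proof. unfold laguerre; simpl; rewrite Binomial_C_0; field. Qed.

Lemma laguerre_deriv_expand (k : nat) (x : R) :
  laguerre_deriv (S k) x =
  - sum_f_R0 (fun j => Binomial.C (S k) (S j) * ((- x) ^ j / INR (fact j))) k.
Proof.
induction k as [|k IH].
- simpl; rewrite laguerre_0, Binomial_C_diag; field.
- change (laguerre_deriv (S k) x - laguerre (S k) x =
    - sum_f_R0 (fun j => Binomial.C (S (S k)) (S j) * ((- x) ^ j / INR (fact j))) (S k)).
  rewrite IH; unfold laguerre; rewrite !tech5, !Binomial_C_diag.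
  rewrite (sum_eq (fun j => Binomial.C (S (S k)) (S j) * ((- x) ^ j / INR (fact j)))
    (fun j => Binomial.C (S k) j * ((- x) ^ j / INR (fact j)) +
              Binomial.C (S k) (S j) * ((- x) ^ j / INR (fact j)))).
  + rewrite sum_plus; ring.
  + intros i Hi; rewrite <- pascal by lia; ring.
Qed.

(** Pascal's rule gives the difference of consecutive polynomials the coefficients C(k, j), and
    absorption turns them into those of the derivative. This relation and the definition of
    [laguerre_deriv] imply every later identity. *)
Lemma laguerre_S (k : nat) (x : R) :
  laguerre (S k) x = laguerre k x + x * laguerre_deriv (S k) x / INR (S k).
Proof.
assert (Hk : INR (S k) <> 0) by (apply not_0_INR; lia).
rewrite laguerre_deriv_expand.
assert (E : laguerre (S k) x - laguerre k x =
  sum_f_R0 (fun j => Binomial.C k j * ((- x) ^ (S j) / INR (fact (S j)))) k).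
{ unfold laguerre; rewrite (decomp_sum _ (S k)) by lia; cbn [pred].
  destruct k as [|k].
  - simpl; rewrite !Binomial_C_0, Binomial_C_diag; field.
  - rewrite (decomp_sum (fun j => Binomial.C (S k) j * ((- x) ^ j / INR (fact j))) (S k)) by lia.
    cbn [pred]; rewrite !tech5, !Binomial_C_0, !Binomial_C_diag.
    rewrite (sum_eq (fun i => Binomial.C (S (S k)) (S i) * ((- x) ^ (S i) / INR (fact (S i))))
     (fun i => Binomial.C (S k) i * ((- x) ^ (S i) / INR (fact (S i))) +
               Binomial.C (S k) (S i) * ((- x) ^ (S i) / INR (fact (S i))))).
    + rewrite sum_plus; ring.
    + intros i Hi; rewrite <- pascal by lia; ring. }
replace (laguerre (S k) x) with (laguerre k x + (laguerre (S k) x - laguerre k x)) by ring.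
rewrite E; f_equal.
replace (x * - sum_f_R0 (fun j => Binomial.C (S k) (S j) * ((- x) ^ j / INR (fact j))) k / INR (S k))
  with (- x / INR (S k) * sum_f_R0 (fun j => Binomial.C (S k) (S j) * ((- x) ^ j / INR (fact j))) k)
  by (field; exact Hk).
rewrite scal_sum; apply sum_eq; intros j Hj.
rewrite Binomial_C_absorb by exact Hj.
rewrite fact_simpl, mult_INR.
rewrite <- tech_pow_Rmult.
field; repeat split; try apply INR_fact_neq_0; try assumption; apply not_0_INR; lia.
Qed.

Lemma is_derive_id_mult (f : R -> R) (x l : R) :
  is_derive f x l -> is_derive (fun x => x * f x) x (1 * f x + x * l).
Proof.
intros H.
exact (is_derive_mult (K := R_AbsRing) (fun x => x) f x 1 l
  (is_derive_id (K := R_AbsRing) x) H Rmult_comm).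
Qed.

(** The derivative and the Laguerre equation in the form (x L')' = x L' - k L are proved together.
    Both at degree k make the derivative of x L_(k+1)' equal to -(k+1) L_k, and [laguerre_S] then
    yields L_(k+1)'. *)
Lemma laguerre_derive (k : nat) (x : R) :
  is_derive (laguerre k) x (laguerre_deriv k x) /\
  is_derive (fun x => x * laguerre_deriv k x) x (x * laguerre_deriv k x - INR k * laguerre k x).
Proof.
induction k as [|k [IH1 IH2]].
- split.
  + apply (is_derive_ext (fun _ => 1)); [intros t; symmetry; apply laguerre_0|].
    apply (is_derive_const (K := R_AbsRing) (V := R_NormedModule)).
  + simpl; apply (is_derive_ext (fun _ => 0)); [intros t; simpl; ring_R|].
    replace (x * 0 - 0 * laguerre 0 x) with 0 by ring.
    apply (is_derive_const (K := R_AbsRing) (V := R_NormedModule)).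
- assert (Hk : INR (S k) <> 0) by (apply not_0_INR; lia).
  assert (H2 : is_derive (fun x => x * laguerre_deriv (S k) x) x (- INR (S k) * laguerre k x)).
  { apply (is_derive_ext (fun x => x * laguerre_deriv k x - x * laguerre k x)).
    { intros t; simpl; ring_R. }
    replace (- INR (S k) * laguerre k x) with
      ((x * laguerre_deriv k x - INR k * laguerre k x) -
       (1 * laguerre k x + x * laguerre_deriv k x)) by (rewrite S_INR; ring).
    apply (is_derive_minus (K := R_AbsRing) (V := R_NormedModule)); [exact IH2|].
    apply is_derive_id_mult, IH1. }
  split.
  + apply (is_derive_ext (fun x => laguerre k x + / INR (S k) * (x * laguerre_deriv (S k) x))).
    { intros t; rewrite laguerre_S; unfold Rdiv; ring_R. }
    replace (laguerre_deriv (S k) x) with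
      (laguerre_deriv k x + / INR (S k) * (- INR (S k) * laguerre k x))
      by (simpl laguerre_deriv; field; exact Hk).
    apply (is_derive_plus (K := R_AbsRing) (V := R_NormedModule)); [exact IH1|].
    apply is_derive_scal; exact H2.
  + replace (x * laguerre_deriv (S k) x - INR (S k) * laguerre (S k) x)
      with (- INR (S k) * laguerre k x) by (rewrite laguerre_S; field; exact Hk).
    exact H2.
Qed.

Lemma laguerre_three_term (k : nat) (x : R) :
  INR (S (S k)) * laguerre (S (S k)) x =
  (2 * INR (S k) + 1 - x) * laguerre (S k) x - INR (S k) * laguerre k x.
Proof.
assert (H1 := laguerre_S k x); assert (H2 := laguerre_S (S k) x).
assert (Hk : INR (S k) <> 0) by (apply not_0_INR; lia).
assert (Hk' : INR (S (S k)) <> 0) by (apply not_0_INR; lia).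
change (laguerre_deriv (S (S k)) x) with (laguerre_deriv (S k) x - laguerre (S k) x) in H2.
assert (E1 : x * laguerre_deriv (S k) x = INR (S k) * (laguerre (S k) x - laguerre k x))
  by (rewrite H1; field; exact Hk).
assert (E2 : INR (S (S k)) * laguerre (S (S k)) x = INR (S (S k)) * laguerre (S k) x +
  (x * laguerre_deriv (S k) x - x * laguerre (S k) x)) by (rewrite H2; field; exact Hk').
rewrite E2, E1, (S_INR (S k)); ring.
Qed.

(** The factor [x - y] is what later cancels against the Cauchy kernel, in
    [laguerre_kernel_stieltjes]. *)
Lemma christoffel_darboux (N : nat) (x y : R) :
  (x - y) * sum_f_R0 (fun k => laguerre k x * laguerre k y) N =
  INR (S N) * (laguerre N x * laguerre (S N) y - laguerre (S N) x * laguerre N y).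
Proof.
induction N as [|N IH].
- simpl; rewrite !laguerre_S, !laguerre_0; simpl; rewrite !laguerre_0; field.
- rewrite tech5, Rmult_plus_distr_l, IH.
  replace (INR (S (S N)) * (laguerre (S N) x * laguerre (S (S N)) y -
      laguerre (S (S N)) x * laguerre (S N) y)) with
    (laguerre (S N) x * (INR (S (S N)) * laguerre (S (S N)) y) -
      (INR (S (S N)) * laguerre (S (S N)) x) * laguerre (S N) y) by ring.
  rewrite !laguerre_three_term; ring.
Qed.

(** * Bounds of Laguerre polynomials *)

Lemma derive_nonpos_le (f f' : R -> R) (x : R) : 0 <= x ->
  (forall t, is_derive f t (f' t)) -> (forall t, 0 <= t -> f' t <= 0) -> f x <= f 0.
Proof.
intros Hx Hd Hn.
destruct (MVT_gen f 0 x f') as [c [Hc E]].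
- intros t _; apply Hd.
- intros t _; apply continuity_pt_filterlim, (ex_derive_continuous (V := R_NormedModule)).
  exists (f' t); apply Hd.
- rewrite Rmin_left, Rmax_right in Hc by exact Hx.
  specialize (Hn c (proj1 Hc)); nra.
Qed.

Lemma laguerre_at_0 (k : nat) : laguerre k 0 = 1.
Proof.
induction k as [|k IH]; [apply laguerre_0|].
rewrite laguerre_S, IH; unfold Rdiv; ring.
Qed.

(* With u_k = exp(-x/2) L_k, the recursion L_k' = L_(k-1)' - L_(k-1) telescopes
   the derivative of u_0^2 + ... + u_k^2 to a negative square. *)
Lemma laguerre_bound (k : nat) (x : R) : 0 <= x ->
  exp (- x) * laguerre k x ^ 2 <= INR k + 1.
Proof.
intros Hx.
set (S0 := fun x => exp (- x) * sum_f_R0 (fun j => laguerre j x ^ 2) k).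
assert (Hsum : forall n x, is_derive (fun x => sum_f_R0 (fun j => laguerre j x ^ 2) n) x
   (sum_f_R0 (fun j => laguerre j x ^ 2) n - laguerre_deriv (S n) x ^ 2)).
{ clear; intros n x.
  assert (Hsq : forall j, is_derive (fun x => laguerre j x ^ 2) x
     (2 * laguerre j x * laguerre_deriv j x)).
  { intros j.
    replace (2 * laguerre j x * laguerre_deriv j x)
      with (INR 2 * laguerre_deriv j x * laguerre j x ^ (pred 2)) by (simpl; ring).
    apply is_derive_pow, laguerre_derive. }
  induction n as [|n IH].
  - change (is_derive (fun x => laguerre 0 x ^ 2) x (laguerre 0 x ^ 2 - laguerre_deriv 1 x ^ 2)).
    replace (laguerre 0 x ^ 2 - laguerre_deriv 1 x ^ 2)
      with (2 * laguerre 0 x * laguerre_deriv 0 x) by (simpl; rewrite laguerre_0; ring).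
    apply Hsq.
  - apply (is_derive_ext (fun x => sum_f_R0 (fun j => laguerre j x ^ 2) n + laguerre (S n) x ^ 2)).
    { intros t; reflexivity. }
    rewrite tech5.
    replace (sum_f_R0 (fun j => laguerre j x ^ 2) n + laguerre (S n) x ^ 2 - laguerre_deriv (S (S
        n)) x ^ 2)
      with ((sum_f_R0 (fun j => laguerre j x ^ 2) n - laguerre_deriv (S n) x ^ 2) +
        2 * laguerre (S n) x * laguerre_deriv (S n) x).
    + apply (is_derive_plus (K := R_AbsRing) (V := R_NormedModule)); [exact IH|apply Hsq].
    + change (laguerre_deriv (S (S n)) x) with (laguerre_deriv (S n) x - laguerre (S n) x); ring. }
assert (HS : S0 x <= S0 0).
{ apply (derive_nonpos_le S0 (fun t => - exp (- t) * laguerre_deriv (S k) t ^ 2)); [exact Hx| |].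
  - intros t; unfold S0.
    replace (- exp (- t) * laguerre_deriv (S k) t ^ 2) with
      (- exp (- t) * sum_f_R0 (fun j => laguerre j t ^ 2) k +
       exp (- t) * (sum_f_R0 (fun j => laguerre j t ^ 2) k - laguerre_deriv (S k) t ^ 2)) by ring.
    apply (is_derive_mult (K := R_AbsRing) (fun t => exp (- t))); [|apply Hsum|intros; apply Rmult_comm].
    auto_derive; [auto|ring].
  - intros t _; generalize (exp_pos (- t)) (pow2_ge_0 (laguerre_deriv (S k) t)); intros; nra. }
assert (H0 : S0 0 = INR k + 1).
{ unfold S0; rewrite Ropp_0, exp_0, Rmult_1_l.
  rewrite (sum_eq _ (fun _ => 1)); [rewrite sum_cte, S_INR; ring|].
  intros; rewrite laguerre_at_0; ring. }
rewrite <- H0; eapply Rle_trans; [|exact HS]; unfold S0.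
apply Rmult_le_compat_l; [left; apply exp_pos|].
destruct k as [|k]; [simpl; lra|].
rewrite tech5.
assert (0 <= sum_f_R0 (fun j => laguerre j x ^ 2) k)
  by (apply cond_pos_sum; intros; apply pow2_ge_0).
lra.
Qed.

Lemma laguerre_abs_bound (k : nat) (x : R) : 0 <= x ->
  Rabs (laguerre k x) <= (INR k + 1) * exp (x / 2).
Proof.
intros Hx; assert (H := laguerre_bound k x Hx).
assert (Hk : 0 <= INR k) by apply pos_INR.
assert (He : 0 < exp (x / 2)) by apply exp_pos.
apply Rsqr_incr_0_var; [|nra].
rewrite <- Rsqr_abs; unfold Rsqr.
replace ((INR k + 1) * exp (x / 2) * ((INR k + 1) * exp (x / 2)))
  with ((INR k + 1) ^ 2 * (exp (x / 2) * exp (x / 2))) by ring.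
rewrite <- exp_plus; replace (x / 2 + x / 2) with x by field.
assert (E : exp x * exp (- x) = 1) by (rewrite <- exp_plus, Rplus_opp_r; apply exp_0).
assert (Hx1 := exp_pos x).
apply Rle_trans with (exp x * (INR k + 1)).
- replace (laguerre k x * laguerre k x) with (exp x * (exp (- x) * laguerre k x ^ 2))
    by (rewrite <- Rmult_assoc, E; ring).
  apply Rmult_le_compat_l; lra.
- rewrite (Rmult_comm _ (exp x)); apply Rmult_le_compat_l; [lra|]; simpl; nra.
Qed.

Lemma laguerre_deriv_ex_derive (k : nat) (x : R) : ex_derive (laguerre_deriv k) x.
Proof.
induction k as [|k IH]; [apply ex_derive_const|].
apply (ex_derive_minus (K := R_AbsRing) (V := R_NormedModule)); [exact IH|].
exists (laguerre_deriv k x); apply laguerre_derive.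
Qed.

(* The energy (k + 1/2 - x/4) u^2 + x u'^2 of u = exp(-x/2) L_k, which solves
   (x u')' = - (k + 1/2 - x/4) u, is nonincreasing. *)
Lemma laguerre_energy (k : nat) (x : R) : 0 <= x <= 2 * INR k + 1 ->
  exp (- x) * laguerre k x ^ 2 <= 2.
Proof.
intros Hx.
assert (Hk : 0 <= INR k) by apply pos_INR.
set (E := fun x => exp (- x) * ((INR k + 1 / 2) * laguerre k x ^ 2 +
   x * laguerre_deriv k x * (laguerre_deriv k x - laguerre k x))).
assert (HE : E x <= E 0).
{ apply (derive_nonpos_le E (fun t => - exp (- t) *
    ((laguerre_deriv k t - laguerre k t / 2) ^ 2 + laguerre k t ^ 2 / 4))); [lra| |].
  - intros t; unfold E.
    destruct (laguerre_derive k t) as [H1 H2].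
    destruct (laguerre_deriv_ex_derive k t) as [d Hd].
    assert (Ed : laguerre_deriv k t + t * d = t * laguerre_deriv k t - INR k * laguerre k t).
    { assert (H3 : is_derive (fun x => x * laguerre_deriv k x) t
        (1 * laguerre_deriv k t + t * d)) by (apply is_derive_id_mult, Hd).
      apply is_derive_unique in H2; apply is_derive_unique in H3.
      rewrite H2 in H3; lra. }
    assert (Hd1 : Derive (fun x => laguerre_deriv k x) t = d) by (apply is_derive_unique, Hd).
    assert (Hd2 : Derive (fun x => laguerre k x) t = laguerre_deriv k t) by (apply is_derive_unique, H1).
    auto_derive.
    + repeat split; [exists (laguerre_deriv k t); exact H1|exists d; exact Hd|
        exists d; exact Hd|exists (laguerre_deriv k t); exact H1].
    + rewrite Hd1, Hd2.
      set (L := laguerre k t) in *; set (D := laguerre_deriv k t) in *.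
      assert (Ed' : t * d = t * D - INR k * L - D) by lra.
      match goal with |- ?lhs = _ => replace lhs with (exp (- t) *
         (- ((INR k + 1 / 2) * L ^ 2 + t * D * (D - L)) + (INR k + 1 / 2) * (2 * D * L)
          + D * (D - L) + (t * d) * (D - L) + D * (t * d) - t * D * D)) by ring end.
      rewrite Ed'; field.
  - intros t _; generalize (exp_pos (- t)) (pow2_ge_0 (laguerre_deriv k t - laguerre k t / 2))
      (pow2_ge_0 (laguerre k t)); intros; nra. }
assert (H0 : E 0 = INR k + 1 / 2).
{ unfold E; rewrite Ropp_0, exp_0, laguerre_at_0; ring. }
assert (K : exp (- x) * laguerre k x ^ 2 * ((INR k + 1 / 2) / 2) <= E x).
{ unfold E; rewrite Rmult_assoc; apply Rmult_le_compat_l; [left; apply exp_pos|].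
  assert (0 <= x * (laguerre_deriv k x - laguerre k x / 2) ^ 2)
    by (apply Rmult_le_pos; [lra|apply pow2_ge_0]).
  assert (0 <= ((2 * INR k + 1) - x) * laguerre k x ^ 2)
    by (apply Rmult_le_pos; [lra|apply pow2_ge_0]).
  lra. }
rewrite H0 in HE; nra.
Qed.

(** The energy bound covers the degrees with x <= 2 k + 1. The others satisfy k < x / 2, where a
    bound linear in the degree is enough. *)
Lemma laguerre_bounded_in_degree (x : R) : 0 <= x ->
  exists B, 0 < B /\ forall k, Rabs (laguerre k x) <= B.
Proof.
intros Hx.
destruct (INR_unbounded x) as [m Hm].
assert (Hm0 : 0 <= INR m) by apply pos_INR.
assert (He := exp_pos (x / 2)).
exists ((INR m + 3) * exp (x / 2)); split; [nra|]; intros k.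
destruct (Rle_dec x (2 * INR k + 1)) as [H|H].
- assert (K := laguerre_energy k x (conj Hx H)).
  apply Rsqr_incr_0_var; [|nra].
  rewrite <- Rsqr_abs; unfold Rsqr.
  assert (E : exp x * exp (- x) = 1) by (rewrite <- exp_plus, Rplus_opp_r; apply exp_0).
  assert (E2 : exp (x / 2) * exp (x / 2) = exp x) by (rewrite <- exp_plus; f_equal; field).
  assert (Hx1 := exp_pos x).
  replace (laguerre k x * laguerre k x) with (exp x * (exp (- x) * laguerre k x ^ 2))
    by (rewrite <- Rmult_assoc, E; ring).
  replace ((INR m + 3) * exp (x / 2) * ((INR m + 3) * exp (x / 2)))
    with (exp x * (INR m + 3) ^ 2) by (rewrite <- E2; ring).
  apply Rmult_le_compat_l; [lra|]; simpl; nra.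
- eapply Rle_trans; [apply laguerre_abs_bound, Hx|].
  apply Rmult_le_compat_r; [lra|].
  assert (2 * INR k + 1 < x) by lra; assert (0 <= INR k) by apply pos_INR; lra.
Qed.

(** * Laplace and Stieltjes transforms of Laguerre polynomials *)

(** Integration by parts in the form of a total derivative. With p = 1 and p = L_(k+1) - L_k, whose
    derivative is -L_k, it gives the recursion of the truncated Laplace transforms. *)
Lemma is_CInt_exp_mul (s : C) (p p' : R -> R) (a b : R) : a <= b ->
  (forall t, is_derive p t (p' t)) -> (forall t, continuous p' t) ->
  is_CInt (fun t => (Cexp (- (s * t)) * (RtoC (p' t) - s * RtoC (p t)))%C) a b
    (Cexp (- (s * b)) * RtoC (p b) - Cexp (- (s * a)) * RtoC (p a))%C.
Proof.
intros Hab Hp Hc.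
apply (is_CInt_derive (fun t => (Cexp (- (s * t)) * RtoC (p t))%C)).
- exact Hab.
- intros t _; unfold Cexp, Re, Im; simpl.
  assert (D : Derive (fun x => p x) t = p' t) by apply is_derive_unique, Hp.
  auto_derive; [repeat split; exists (p' t); apply Hp|].
  rewrite D; unfold Rminus; ring.
- intros t _; unfold Cexp, Re, Im; simpl.
  assert (D : Derive (fun x => p x) t = p' t) by apply is_derive_unique, Hp.
  auto_derive; [repeat split; exists (p' t); apply Hp|].
  rewrite D; unfold Rminus; ring.
- intros t _; apply Ccont_mult.
  + apply Ccont_exp, Ccont_opp, Ccont_mult; [apply Ccont_const|].
    apply Ccont_RtoC, continuous_id.
  + apply Ccont_minus; [apply Ccont_RtoC, Hc|].
    apply Ccont_mult; [apply Ccont_const|apply Ccont_RtoC].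
    apply (ex_derive_continuous (V := R_NormedModule)); exists (p' t); apply Hp.
Qed.

Lemma continuous_laguerre (k : nat) (x : R) : continuous (laguerre k) x.
Proof.
apply (ex_derive_continuous (V := R_NormedModule)).
exists (laguerre_deriv k x); apply laguerre_derive.
Qed.

Definition laguerre_laplace (k : nat) (s : C) (X : R) : C :=
  CInt (fun x => (Cexp (- (s * x)) * RtoC (laguerre k x))%C) 0 X.

Lemma laguerre_laplace_correct (k : nat) (s : C) (X : R) : 0 <= X ->
  is_CInt (fun x => (Cexp (- (s * x)) * RtoC (laguerre k x))%C) 0 X
    (laguerre_laplace k s X).
Proof.
intros HX; apply CInt_correct; [exact HX|]; intros t _; apply Ccont_mult.
- apply Ccont_exp, Ccont_opp, Ccont_mult; [apply Ccont_const|].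
  apply Ccont_RtoC, continuous_id.
- apply Ccont_RtoC, continuous_laguerre.
Qed.

Lemma laguerre_laplace_0 (s : C) (X : R) : 0 <= X ->
  (s * laguerre_laplace 0 s X)%C = (1 - Cexp (- (s * X)))%C.
Proof.
intros HX.
assert (H := is_CInt_mult_l s _ _ _ _ (laguerre_laplace_correct 0 s X HX)).
assert (H2 := is_CInt_mult_l (- 1)%C _ _ _ _
  (is_CInt_exp_mul s (fun _ => 1) (fun _ => 0) 0 X HX
    (fun t => is_derive_const (K := R_AbsRing) (V := R_NormedModule) 1 t) (fun t =>
        continuous_const 0 t))).
rewrite <- (is_CInt_unique _ _ _ _ H).
replace (1 - Cexp (- (s * X)))%C with
  (- 1 * (Cexp (- (s * X)) * 1 - Cexp (- (s * 0)) * 1))%C.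
- apply is_CInt_unique; revert H2; apply is_CInt_ext; [exact HX|].
  intros t _; rewrite laguerre_0; ring.
- replace (- (s * 0))%C with (RtoC 0) by ring; rewrite Cexp_0; ring.
Qed.

Lemma laguerre_laplace_S (k : nat) (s : C) (X : R) : 0 <= X ->
  (s * laguerre_laplace (S k) s X)%C =
  ((s - 1) * laguerre_laplace k s X - Cexp (- (s * X)) * RtoC (laguerre (S k) X - laguerre k X))%C.
Proof.
intros HX.
assert (H1 := is_CInt_mult_l s _ _ _ _ (laguerre_laplace_correct (S k) s X HX)).
assert (H0 := is_CInt_mult_l (s - 1)%C _ _ _ _ (laguerre_laplace_correct k s X HX)).
assert (H2 := is_CInt_exp_mul s (fun x => laguerre (S k) x - laguerre k x)
  (fun x => - laguerre k x) 0 X HX).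
rewrite <- (is_CInt_unique _ _ _ _ H1).
assert (Hd : forall t, is_derive (fun x => laguerre (S k) x - laguerre k x) t (- laguerre k t)).
{ intros t; replace (- laguerre k t) with (laguerre_deriv (S k) t - laguerre_deriv k t)
    by (simpl; ring).
  exact (is_derive_minus (K := R_AbsRing) (V := R_NormedModule) (laguerre (S k)) (laguerre k) t
    _ _ (proj1 (laguerre_derive (S k) t)) (proj1 (laguerre_derive k t))). }
assert (H3 := is_CInt_minus _ _ _ _ _ _ H0 (H2
  Hd (fun t => continuous_opp (V := R_NormedModule) _ _ (continuous_laguerre k t)))).
cbv beta in H3; rewrite !laguerre_at_0, Rminus_diag, Cmult_0_r in H3.
replace (Cexp (- (s * X)) * RtoC (laguerre (S k) X - laguerre k X) - 0)%C
  with (Cexp (- (s * X)) * RtoC (laguerre (S k) X - laguerre k X))%C in H3 by ring.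
apply is_CInt_unique; revert H3; apply is_CInt_ext; [exact HX|].
intros t _; rewrite RtoC_opp, RtoC_minus; ring.
Qed.

Lemma exp_le (x y : R) : x <= y -> exp x <= exp y.
Proof. intros [H| ->]; [left; apply exp_increasing, H|right; reflexivity]. Qed.

Lemma Re_scal_exponent (s : C) (X : R) : Re (- (s * X)) = - (Re s * X).
Proof. simpl; unfold Re; ring. Qed.

Lemma Cmod_minus_1_le (s : C) : 1 / 2 <= Re s -> Cmod (s - 1) <= Cmod s.
Proof.
destruct s as [p q]; simpl; intros H.
apply Rsqr_incr_0_var; [|apply Cmod_ge_0].
rewrite !Rsqr_pow2, !Cmod2_alt; unfold Re, Im; simpl; nra.
Qed.

(** (s - 1)^k / s^(k+1) is the transform over the whole half-line. In the half-plane Re s >= 1/2 the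
    ratio (s - 1)/s has modulus at most 1, so the boundary terms at [X] add up without being
    amplified. *)
Lemma laguerre_laplace_error (k : nat) (s : C) (X : R) : 0 <= X ->
  1 / 2 <= Re s ->
  Cmod (laguerre_laplace k s X - (s - 1) ^ k / s ^ (S k)) <=
  4 * exp (- (Re s * X)) * sum_f_R0 (fun j => Rabs (laguerre j X)) k.
Proof.
intros HX Hs; assert (Hs1 := Cmod_minus_1_le s Hs).
set (e := exp (- (Re s * X))).
assert (He : 0 < e) by apply exp_pos.
assert (Hms : 1 / 2 <= Cmod s).
{ eapply Rle_trans; [|apply re_le_Cmod]; rewrite Rabs_pos_eq; lra. }
assert (Hs0 : s <> RtoC 0) by (apply Cmod_gt_0; lra).
assert (Hcancel : forall z, Cmod z <= 2 * Cmod (s * z)).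
{ intros z; rewrite Cmod_mult; generalize (Cmod_ge_0 z); nra. }
(* The extra term stores the share of L_k(X) in the boundary term of the next step, where L_(k+1) -
   L_k appears. *)
assert (K : forall k, Cmod (laguerre_laplace k s X - (s - 1) ^ k / s ^ (S k)) + 2 * e * Rabs
    (laguerre k X) <=
   4 * e * sum_f_R0 (fun j => Rabs (laguerre j X)) k).
{ clear k; induction k as [|k IH].
  - assert (E : Cmod (laguerre_laplace 0 s X - (s - 1) ^ 0 / s ^ 1) <= 2 * e).
    { eapply Rle_trans; [apply Hcancel|].
      replace (s * (laguerre_laplace 0 s X - (s - 1) ^ 0 / s ^ 1))%C
        with (- Cexp (- (s * X)))%C.
      - rewrite Cmod_opp, Cmod_Cexp, Re_scal_exponent; fold e; lra.
      - transitivity (s * laguerre_laplace 0 s X - 1)%C.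
        + rewrite laguerre_laplace_0 by exact HX; ring.
        + simpl; field; exact Hs0. }
    simpl sum_f_R0; rewrite laguerre_0, Rabs_R1; lra.
  - assert (Hp : (s ^ (S k))%C <> RtoC 0) by (apply Cpow_nz, Hs0).
    assert (E : Cmod (laguerre_laplace (S k) s X - (s - 1) ^ (S k) / s ^ (S (S k))) <=
       Cmod (laguerre_laplace k s X - (s - 1) ^ k / s ^ (S k)) +
       2 * e * (Rabs (laguerre (S k) X) + Rabs (laguerre k X))).
    { replace (laguerre_laplace (S k) s X - (s - 1) ^ (S k) / s ^ (S (S k)))%C
      with ((s - 1) / s * (laguerre_laplace k s X - (s - 1) ^ k / s ^ (S k)) + - (Cexp (- (s * X))
          * RtoC (laguerre (S k) X - laguerre k X) / s))%C.
      - eapply Rle_trans; [apply Cmod_triangle|]; rewrite Cmod_opp, Cmod_mult.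
        apply Rplus_le_compat.
        + rewrite <- (Rmult_1_l (Cmod (laguerre_laplace k s X - _))) at 2.
          apply Rmult_le_compat_r; [apply Cmod_ge_0|].
          rewrite Cmod_div by exact Hs0.
          apply Rmult_le_reg_r with (Cmod s); [lra|].
          unfold Rdiv; rewrite Rmult_assoc, Rinv_l by lra; lra.
        + eapply Rle_trans; [apply Hcancel|].
          replace (s * (Cexp (- (s * X)) * RtoC (laguerre (S k) X - laguerre k X) / s))%C with
             (Cexp (- (s * X)) * RtoC (laguerre (S k) X - laguerre k X))%C by (field; exact Hs0).
          rewrite Cmod_mult, Cmod_Cexp, Re_scal_exponent, Cmod_R; fold e.
          rewrite Rmult_assoc; apply Rmult_le_compat_l; [lra|].
          apply Rmult_le_compat_l; [lra|].
          unfold Rminus; eapply Rle_trans; [apply Rabs_triang|]; rewrite Rabs_Ropp; lra.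
      - replace (laguerre_laplace (S k) s X)
          with (s * laguerre_laplace (S k) s X / s)%C by (field; exact Hs0).
        rewrite laguerre_laplace_S by exact HX.
        change (s ^ (S (S k)))%C with (s * s ^ (S k))%C.
        change ((s - 1) ^ (S k))%C with
          ((s - 1) * (s - 1) ^ k)%C.
        field; split; assumption. }
    rewrite tech5, Rmult_plus_distr_l; lra. }
specialize (K k); generalize (Rabs_pos (laguerre k X)); nra.
Qed.

Lemma sum_laguerre_bound (k : nat) (X : R) : 0 <= X ->
  sum_f_R0 (fun j => Rabs (laguerre j X)) k <= (INR k + 1) ^ 2 * exp (X / 2).
Proof.
intros HX.
apply Rle_trans with (sum_f_R0 (fun _ => (INR k + 1) * exp (X / 2)) k).
- apply sum_Rle; intros j Hj; eapply Rle_trans; [apply laguerre_abs_bound, HX|].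
  apply Rmult_le_compat_r; [left; apply exp_pos|].
  apply Rplus_le_compat_r, le_INR, Hj.
- rewrite sum_cte, S_INR; right; ring.
Qed.

(** The transform Q_k of the overview with its integral cut off at [X]. *)
Definition stieltjes (k : nat) (zeta : C) (X : R) : C :=
  CInt (fun x => (RtoC (exp (- x) * laguerre k x) * / (zeta * zeta + x))%C) 0 X.

(** zeta^2 + x is the product of zeta + i sqrt x and zeta - i sqrt x, both at distance at least Re
    zeta from 0. *)
Lemma half_plane_sqr_plus (zeta : C) (x : R) : 0 < Re zeta -> 0 <= x ->
  Re zeta ^ 2 <= Cmod (zeta * zeta + x).
Proof.
destruct zeta as [r y]; simpl; intros Hr Hx.
apply Rsqr_incr_0_var; [|apply Cmod_ge_0].
unfold Rsqr; replace (Cmod ((r, y) * (r, y) + x) *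
  Cmod ((r, y) * (r, y) + x))
  with (Cmod ((r, y) * (r, y) + x) ^ 2) by ring.
rewrite Cmod2_alt; simpl.
assert (0 <= y ^ 2 * y ^ 2) by (apply Rmult_le_pos; apply pow2_ge_0).
assert (0 <= r ^ 2 * y ^ 2) by (apply Rmult_le_pos; apply pow2_ge_0).
assert (0 <= x * r ^ 2) by (apply Rmult_le_pos; [lra|apply pow2_ge_0]).
assert (0 <= (x - y ^ 2) ^ 2) by apply pow2_ge_0.
nra.
Qed.

(* 1/(zeta^2 + x) is the Laplace integral of exp(- (zeta + x/zeta) u) / zeta,
   whose exponent is in the right half-plane because zeta and 1/zeta are. *)
Lemma stieltjes_bound (k : nat) (zeta : C) (X I : R) (m : R -> R) :
  0 < Re zeta -> 0 <= X ->
  (forall u, 0 <= u ->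
     exp (- (Re zeta * u)) * (u ^ k / Cmod (u + zeta) ^ S k) <= m u) ->
  (forall u, 0 <= u -> continuous m u) ->
  (forall U, 0 <= U -> RInt m 0 U <= I) ->
  Cmod (stieltjes k zeta X) <= I + 4 * (INR k + 1) ^ 2 / (Re zeta ^ 2) * exp (- X / 2).
Proof.
intros Hr HX Hm Hmc HI.
set (r := Re zeta) in *.
assert (Hrm : r <= Cmod zeta).
{ eapply Rle_trans; [|apply re_le_Cmod]; rewrite Rabs_pos_eq; unfold r in *; lra. }
assert (Hz0 : zeta <> RtoC 0) by (apply Cmod_gt_0; lra).
assert (Hk : 0 <= INR k) by apply pos_INR.
assert (Hden : forall x, 0 <= x -> (zeta * zeta + x)%C <> RtoC 0).
{ intros x Hx; apply Cmod_gt_0; generalize (half_plane_sqr_plus zeta x Hr Hx); fold r; nra. }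
(* The u-integral is cut off as well, so that Fubini applies to a rectangle; the last term is the
   price and vanishes as [U] grows. *)
assert (Hfin : forall U, 0 <= U -> Cmod (stieltjes k zeta X) <=
  (I + 4 * (INR k + 1) ^ 2 / (r ^ 2) * exp (- X / 2)) + exp (- (r * U)) * (X * (INR k + 1) / r ^ 2)).
{ intros U HU.
  set (lam := fun x : R => (zeta + x / zeta)%C).
  set (F := fun w : C => (RtoC (exp (- fst w) * laguerre k (fst w)) / zeta * Cexp (- ((zeta + RtoC
      (fst w) / zeta) * RtoC (snd w))))%C).
  assert (HF : forall w, Ccont (U := C_UniformSpace) F w).
  { intros w; assert (Hfst : continuous (fun w : C_UniformSpace => fst w) w)
      by (apply (Ccont_Re _ (fun w => w)), Ccont_id).
    assert (Hsnd : continuous (fun w : C_UniformSpace => snd w) w)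
      by (apply (Ccont_Im _ (fun w => w)), Ccont_id).
    unfold F, Cdiv; apply Ccont_mult; [apply Ccont_mult; [|apply Ccont_const]|].
    - apply Ccont_RtoC, continuous_Rmult.
      + apply (continuous_comp (fun w : C_UniformSpace => - fst w) exp); [|apply continuous_exp].
        apply (continuous_opp (V := R_NormedModule)); exact Hfst.
      + apply (continuous_comp (fun w : C_UniformSpace => fst w) (laguerre k)); [exact Hfst|].
        apply continuous_laguerre.
    - apply Ccont_exp, Ccont_opp, Ccont_mult; [|apply Ccont_RtoC, Hsnd].
      apply Ccont_plus; [apply Ccont_const|apply Ccont_mult; [|apply Ccont_const]].
      apply Ccont_RtoC, Hfst. }
  assert (Hfub := fubini_rectangle F 0 X 0 U HX HU HF).
  assert (Hinner : forall x, 0 <= x -> is_CInt (fun u => F (x, u)) 0 U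
    (RtoC (exp (- x) * laguerre k x) * (/ (zeta * zeta + x) * (1 - Cexp (- (lam x * U)))))%C).
  { intros x Hx.
    assert (Hlam : (zeta * lam x)%C = (zeta * zeta + x)%C)
      by (unfold lam; field; exact Hz0).
    assert (Hl0 : lam x <> RtoC 0).
    { intros E; apply (Hden x Hx); rewrite <- Hlam, E; ring. }
    assert (H2 := is_CInt_mult_l (- (RtoC (exp (- x) * laguerre k x) / (zeta * zeta + x)))%C _ _ _ _
     (is_CInt_exp_mul (lam x) (fun _ => 1) (fun _ => 0) 0 U HU
    (fun t => is_derive_const (K := R_AbsRing) (V := R_NormedModule) 1 t) (fun t =>
        continuous_const 0 t))).
    match type of H2 with is_CInt _ _ _ ?v =>
    match goal with |- is_CInt _ _ _ ?w => replace w with v end end.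
    - revert H2; apply is_CInt_ext; [exact HU|]; intros u _; unfold F; simpl fst; simpl snd.
      fold (lam x); rewrite <- Hlam; field; split; assumption.
    - replace (- (lam x * 0))%C with (RtoC 0) by ring; rewrite Cexp_0.
      field; apply Hden, Hx. }
  assert (Hmain : Cmod (CInt (fun u => CInt (fun x => F (x, u)) 0 X) 0 U) <=
     I + 4 * (INR k + 1) ^ 2 / (r ^ 2) * exp (- X / 2)).
  { set (E0 := 4 * (INR k + 1) ^ 2 * exp (- X / 2)).
    assert (HE0 : 0 <= E0).
    { unfold E0; apply Rmult_le_pos; [|left; apply exp_pos].
      apply Rmult_le_pos; [lra|apply pow2_ge_0]. }
    assert (HgI : is_RInt (fun u => m u + E0 / r * exp (- (r * u))) 0 U
       (RInt m 0 U + E0 / r * ((1 - exp (- (r * U))) / r))).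
    { apply (is_RInt_plus (V := R_NormedModule)).
      - apply is_RInt_continuous_le; [exact HU|]; intros t Ht; apply Hmc; lra.
      - apply (is_RInt_scal (V := R_NormedModule)).
        replace ((1 - exp (- (r * U))) / r) with
          (minus (- exp (- (r * U)) / r) (- exp (- (r * 0)) / r)).
        + apply (is_RInt_derive (V := R_CompleteNormedModule) (fun u => - exp (- (r * u)) / r)).
          * intros t _; auto_derive; [auto|field; lra].
          * intros t _; apply (ex_derive_continuous (V := R_NormedModule)); auto_derive; auto.
        + rewrite Rmult_0_r, Ropp_0, exp_0; unfold minus, plus, opp; simpl; field; lra. }
    apply Rle_trans with (RInt m 0 U + E0 / r * ((1 - exp (- (r * U))) / r)).
    - apply (is_CInt_Cmod_le (fun u => CInt (fun x => F (x, u)) 0 X)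
         (fun u => m u + E0 / r * exp (- (r * u))) 0 U); [exact HU| | |exact HgI].
      + intros u Hu.
        (* At fixed u the x-integral is a truncated Laplace transform at [s], times e^(-zeta u) /
           zeta. Its limit (s - 1)^k / s^(k+1) produces e^(-zeta u) u^k / (u + zeta)^(k+1). *)
        set (s := (1 + u / zeta)%C).
        assert (Hs : (s * zeta)%C = (u + zeta)%C) by (unfold s; field; exact Hz0).
        assert (Hsm : 0 < Cmod (u + zeta)).
        { apply Rlt_le_trans with r; [exact Hr|].
          eapply Rle_trans; [|apply re_le_Cmod]; simpl; fold r.
          unfold r in *; unfold Re in *; rewrite Rabs_pos_eq; lra. }
        assert (Hs0 : s <> RtoC 0).
        { intros E; rewrite E, Cmult_0_l in Hs; rewrite <- Hs, Cmod_0 in Hsm; lra. }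
        assert (Hre : Re s = 1 + u * r / Cmod zeta ^ 2).
        { unfold s; rewrite Cmod2_alt; destruct zeta as [p q]; unfold r; simpl.
          field; intros E; apply Hz0, injective_projections; simpl; nra. }
        assert (Hre1 : 1 <= Re s).
        { rewrite Hre; assert (0 <= u * r / Cmod zeta ^ 2); [|lra].
          apply Rmult_le_pos; [nra|left; apply Rinv_0_lt_compat; nra]. }
        assert (Hin : is_CInt (fun x => F (x, u)) 0 X
           (Cexp (- (zeta * u)) / zeta * laguerre_laplace k s X)%C).
        { assert (H2 := is_CInt_mult_l (Cexp (- (zeta * u)) / zeta)%C _ _ _ _
            (laguerre_laplace_correct k s X HX)).
          revert H2; apply is_CInt_ext; [exact HX|]; intros x _; unfold F; simpl fst; simpl snd.
          replace (RtoC (exp (- x) * laguerre k x)) with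
            (Cexp (- x) * RtoC (laguerre k x))%C.
          2:{ rewrite RtoC_mult; f_equal; unfold Cexp; simpl.
              rewrite Ropp_0, cos_0, sin_0; apply injective_projections; simpl; ring. }
          replace (- (s * x))%C with
            (- x + - (u * x / zeta))%C
            by (unfold s; field; exact Hz0).
          replace (- ((zeta + x / zeta) * u))%C with
            (- (zeta * u) + - (u * x / zeta))%C
            by (field; exact Hz0).
          rewrite !Cexp_plus; field; exact Hz0. }
        rewrite (is_CInt_unique _ _ _ _ Hin).
        assert (Herr := laguerre_laplace_error k s X HX ltac:(lra)).
        replace (laguerre_laplace k s X) with ((s - 1) ^ k / s ^ (S k) + (laguerre_laplace k s X -
            (s - 1) ^ k / s ^ (S k)))%C by ring.
        rewrite Cmult_plus_distr_l; eapply Rle_trans; [apply Cmod_triangle|].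
        apply Rplus_le_compat.
        * eapply Rle_trans; [|apply Hm; lra].
          replace (Cexp (- (zeta * u)) / zeta * ((s - 1) ^ k / s ^ (S k)))%C with
             (Cexp (- (zeta * u)) * (u ^ k / (u + zeta) ^ (S k)))%C.
          -- rewrite Cmod_mult, Cmod_Cexp, Re_scal_exponent, Cmod_div, !Cmod_pow, Cmod_R, Rabs_pos_eq.
             ++ apply Rle_refl.
             ++ lra.
             ++ apply Cpow_nz, Cmod_gt_0, Hsm.
          -- rewrite <- Hs, !Cpow_mult_l.
             replace (s - 1)%C with (u / zeta)%C by (unfold s; ring).
             replace ((u / zeta) ^ k)%C with (u ^ k / zeta ^ k)%C
               by (unfold Cdiv; rewrite Cpow_mult_l, Cpow_inv by exact Hz0; reflexivity).
             simpl Cpow; field; repeat split; try apply Cpow_nz; assumption.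
        * rewrite Cmod_mult, Cmod_div, Cmod_Cexp, Re_scal_exponent by exact Hz0; fold r.
          apply Rle_trans with (exp (- (r * u)) / r * E0); [|right; field; lra].
          apply Rmult_le_compat; try apply Cmod_ge_0.
          -- apply Rmult_le_pos; [left; apply exp_pos|left; apply Rinv_0_lt_compat; lra].
          -- apply Rmult_le_compat_l; [left; apply exp_pos|]; apply Rinv_le_contravar; lra.
          -- eapply Rle_trans; [exact Herr|].
             apply Rle_trans with (4 * exp (- X) * ((INR k + 1) ^ 2 * exp (X / 2))).
             ++ apply Rmult_le_compat.
                ** generalize (exp_pos (- (Re s * X))); lra.
                ** apply cond_pos_sum; intros; apply Rabs_pos.
                ** apply Rmult_le_compat_l; [lra|]; apply exp_le; nra.
                ** apply sum_laguerre_bound, HX.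
             ++ right; unfold E0; replace (- X / 2) with (- X + X / 2) by field.
                rewrite exp_plus; ring.
      + apply CInt_correct; [exact HU|]; intros; apply Ccont_CInt_param'; assumption.
    - apply Rplus_le_compat; [apply HI, HU|].
      replace (4 * (INR k + 1) ^ 2 / r ^ 2 * exp (- X / 2)) with (E0 / r * (1 / r))
        by (unfold E0; field; lra).
      apply Rmult_le_compat_l.
      + apply Rmult_le_pos; [exact HE0|left; apply Rinv_0_lt_compat; lra].
      + apply Rmult_le_compat_r; [left; apply Rinv_0_lt_compat; lra|].
        generalize (exp_pos (- (r * U))); lra. }
  rewrite <- Hfub in Hmain.
  (* In the other order the u-integral misses 1 / (zeta^2 + x) by a factor e^(-lam U), and Re lam >=
     Re zeta because 1/zeta lies in the right half-plane. *)
  assert (Hdiff : Cmod (stieltjes k zeta X - CInt (fun x => CInt (fun u => F (x, u)) 0 U) 0 X)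
     <= (X - 0) * (exp (- (r * U)) * ((INR k + 1) / r ^ 2))).
  { apply (is_CInt_Cmod_le_const (fun x => (RtoC (exp (- x) * laguerre k x) * / (zeta * zeta + x) -
      CInt (fun u => F (x, u)) 0 U)%C));
      [exact HX| |].
    - intros x Hx; rewrite (is_CInt_unique _ _ _ _ (Hinner x (proj1 Hx))).
      match goal with |- Cmod ?z <= _ => replace z with (Cexp (- (lam x * U)) * (RtoC (exp (- x) *
          laguerre k x) * / (zeta * zeta + x)))%C by ring end.
      rewrite !Cmod_mult, Cmod_Cexp, Re_scal_exponent, Cmod_R, Cmod_inv by (apply Hden; lra).
      apply Rmult_le_compat.
      + left; apply exp_pos.
      + apply Rmult_le_pos; [apply Rabs_pos|left; apply Rinv_0_lt_compat, Cmod_gt_0, Hden; lra].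
      + apply exp_le; apply Ropp_le_contravar, Rmult_le_compat_r; [lra|].
        unfold lam; destruct zeta as [p q]; unfold r, Re; simpl.
        assert (0 <= x * (p / (p * (p * 1) + q * (q * 1))) - 0 * (- q / (p * (p * 1) + q * (q *
            1)))); [|lra].
        rewrite Rmult_0_l, Rminus_0_r; apply Rmult_le_pos; [lra|].
        unfold r, Re in Hr; simpl in Hr.
        apply Rmult_le_pos; [lra|left; apply Rinv_0_lt_compat; nra].
      + apply Rmult_le_compat; [apply Rabs_pos|left; apply Rinv_0_lt_compat, Cmod_gt_0, Hden; lra| |].
        * rewrite Rabs_mult, (Rabs_pos_eq (exp _)) by (left; apply exp_pos).
          apply Rle_trans with (exp (- x) * ((INR k + 1) * exp (x / 2))).
          -- apply Rmult_le_compat_l; [left; apply exp_pos|apply laguerre_abs_bound; lra].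
          -- replace (exp (- x) * ((INR k + 1) * exp (x / 2))) with ((INR k + 1) * exp (- x + x / 2))
               by (rewrite exp_plus; ring).
             rewrite <- (Rmult_1_r (INR k + 1)) at 2; apply Rmult_le_compat_l; [lra|].
             rewrite <- exp_0; apply exp_le; lra.
        * apply Rinv_le_contravar; [nra|]; apply (half_plane_sqr_plus zeta x Hr); lra.
    - apply is_CInt_minus.
      + apply CInt_correct; [exact HX|]; intros t Ht; apply Ccont_mult.
        * apply Ccont_RtoC, continuous_Rmult; [|apply continuous_laguerre].
          apply (ex_derive_continuous (V := R_NormedModule)); auto_derive; auto.
        * apply Ccont_inv; [|apply Hden; lra].
          apply Ccont_plus; [apply Ccont_const|apply Ccont_RtoC, continuous_id].
      + apply CInt_correct; [exact HX|]; intros; apply Ccont_CInt_param; assumption. }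
  replace (stieltjes k zeta X) with (stieltjes k zeta X - CInt (fun x => CInt (fun u => F (x, u)) 0
      U) 0 X + CInt (fun x => CInt (fun u => F (x, u)) 0 U) 0 X)%C by ring.
  eapply Rle_trans; [apply Cmod_triangle|].
  replace (exp (- (r * U)) * (X * (INR k + 1) / r ^ 2)) with
    ((X - 0) * (exp (- (r * U)) * ((INR k + 1) / r ^ 2))) by (field; lra).
  lra. }
fold r; apply le_epsilon; intros eps Heps.
set (c := X * (INR k + 1) / r ^ 2) in *.
assert (Hc : 0 <= c).
{ unfold c; apply Rmult_le_pos; [nra|left; apply Rinv_0_lt_compat; nra]. }
assert (HU : 0 <= c / (r * eps)).
{ apply Rmult_le_pos; [exact Hc|left; apply Rinv_0_lt_compat; nra]. }
(* For this [U] the last term is c e^(-c/eps), which is at most eps because y e^(-y) <= 1. *)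
eapply Rle_trans; [apply (Hfin (c / (r * eps)) HU)|].
apply Rplus_le_compat_l.
replace (r * (c / (r * eps))) with (c / eps) by (field; lra).
assert (H1 := exp_ineq1_le (c / eps)).
assert (E : exp (c / eps) * exp (- (c / eps)) = 1) by (rewrite <- exp_plus, Rplus_opp_r; apply exp_0).
assert (Hp := exp_pos (- (c / eps))).
assert (Ec : c / eps * eps = c) by (field; lra).
assert (exp (- (c / eps)) * (c / eps) <= 1) by nra.
replace (exp (- (c / eps)) * c) with (exp (- (c / eps)) * (c / eps) * eps) by (rewrite Rmult_assoc,
    Ec; ring).
nra.
Qed.

(** * Decay of the Stieltjes transforms *)

Lemma exp_pow_INR (x : R) (n : nat) : exp x ^ n = exp (INR n * x).
Proof.
induction n as [|n IH]; [simpl; rewrite Rmult_0_l, exp_0; reflexivity|].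
rewrite S_INR, Rmult_plus_distr_r, exp_plus, <- IH, Rmult_1_l; simpl; ring.
Qed.

(** The exponential is split into n equal factors, each of which controls one factor [Q + 2]. *)
Lemma poly_exp_bound (r : R) (n : nat) : 0 < r ->
  exists B, 0 < B /\ forall Q, 0 <= Q -> (Q + 2) ^ n * exp (- (r * Q)) <= B.
Proof.
intros Hr; destruct n as [|n].
- exists 1; split; [lra|]; intros Q HQ; simpl; rewrite Rmult_1_l, <- exp_0.
  apply exp_le; nra.
- set (r' := r / INR (S n)).
  assert (Hn : 0 < INR (S n)) by (apply lt_0_INR; lia).
  assert (Hr' : 0 < r') by (apply Rdiv_lt_0_compat; assumption).
  assert (Hir : 0 < / r') by (apply Rinv_0_lt_compat, Hr').
  exists ((2 + / r') ^ S n); split; [apply pow_lt; lra|]; intros Q HQ.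
  assert (E : exp (- (r * Q)) = exp (- (r' * Q)) ^ S n).
  { rewrite exp_pow_INR; f_equal; unfold r'; field; lra. }
  rewrite E, <- Rpow_mult_distr; apply pow_incr.
  assert (Hp := exp_pos (- (r' * Q))).
  split; [nra|].
  assert (E2 : exp (r' * Q) * exp (- (r' * Q)) = 1) by (rewrite <- exp_plus, Rplus_opp_r; apply exp_0).
  assert (H1 := exp_ineq1_le (r' * Q)).
  assert (exp (- (r' * Q)) <= 1) by (rewrite <- exp_0; apply exp_le; nra).
  assert (r' * (Q * exp (- (r' * Q))) <= 1) by nra.
  assert (Q * exp (- (r' * Q)) <= / r').
  { apply Rmult_le_reg_l with r'; [exact Hr'|]; rewrite Rinv_r by lra; assumption. }
  nra.
Qed.

(** In other words (1 - x)/(1 + x) <= e^(-2x): the difference of the two sides vanishes at 0 and has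
    derivative -2 x sinh x. *)
Lemma Cayley_le_exp (x : R) : 0 <= x -> (1 - x) * exp x <= (1 + x) * exp (- x).
Proof.
intros Hx.
assert (H := derive_nonpos_le (fun x => (1 - x) * exp x - (1 + x) * exp (- x))
  (fun x => - x * (exp x - exp (- x))) x Hx).
cbv beta in H; rewrite Ropp_0, exp_0 in H.
assert ((1 - x) * exp x - (1 + x) * exp (- x) <= (1 - 0) * 1 - (1 + 0) * 1); [|lra].
apply H.
- intros t; auto_derive; [auto|ring].
- intros t Ht; assert (exp (- t) <= exp t) by (apply exp_le; lra); nra.
Qed.

(** With x = r / (2 u + r) the ratio is (1 - x)/(1 + x), and 2 x = r / (u + r/2). This is the origin
    of the variable v = u + r/2. *)
Lemma power_ratio_bound (k : nat) (r u : R) : 0 < r -> 0 < u ->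
  (u / (u + r)) ^ k <= exp (- (INR k * r / (u + r / 2))).
Proof.
intros Hr Hu.
replace (- (INR k * r / (u + r / 2))) with (INR k * - (r / (u + r / 2))) by (field; lra).
rewrite <- exp_pow_INR.
apply pow_incr; split; [left; apply Rdiv_lt_0_compat; lra|].
set (x := r / (2 * (u + r / 2))).
assert (Hx : 0 < x) by (apply Rdiv_lt_0_compat; lra).
assert (H := Cayley_le_exp x ltac:(lra)).
assert (E : exp x * exp (- x) = 1) by (rewrite <- exp_plus, Rplus_opp_r; apply exp_0).
assert (Hp := exp_pos (- x)).
replace (- (r / (u + r / 2))) with (- x + - x) by (unfold x; field; lra).
rewrite exp_plus.
replace (u / (u + r)) with ((1 - x) / (1 + x)) by (unfold x; field; lra).
apply Rmult_le_reg_r with (1 + x); [lra|].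
unfold Rdiv; rewrite Rmult_assoc, Rinv_l, Rmult_1_r by lra.
apply Rle_trans with ((1 - x) * exp x * exp (- x)); [right; rewrite Rmult_assoc, E; ring|].
nra.
Qed.

Lemma bernoulli (n : nat) (x : R) : 0 <= x -> 1 + INR n * x <= (1 + x) ^ n.
Proof.
intros Hx; induction n as [|n IH]; [simpl; lra|].
rewrite S_INR; simpl; generalize (pos_INR n); intros; nra.
Qed.

(** The decay in [y] is drawn from the k-th power of |u + r + i y| / (u + r): each of [M] equal
    shares of it gives a factor linear in y^2 by Bernoulli's inequality. The loss is a power of v^2
    / k, of order one at the saddle point v = sqrt k. *)
Lemma transversal_decay (M k : nat) (r u y : R) : (1 <= M)%nat -> (2 * M <= k)%nat ->
  0 < r -> 0 <= u ->
  (1 + y ^ 2) ^ M <= (Cmod (u + r, y) / (u + r)) ^ k *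
     (1 + 16 * INR M * ((u + r / 2) ^ 2 / INR k)) ^ M.
Proof.
intros HM Hk Hr Hu.
(* 2 q M of the k factors are used. As k <= 4 M q and a = u + r <= 2 v, the loss a^2 / q is at most
   16 M v^2 / k. *)
set (q := (k / (2 * M))%nat).
assert (HM' : 1 <= INR M) by (change 1 with (INR 1); apply le_INR, HM).
assert (Hk' : 2 * INR M <= INR k) by (change 2 with (INR 2); rewrite <- mult_INR; apply le_INR, Hk).
assert (Hq1 : (1 <= q)%nat) by (apply Nat.div_le_lower_bound; lia).
assert (Hq2 : (q * M * 2 <= k)%nat).
{ unfold q; generalize (Nat.Div0.mul_div_le k (2 * M)); lia. }
assert (Hq3 : INR k <= 4 * INR M * INR q).
{ replace 4 with (INR 4) by (simpl; ring); rewrite <- !mult_INR; apply le_INR.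
  generalize (Nat.mul_succ_div_gt k (2 * M) ltac:(lia)); fold q; nia. }
assert (Hq : 1 <= INR q) by (change 1 with (INR 1); apply le_INR, Hq1).
set (a := u + r) in *; assert (Ha : 0 < a) by (unfold a; lra).
set (s := Cmod (a, y) / a).
assert (Hs2 : s ^ 2 = 1 + y ^ 2 / a ^ 2).
{ unfold s, Rdiv; rewrite Rpow_mult_distr, Cmod2_alt; unfold Re, Im; simpl; field; lra. }
assert (HY : 0 <= y ^ 2 / a ^ 2).
{ apply Rmult_le_pos; [apply pow2_ge_0|left; apply Rinv_0_lt_compat, pow_lt, Ha]. }
assert (Hs0 : 0 <= s).
{ apply Rmult_le_pos; [apply Cmod_ge_0|left; apply Rinv_0_lt_compat, Ha]. }
assert (Hs1 : 1 <= s).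
{ apply Rnot_lt_le; intros Hlt; assert (s * s < 1) by nra.
  replace (s ^ 2) with (s * s) in Hs2 by ring; lra. }
assert (H1 : (1 + INR q * (y ^ 2 / a ^ 2)) ^ M <= s ^ k).
{ apply Rle_trans with (s ^ (2 * (q * M))); [|apply Rle_pow; [exact Hs1|lia]].
  rewrite pow_mult, Hs2, pow_mult; apply pow_incr; split; [assert (0 <= INR q * (y ^ 2 / a ^ 2)) by
      (apply Rmult_le_pos; lra); lra|apply bernoulli, HY]. }
apply Rle_trans with ((1 + INR q * (y ^ 2 / a ^ 2)) ^ M *
  (1 + 16 * INR M * ((u + r / 2) ^ 2 / INR k)) ^ M).
- rewrite <- Rpow_mult_distr; apply pow_incr; split; [generalize (pow2_ge_0 y); lra|].
  apply Rle_trans with ((1 + INR q * (y ^ 2 / a ^ 2)) * (1 + a ^ 2 / INR q)).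
  + replace ((1 + INR q * (y ^ 2 / a ^ 2)) * (1 + a ^ 2 / INR q))
      with (1 + y ^ 2 + (INR q * (y ^ 2 / a ^ 2) + a ^ 2 / INR q)) by (field; lra).
    assert (0 <= a ^ 2 / INR q)
      by (apply Rmult_le_pos; [apply pow2_ge_0|left; apply Rinv_0_lt_compat; lra]).
    assert (0 <= INR q * (y ^ 2 / a ^ 2)) by (apply Rmult_le_pos; lra).
    lra.
  + assert (0 <= INR q * (y ^ 2 / a ^ 2)) by (apply Rmult_le_pos; lra).
    apply Rmult_le_compat_l; [lra|]; apply Rplus_le_compat_l.
    apply Rle_trans with (4 * (u + r / 2) ^ 2 / INR q).
    * apply Rmult_le_compat_r; [left; apply Rinv_0_lt_compat; lra|].
      unfold a; nra.
    * apply Rmult_le_reg_r with (INR q * INR k); [nra|].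
      replace (4 * (u + r / 2) ^ 2 / INR q * (INR q * INR k))
        with (4 * (u + r / 2) ^ 2 * INR k) by (field; lra).
      replace (16 * INR M * ((u + r / 2) ^ 2 / INR k) * (INR q * INR k))
        with (4 * (u + r / 2) ^ 2 * (4 * INR M * INR q)) by (field; lra).
      apply Rmult_le_compat_l; [generalize (pow2_ge_0 (u + r / 2)); lra|exact Hq3].
- apply Rmult_le_compat_r; [|exact H1].
  apply pow_le; assert (0 <= (u + r / 2) ^ 2 / INR k); [|nra].
  apply Rmult_le_pos; [apply pow2_ge_0|left; apply Rinv_0_lt_compat; lra].
Qed.

Definition coef_rate (r : R) (k : nat) : R :=
  / sqrt (sqrt (INR k)) * exp (- (2 * r * sqrt (INR k))).

Lemma coef_rate_pos (r : R) (k : nat) : (1 <= k)%nat -> 0 < coef_rate r k.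
Proof.
intros Hk; apply Rmult_lt_0_compat; [|apply exp_pos].
apply Rinv_0_lt_compat, sqrt_lt_R0, sqrt_lt_R0, lt_0_INR; lia.
Qed.

(** With v = u + r/2 and sg = v / sqrt k, the exponent r (v + k/v) equals 2 r sqrt k + r Q, where Q
    = sqrt k (sg - 1)^2 / sg. Away from the saddle point e^(-r Q) absorbs every polynomial loss,
    since sg and 1/sg are at most Q + 2. *)
Lemma stieltjes_decay (r : R) (M : nat) : 0 < r -> (1 <= M)%nat ->
  exists B, 0 < B /\ forall k y X, (2 * M <= k)%nat -> 0 <= X ->
    Cmod (stieltjes k (r, y) X) <=
    B * coef_rate r k / (1 + y ^ 2) ^ M + 4 * (INR k + 1) ^ 2 / (r ^ 2) * exp (- X / 2).
Proof.
intros Hr HM.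
assert (HM' : 1 <= INR M) by (change 1 with (INR 1); apply le_INR, HM).
(* Powers of Q + 2: 2 M for the loss of [transversal_decay], one for 1/sg, and two for the
   denominator of [m], which is 1 + Q sg. *)
destruct (poly_exp_bound r (2 * M + 3) Hr) as [B1 [HB1 HB]].
set (B2 := exp (r ^ 2 / 2) * ((16 * INR M + 1) ^ M * B1)).
assert (HB2 : 0 < B2).
{ apply Rmult_lt_0_compat; [apply exp_pos|apply Rmult_lt_0_compat; [apply pow_lt; lra|exact HB1]]. }
exists (B2 * PI); split; [generalize PI_RGT_0; intros; nra|]; intros k y X Hk HX.
set (kap := sqrt (INR k)).
assert (Hk1 : 1 <= INR k) by (change 1 with (INR 1); apply le_INR; lia).
assert (Hkap : 1 <= kap) by (rewrite <- sqrt_1; apply sqrt_le_1_alt, Hk1).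
assert (Ek : kap * kap = INR k) by (apply sqrt_sqrt; lra).
assert (Hsk : 1 <= sqrt kap) by (rewrite <- sqrt_1; apply sqrt_le_1_alt, Hkap).
assert (Esk : sqrt kap * sqrt kap = kap) by (apply sqrt_sqrt; lra).
assert (Hy : 0 < (1 + y ^ 2) ^ M) by (apply pow_lt; generalize (pow2_ge_0 y); lra).
set (c := B2 * exp (- (2 * r * kap)) / (1 + y ^ 2) ^ M / kap).
assert (Hc : 0 < c).
{ unfold c; repeat apply Rdiv_lt_0_compat; try lra; apply Rmult_lt_0_compat; [lra|apply exp_pos]. }
(* A Lorentzian dominates the peak and has an arctangent as primitive. Its u-integral is at most c
   sqrt(kap) PI; as [c] contains 1/kap with kap = sqrt k, this is the factor k^(-1/4). *)
set (m := fun u => c / (1 + kap * ((u + r / 2) / kap - 1) ^ 2)).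
assert (Hden : forall u, 0 < 1 + kap * ((u + r / 2) / kap - 1) ^ 2).
{ intros u; generalize (pow2_ge_0 ((u + r / 2) / kap - 1)); intros; nra. }
assert (Hmc : forall u, continuous m u).
{ intros u; apply (ex_derive_continuous (V := R_NormedModule)); unfold m; auto_derive.
  specialize (Hden u); unfold Rdiv, Rminus in Hden; simpl in Hden; apply Rgt_not_eq, Hden. }
apply (stieltjes_bound k (r, y) X _ m); simpl Re; [exact Hr|exact HX| |auto|].
- intros u Hu.
  assert (Hmu : 0 < m u) by (apply Rdiv_lt_0_compat; auto).
  destruct Hu as [Hu|<-].
  2:{ rewrite pow_i by lia; unfold Rdiv; rewrite Rmult_0_l, Rmult_0_r; lra. }
  replace (u + (r, y))%C with ((u + r, y) : C)
    by (apply injective_projections; simpl; ring).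
  set (v := u + r / 2); set (sg := v / kap).
  assert (Hv : 0 < v) by (unfold v; lra).
  assert (Hsg : 0 < sg) by (apply Rdiv_lt_0_compat; lra).
  set (Q := kap * (sg - 1) ^ 2 / sg).
  set (W := (1 + 16 * INR M * sg ^ 2) ^ M).
  assert (HW : 0 < W) by (apply pow_lt; generalize (pow2_ge_0 sg); intros; nra).
  assert (HQ : 0 <= Q).
  { apply Rmult_le_pos; [apply Rmult_le_pos; [lra|apply pow2_ge_0]|left; apply Rinv_0_lt_compat, Hsg]. }
  assert (HQ1 : sg - 2 + / sg <= Q).
  { replace (sg - 2 + / sg) with (1 * ((sg - 1) ^ 2 / sg)) by (field; lra).
    unfold Q, Rdiv; rewrite Rmult_assoc; apply Rmult_le_compat_r; [|exact Hkap].
    apply Rmult_le_pos; [apply pow2_ge_0|left; apply Rinv_0_lt_compat, Hsg]. }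
  assert (Hisg : 0 < / sg) by (apply Rinv_0_lt_compat, Hsg).
  assert (Hcm : u + r <= Cmod (u + r, y)).
  { eapply Rle_trans; [|apply (re_le_Cmod (u + r, y))]; simpl; rewrite Rabs_pos_eq; lra. }
  assert (S1 : u ^ k / Cmod (u + r, y) ^ S k <=
     exp (- (INR k * r / v)) * (W / (1 + y ^ 2) ^ M) * / v).
  { assert (T := transversal_decay M k r u y HM Hk Hr ltac:(lra)).
    replace ((u + r / 2) ^ 2 / INR k) with (sg ^ 2) in T
      by (unfold sg, v; rewrite <- Ek; field; lra).
    fold W in T.
    replace (u ^ k / Cmod (u + r, y) ^ S k) with
      ((u / (u + r)) ^ k * / (Cmod (u + r, y) / (u + r)) ^ k * / Cmod (u + r, y)).
    2:{ unfold Rdiv; rewrite !Rpow_mult_distr, !pow_inv; simpl; field.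
        repeat split; try apply pow_nonzero; lra. }
    assert (Hcr : 0 < (Cmod (u + r, y) / (u + r)) ^ k) by (apply pow_lt, Rdiv_lt_0_compat; lra).
    apply Rmult_le_compat.
    - apply Rmult_le_pos; [apply pow_le; left; apply Rdiv_lt_0_compat; lra|].
      left; apply Rinv_0_lt_compat, Hcr.
    - left; apply Rinv_0_lt_compat; lra.
    - apply Rmult_le_compat.
      + apply pow_le; left; apply Rdiv_lt_0_compat; lra.
      + left; apply Rinv_0_lt_compat, Hcr.
      + apply power_ratio_bound; lra.
      + apply Rmult_le_reg_l with ((Cmod (u + r, y) / (u + r)) ^ k); [exact Hcr|].
        rewrite Rinv_r by lra.
        apply Rmult_le_reg_r with ((1 + y ^ 2) ^ M); [exact Hy|].
        replace ((Cmod (u + r, y) / (u + r)) ^ k * (W / (1 + y ^ 2) ^ M) * (1 + y ^ 2) ^ M)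
          with ((Cmod (u + r, y) / (u + r)) ^ k * W) by (field; lra).
        lra.
    - apply Rinv_le_contravar; [exact Hv|unfold v; lra]. }
  eapply Rle_trans; [apply Rmult_le_compat_l; [left; apply exp_pos|exact S1]|].
  assert (S2 : exp (- (r * u)) * exp (- (INR k * r / v)) =
     exp (r ^ 2 / 2) * exp (- (2 * r * kap)) * exp (- (r * Q))).
  { rewrite <- !exp_plus; f_equal; unfold Q, sg; rewrite <- Ek.
    replace u with (v - r / 2) by (unfold v; ring); field; lra. }
  replace (exp (- (r * u)) * (exp (- (INR k * r / v)) * (W / (1 + y ^ 2) ^ M) * / v))
    with ((exp (- (r * u)) * exp (- (INR k * r / v))) * (W / (1 + y ^ 2) ^ M) * / v) by ring.
  rewrite S2.
  assert (S3 : exp (- (r * Q)) * W * / sg * (1 + kap * (sg - 1) ^ 2) <= (16 * INR M + 1) ^ M * B1).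
  { replace (kap * (sg - 1) ^ 2) with (Q * sg) by (unfold Q; field; lra).
    apply Rle_trans with (exp (- (r * Q)) * ((16 * INR M + 1) * (Q + 2) ^ 2) ^ M * (Q + 2) * (Q +
        2) ^ 2).
    - assert (Hp := exp_pos (- (r * Q))).
      apply Rmult_le_compat.
      + apply Rmult_le_pos; [apply Rmult_le_pos; lra|lra].
      + nra.
      + apply Rmult_le_compat; [apply Rmult_le_pos; lra|lra| |lra].
        apply Rmult_le_compat_l; [lra|].
        apply pow_incr; split; [generalize (pow2_ge_0 sg); intros; nra|].
        assert (sg ^ 2 <= (Q + 2) ^ 2) by (apply pow_incr; lra).
        assert (1 <= (Q + 2) ^ 2) by (simpl; nra).
        nra.
      + nra.
    - replace (exp (- (r * Q)) * ((16 * INR M + 1) * (Q + 2) ^ 2) ^ M * (Q + 2) * (Q + 2) ^ 2)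
        with ((16 * INR M + 1) ^ M * ((Q + 2) ^ (2 * M + 3) * exp (- (r * Q)))).
      + apply Rmult_le_compat_l; [apply pow_le; lra|apply HB, HQ].
      + rewrite Rpow_mult_distr, pow_add, pow_mult; simpl; ring. }
  unfold m; fold v; fold sg.
  apply Rmult_le_reg_r with (1 + kap * (sg - 1) ^ 2); [apply Hden|].
  replace (c / (1 + kap * (sg - 1) ^ 2) * (1 + kap * (sg - 1) ^ 2)) with
    (exp (r ^ 2 / 2) * exp (- (2 * r * kap)) / ((1 + y ^ 2) ^ M) / kap * ((16 * INR M + 1) ^ M * B1)).
  2:{ unfold c, B2; field; repeat split; try lra; specialize (Hden u); fold v in Hden; fold sg in
      Hden; lra. }
  replace (/ v) with (/ kap * / sg) by (unfold sg; field; lra).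
  replace (exp (r ^ 2 / 2) * exp (- (2 * r * kap)) * exp (- (r * Q)) * (W / (1 + y ^ 2) ^ M) * (/
      kap * / sg) * (1 + kap * (sg - 1) ^ 2))
    with (exp (r ^ 2 / 2) * exp (- (2 * r * kap)) / ((1 + y ^ 2) ^ M) / kap *
     (exp (- (r * Q)) * W * / sg * (1 + kap * (sg - 1) ^ 2))) by (field; lra).
  apply Rmult_le_compat_l; [|exact S3].
  left; repeat apply Rdiv_lt_0_compat; try lra; apply Rmult_lt_0_compat; apply exp_pos.
- intros U HU.
  set (G := fun u => c * sqrt kap * atan (sqrt kap * ((u + r / 2) / kap - 1))).
  rewrite (is_RInt_unique (V := R_CompleteNormedModule) m 0 U (minus (G U) (G 0))).
  + change (G U - G 0 <= B2 * PI * coef_rate r k / (1 + y ^ 2) ^ M); unfold G.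
    set (A1 := atan _); set (A2 := atan _).
    assert (H1 := atan_bound (sqrt kap * ((U + r / 2) / kap - 1))).
    assert (H2 := atan_bound (sqrt kap * ((0 + r / 2) / kap - 1))).
    fold A1 in H1; fold A2 in H2.
    apply Rle_trans with (c * sqrt kap * PI).
    * replace (c * sqrt kap * A1 - c * sqrt kap * A2) with (c * sqrt kap * (A1 - A2)) by ring.
      apply Rmult_le_compat_l; [nra|lra].
    * right; unfold c, coef_rate; fold kap.
      replace (/ sqrt kap) with (sqrt kap / kap).
      { field; split; lra. }
      apply Rmult_eq_reg_r with (sqrt kap); [|lra]; rewrite Rinv_l by lra.
      unfold Rdiv; rewrite (Rmult_comm _ (/ kap)), Rmult_assoc, Esk; apply Rinv_l; lra.
  + apply (is_RInt_derive (V := R_CompleteNormedModule) G).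
    * intros u _; unfold G, m; specialize (Hden u).
      auto_derive; [auto|].
      unfold Rsqr.
      replace (sqrt kap * ((u + r / 2) * / kap + - (1)) * (sqrt kap * ((u + r / 2) * / kap + - (1)) * 1))
        with (kap * ((u + r / 2) / kap - 1) ^ 2) by (rewrite <- Esk at 1; unfold Rdiv; ring).
      replace (c * sqrt kap * (sqrt kap * (1 * / kap) * / (1 + kap * ((u + r / 2) / kap - 1) ^ 2)))
        with (c * (sqrt kap * sqrt kap * / kap) * / (1 + kap * ((u + r / 2) / kap - 1) ^ 2)) by ring.
      rewrite Esk, Rinv_r by lra; unfold Rdiv; ring.
    * intros u _; apply Hmc.
Qed.

(** * Cauchy's formula on a strip *)

(** The identity in [Cdiff] binds the function everywhere, so a change of value at a point [x] far
    from [z] has to be matched by a change of the quotient at [x]. *)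
Lemma Cdiff_modify (f h : C -> C) (x z : C) : z <> x ->
  (forall w, w <> x -> f w = h w) -> Cdiff f z -> Cdiff h z.
Proof.
intros Hzx Heq [q [Hq Hf]].
assert (Hd : (z - x)%C <> RtoC 0).
{ intros E; apply Hzx; replace z with (z - x + x)%C by ring; rewrite E; ring. }
assert (Hd' : (x - z)%C <> RtoC 0).
{ intros E; apply Hd; replace (z - x)%C with (- (x - z))%C by ring; rewrite E; ring. }
assert (Hpos : 0 < Cmod (z - x)) by (apply Cmod_gt_0, Hd).
exists (fun w => if excluded_middle_informative (w = x)
                 then ((h x - h z) / (x - z))%C else q w); split.
- refine (continuous_ext_loc (T := C_UniformSpace) (U := C_UniformSpace) _ q z _ _); [|exact Hq].
  assert (H2 : 0 < Cmod (z - x) / 2) by lra.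
  exists (mkposreal _ H2); intros w [H1 H3].
  change (Rabs (Re w - Re z) < Cmod (z - x) / 2) in H1.
  change (Rabs (Im w - Im z) < Cmod (z - x) / 2) in H3.
  destruct (excluded_middle_informative _) as [E|]; [exfalso|reflexivity].
  rewrite E in H1, H3.
  generalize (Cmod_le_parts (z - x)%C); rewrite Rabs_minus_sym in H1, H3.
  change (Re (z - x)) with (Re z - Re x); change (Im (z - x)) with (Im z - Im x); lra.
- intros w; destruct (excluded_middle_informative (w = x)) as [->|Hw].
  + field; exact Hd'.
  + rewrite <- !Heq by assumption; apply Hf.
Qed.

Lemma is_CInt_odd (f : R -> C) (Y : R) (l : C) :
  (forall y, f (- y) = (- f y)%C) -> is_CInt f (- Y) Y l -> l = RtoC 0.
Proof.
intros Hodd H.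
assert (H1 : is_CInt f Y (- Y) l).
{ apply (is_RInt_ext (V := C_R_NormedModule) (fun y => opp (f (- y)))).
  - intros y _; rewrite Hodd; apply (opp_opp (G := C_R_NormedModule)).
  - apply (is_RInt_comp_opp (V := C_R_NormedModule) f Y (- Y)); rewrite Ropp_involutive; exact H. }
apply (is_RInt_swap (V := C_R_NormedModule)) in H1.
assert (E := is_CInt_eq _ _ _ _ _ H H1); change (l = (- l)%C) in E.
destruct l as [p q]; injection E; intros; apply injective_projections; simpl; lra.
Qed.

Lemma atan_le_id (t : R) : 0 <= t -> atan t <= t.
Proof.
intros Ht; assert (H := derive_nonpos_le (fun t => atan t - t) (fun t => / (1 + t ^ 2) - 1) t Ht).
cbv beta in H; rewrite atan_0, Rminus_0_r in H.
assert (atan t - t <= 0); [|lra]; apply H.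
- intros s; auto_derive; [auto|]; unfold Rsqr; field; nra.
- intros s _; assert (/ (1 + s ^ 2) <= 1); [|lra].
  rewrite <- Rinv_1; apply Rinv_le_contravar; [lra|]; generalize (pow2_ge_0 s); lra.
Qed.

Lemma atan_tail (t : R) : 0 < t -> PI / 2 - / t <= atan t < PI / 2.
Proof.
intros Ht; split; [|apply atan_bound].
assert (Hit : 0 < / t) by (apply Rinv_0_lt_compat, Ht).
assert (H := atan_inv t Ht); assert (H2 := atan_le_id (/ t) ltac:(lra)); lra.
Qed.

Section CauchyOnStrip.

Variables (g : C -> C) (r B : R).
Hypothesis Hr : 0 < r.
Hypothesis Hdiff : forall zeta, 0 <= Re zeta <= r -> Cdiff g (- (zeta * zeta))%C.
Hypothesis Hbound : forall zeta, 0 <= Re zeta <= r ->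
  Cmod (g (- (zeta * zeta))%C) <= B / (1 + Im zeta ^ 2) ^ 2.

Lemma strip_bound_nonneg : 0 <= B.
Proof.
assert (H := Hbound (RtoC 0) ltac:(simpl; lra)); simpl in H.
generalize (Cmod_ge_0 (g (- (0 * 0))%C)); intros; lra.
Qed.

(** The half-line of the expansion is the image of the edge Re zeta = 0 of the strip. *)
Lemma sqr_sqrt_imag (x : R) : 0 <= x -> (- ((0, sqrt x) * (0, sqrt x)))%C = RtoC x.
Proof.
intros Hx; apply injective_projections; simpl; [|ring].
rewrite sqrt_sqrt by exact Hx; ring.
Qed.

Lemma Cdiff_on_axis (x : R) : 0 <= x -> Cdiff g (RtoC x).
Proof. intros Hx; rewrite <- (sqr_sqrt_imag x Hx); apply Hdiff; simpl; lra. Qed.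

Definition line_kernel (x y : R) : C :=
  ((r, y) * g (- ((r, y) * (r, y)))%C * / ((r, y) * (r, y) + x))%C.

Lemma line_denominator (x y : R) : 0 <= x ->
  r ^ 2 <= Cmod ((r, y) * (r, y) + x).
Proof. intros Hx; apply (half_plane_sqr_plus (r, y) x); simpl; assumption. Qed.

Lemma line_denominator_neq (x y : R) : 0 <= x ->
  ((r, y) * (r, y) + x)%C <> RtoC 0.
Proof.
intros Hx; apply Cmod_gt_0; eapply Rlt_le_trans; [|apply line_denominator, Hx].
apply pow_lt, Hr.
Qed.

Lemma Ccont_line (y : R) : Ccont (fun y => (r, y) : C) y.
Proof. apply Ccont_pair; [apply continuous_const|apply continuous_id]. Qed.

Lemma Ccont_g_line (y : R) : Ccont (fun y => ((r, y) * g (- ((r, y) * (r, y)))%C)%C) y.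
Proof.
apply Ccont_mult; [apply Ccont_line|].
apply (Ccont_comp _ (fun y => (- ((r, y) * (r, y)))%C) g).
- apply Ccont_opp, Ccont_mult; apply Ccont_line.
- apply Cdiff_cont, Hdiff; simpl; lra.
Qed.

Lemma Ccont_line_kernel (x y : R) : 0 <= x -> Ccont (line_kernel x) y.
Proof.
intros Hx; apply Ccont_mult; [apply Ccont_g_line|].
apply Ccont_inv; [|apply line_denominator_neq, Hx].
apply Ccont_plus; [apply Ccont_mult; apply Ccont_line|apply Ccont_const].
Qed.

(** The part of Cauchy's formula without a pole. With q the difference quotient of g at x, zeta q(-
    zeta^2) is odd on the imaginary axis, so its integral there vanishes. Goursat's theorem moves
    the line to Re zeta = r at the cost of the two horizontal sides, which are O(1/Y). *)
Lemma difference_quotient_integral (x Y : R) : 0 <= x -> r <= Y -> 2 * x <= Y ^ 2 ->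
  exists q : C -> C,
    (forall w, g w = (g (RtoC x) + q w * (w - x))%C) /\
    exists l, is_CInt (fun y => ((r, y) * q (- ((r, y) * (r, y)))%C)%C) (- Y) Y l /\
      Cmod l <= 8 * r * (B + Cmod (g (RtoC x))) / Y.
Proof.
intros Hx HrY HxY.
assert (HB := strip_bound_nonneg).
assert (HG := Cmod_ge_0 (g (RtoC x))).
destruct (Cdiff_on_axis x Hx) as [q [Hq Hg]].
exists q; split; [exact Hg|].
assert (Hqdiff : forall z, z <> RtoC x -> Cdiff g z -> Cdiff q z).
{ intros z Hz Hgz.
  apply (Cdiff_modify (fun w => ((g w - g (RtoC x)) * / (w - x))%C) q (RtoC x)).
  - exact Hz.
  - intros w Hw; rewrite (Hg w); field.
    intros E; apply Hw; replace w with (w - x + x)%C by ring; rewrite E; ring.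
  - apply Cdiff_mult.
    + apply Cdiff_minus; [exact Hgz|apply Cdiff_const].
    + apply (Cdiff_comp (fun w => (w - x)%C) Cinv).
      * apply Cdiff_minus; [apply Cdiff_id|apply Cdiff_const].
      * apply Cdiff_inv; intros E; apply Hz.
        replace z with (z - x + x)%C by ring; rewrite E; ring. }
set (Psi := fun zeta : C => (zeta * q (- (zeta * zeta))%C)%C).
assert (Hsq : forall zeta, 0 < Re zeta -> (- (zeta * zeta))%C <> RtoC x).
{ intros zeta Hz E; assert (H := half_plane_sqr_plus zeta x Hz Hx).
  rewrite <- E in H; replace (zeta * zeta + - (zeta * zeta))%C with (RtoC 0) in H by ring.
  rewrite Cmod_0 in H; simpl in H; nra. }
assert (HPd : forall zeta, 0 < Re zeta <= r -> Cdiff Psi zeta).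
{ intros zeta Hz; apply Cdiff_mult; [apply Cdiff_id|].
  apply (Cdiff_comp (fun z => (- (z * z))%C) q).
  - apply Cdiff_opp, Cdiff_mult; apply Cdiff_id.
  - apply Hqdiff; [apply Hsq; lra|apply Hdiff; lra]. }
assert (HPc : forall zeta, 0 <= Re zeta <= r -> Ccont (U := C_UniformSpace) Psi zeta).
{ intros zeta Hz; apply Ccont_mult; [apply Ccont_id|].
  apply (Ccont_comp _ (fun z => (- (z * z))%C) q).
  - apply Ccont_opp, Ccont_mult; apply Ccont_id.
  - destruct (excluded_middle_informative ((- (zeta * zeta))%C = RtoC x)) as [E|E].
    + rewrite E; exact Hq.
    + apply Cdiff_cont, Hqdiff; [exact E|apply Hdiff, Hz]. }
assert (HY : 0 < Y) by lra.
(* On the horizontal sides |zeta| <= 2 Y, and |- zeta^2 - x| >= Y^2 / 2 because 2 x <= Y^2. *)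
set (S := 4 * (B + Cmod (g (RtoC x))) / Y).
assert (HS : forall s Y', 0 <= s <= r -> Y' ^ 2 = Y ^ 2 -> Cmod (Psi (s, Y')) <= S).
{ intros s Y' Hs HY'.
  set (zeta := ((s, Y') : C)).
  assert (Hm2 : Cmod zeta ^ 2 = s ^ 2 + Y ^ 2).
  { rewrite Cmod2_alt; unfold zeta, Re, Im; cbn [fst snd]; rewrite HY'; reflexivity. }
  assert (Hm : Cmod zeta <= 2 * Y).
  { apply Rsqr_incr_0_var; [|lra]; unfold Rsqr; simpl in Hm2; nra. }
  assert (Hzx : Y ^ 2 / 2 <= Cmod (- (zeta * zeta) - x)).
  { assert (T := Cmod_triangle (- (zeta * zeta) - x)%C (RtoC x)).
    replace (- (zeta * zeta) - x + x)%C
      with (- (zeta * zeta))%C in T by ring.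
    rewrite Cmod_opp, Cmod_mult, Cmod_R, Rabs_pos_eq in T by exact Hx.
    replace (Cmod zeta * Cmod zeta) with (Cmod zeta ^ 2) in T by ring; rewrite Hm2 in T.
    generalize (pow2_ge_0 s); lra. }
  assert (Hy2 : 0 < Y ^ 2) by (apply pow_lt, HY).
  assert (Hq1 : Cmod (q (- (zeta * zeta))%C) * (Y ^ 2 / 2) <= B + Cmod (g (RtoC x))).
  { apply Rle_trans with (Cmod (g (- (zeta * zeta))%C - g (RtoC x))).
    - rewrite (Hg (- (zeta * zeta))%C).
      replace (g (RtoC x) + q (- (zeta * zeta))%C * (- (zeta * zeta) - x) - g (RtoC x))%C
        with (q (- (zeta * zeta))%C * (- (zeta * zeta) - x))%C by ring.
      rewrite Cmod_mult; apply Rmult_le_compat_l; [apply Cmod_ge_0|exact Hzx].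
    - unfold Cminus; eapply Rle_trans; [apply Cmod_triangle|]; rewrite Cmod_opp.
      apply Rplus_le_compat_r; eapply Rle_trans; [apply Hbound; exact Hs|].
      rewrite <- (Rmult_1_r B) at 2; apply Rmult_le_compat_l; [exact HB|].
      rewrite <- Rinv_1; apply Rinv_le_contravar; [lra|].
      apply pow_R1_Rle; generalize (pow2_ge_0 (Im zeta)); lra. }
  unfold Psi; rewrite Cmod_mult.
  apply Rle_trans with (2 * Y * ((B + Cmod (g (RtoC x))) / (Y ^ 2 / 2))).
  - apply Rmult_le_compat; try apply Cmod_ge_0; [exact Hm|].
    apply Rmult_le_reg_r with (Y ^ 2 / 2); [lra|].
    unfold Rdiv at 2; rewrite Rmult_assoc, Rinv_l, Rmult_1_r by lra; exact Hq1.
  - right; unfold S; field; lra. }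
assert (Hl : is_CInt (fun y => Psi (r, y)) (- Y) Y (CInt (fun y => Psi (r, y)) (- Y) Y)).
{ apply CInt_correct; [lra|]; intros y _; apply (Ccont_vertical Psi), HPc; simpl; lra. }
exists (CInt (fun y => Psi (r, y)) (- Y) Y); split; [exact Hl|].
apply le_epsilon; intros eps Heps.
assert (H0 : CInt (fun y => Psi (0, y)) (- Y) Y = RtoC 0).
{ apply (is_CInt_odd (fun y => Psi (0, y)) Y).
  - intros y; unfold Psi.
    replace (- ((0, - y)%R * (0, - y)%R))%C with (- ((0, y) * (0, y)))%C
      by (apply injective_projections; simpl; ring).
    replace ((0, - y) : C) with (- (0, y))%C by (apply injective_projections; simpl; ring).
    ring.
  - apply CInt_correct; [lra|]; intros y _; apply (Ccont_vertical Psi), HPc; simpl; lra. }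
destruct (uniform_continuity_fibre Psi 0 (- Y) Y (eps / (2 * Y)) ltac:(lra)) as [delta [Hd Hunif]].
{ intros y _; apply HPc; simpl; lra. }
{ apply Rdiv_lt_0_compat; lra. }
(* The points with - zeta^2 = x lie on the imaginary axis, and there [q] is only known to be
   continuous. Goursat is therefore applied for Re zeta >= d, and uniform continuity accounts for
   the remaining step to 0. *)
set (d := Rmin (delta / 2) r).
assert (Hd0 : 0 < d) by (apply Rmin_glb_lt; lra).
assert (Hd1 := Rmin_l (delta / 2) r); assert (Hd2 := Rmin_r (delta / 2) r); fold d in Hd1, Hd2.
assert (Hgour := goursat_rectangle Psi d r (- Y) Y Hd2 ltac:(lra)
  (fun s y Hs _ => HPd (s, y) ltac:(simpl; lra))).
assert (Hh : forall Y', Y' ^ 2 = Y ^ 2 -> Cmod (CInt (fun s => Psi (s, Y')) d r) <= r * S).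
{ intros Y' HY'; apply Rle_trans with ((r - d) * S).
  - apply (is_CInt_Cmod_le_const (fun s => Psi (s, Y'))); [exact Hd2| |].
    + intros s Hs; apply HS; [lra|exact HY'].
    + apply CInt_correct; [exact Hd2|]; intros s Hs; apply (Ccont_horizontal Psi), HPc; simpl; lra.
  - assert (0 <= S) by (apply Rmult_le_pos; [lra|left; apply Rinv_0_lt_compat, HY]); nra. }
assert (Hv : Cmod (CInt (fun y => Psi (d, y)) (- Y) Y) <= eps).
{ replace (CInt (fun y => Psi (d, y)) (- Y) Y) with
    (CInt (fun y => Psi (d, y)) (- Y)%R Y - CInt (fun y => Psi (0, y)) (- Y)%R Y)%C
    by (rewrite H0; ring).
  apply Rle_trans with ((Y - - Y) * (eps / (2 * Y))); [|right; field; lra].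
  apply (is_CInt_Cmod_le_const (fun y => (Psi (d, y) - Psi (0, y))%C)); [lra| |].
  - intros y Hy; left; apply Hunif; [|exact Hy].
    rewrite Rminus_0_r, Rabs_pos_eq; lra.
  - apply is_CInt_minus; apply CInt_correct; try lra; intros y _;
      apply (Ccont_vertical Psi), HPc; simpl; lra. }
unfold boundary_integral in Hgour.
set (V := CInt (fun y => Psi (r, y)) (- Y) Y) in *.
set (V0 := CInt (fun y => Psi (d, y)) (- Y) Y) in *.
assert (Ha := Hh Y eq_refl); assert (Hb := Hh (- Y) ltac:(ring)).
set (A1 := CInt (fun s => Psi (s, Y)) d r) in *.
set (A2 := CInt (fun s => Psi (s, - Y)) d r) in *.
assert (E : (Ci * V)%C = (A1 + - A2 + Ci * V0)%C).
{ replace (Ci * V)%C with (A2 + Ci * V - (A1 + Ci * V0) + (A1 + - A2 + Ci * V0))%C by ring.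
  rewrite Hgour; ring. }
replace (Cmod V) with (Cmod (Ci * V)) by (rewrite Cmod_mult, Cmod_Ci; ring).
rewrite E; eapply Rle_trans; [apply Cmod_triangle|].
rewrite Cmod_mult, Cmod_Ci, Rmult_1_l.
apply Rplus_le_compat; [|exact Hv].
eapply Rle_trans; [apply Cmod_triangle|]; rewrite Cmod_opp.
replace (8 * r * (B + Cmod (g (RtoC x))) / Y) with (r * S + r * S) by (unfold S; field; lra).
lra.
Qed.

(** Partial fractions at the poles +- i sqrt x: the real part integrates to arctangents and the
    imaginary part is odd in y. The value tends to PI, the constant in front of g(x) in Cauchy's
    formula. *)
Lemma pole_integral (x Y : R) : 0 <= x -> 0 < Y ->
  is_CInt (fun y => ((r, y) * / ((r, y) * (r, y) + x))%C) (- Y) Y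
    (RtoC (atan ((Y - sqrt x) / r) + atan ((Y + sqrt x) / r))).
Proof.
intros Hx HY.
set (a := sqrt x); assert (Ea : x = a * a) by (symmetry; apply sqrt_sqrt, Hx).
assert (Hp : forall t, 0 < r ^ 2 + t ^ 2).
{ intros t; generalize (pow2_ge_0 t) (pow_lt r 2 Hr); lra. }
set (F := fun y : R => (1 / 2 * (atan ((y - a) / r) + atan ((y + a) / r)),
   - (1 / 4) * (ln (r ^ 2 + (y - a) ^ 2) + ln (r ^ 2 + (y + a) ^ 2))) : C).
assert (Hval : forall y, ((r, y) * / ((r, y) * (r, y) + x))%C =
  (1 / 2 * (r / (r ^ 2 + (y - a) ^ 2) + r / (r ^ 2 + (y + a) ^ 2)),
   - (1 / 2) * ((y - a) / (r ^ 2 + (y - a) ^ 2) + (y + a) / (r ^ 2 + (y + a) ^ 2)))).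
{ intros y; rewrite Ea.
  assert (N1 := Hp (y - a)); assert (N2 := Hp (y + a)).
  assert (N3 : (r * r - y * y + a * a) ^ 2 + (r * y + y * r + 0) ^ 2 =
     (r ^ 2 + (y - a) ^ 2) * (r ^ 2 + (y + a) ^ 2)) by ring.
  assert (N4 : 0 < (r * r - y * y + a * a) ^ 2 + (r * y + y * r + 0) ^ 2)
    by (rewrite N3; apply Rmult_lt_0_compat; assumption).
  unfold Cmult, Cinv, Cplus, RtoC; cbn [fst snd].
  apply injective_projections; cbn [fst snd]; rewrite N3; field; lra. }
replace (RtoC (atan ((Y - a) / r) + atan ((Y + a) / r))) with (F Y - F (- Y)%R)%C.
- apply is_CInt_derive; [lra| | |].
  + intros y _; rewrite Hval; unfold F; simpl.
    auto_derive; [auto|].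
    assert (N1 := Hp (y - a)); assert (N2 := Hp (y + a)).
    unfold Rsqr; field; simpl in N1, N2; repeat split; try lra; nra.
  + intros y _; rewrite Hval; unfold F; simpl.
    assert (N1 := Hp (y - a)); assert (N2 := Hp (y + a)); simpl in N1, N2.
    auto_derive; [unfold Rminus in *; repeat split; lra|].
    field; repeat split; lra.
  + intros y _; apply Ccont_mult; [apply Ccont_line|].
    apply Ccont_inv; [|apply line_denominator_neq, Hx].
    apply Ccont_plus; [apply Ccont_mult; apply Ccont_line|apply Ccont_const].
- unfold F; apply injective_projections; cbn [fst snd Cminus Cplus Copp RtoC].
  + replace ((- Y - a) / r) with (- ((Y + a) / r)) by (field; lra).
    replace ((- Y + a) / r) with (- ((Y - a) / r)) by (field; lra).
    rewrite !atan_opp; field.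
  + replace ((- Y - a) ^ 2) with ((Y + a) ^ 2) by ring.
    replace ((- Y + a) ^ 2) with ((Y - a) ^ 2) by ring; ring.
Qed.

Lemma cauchy_strip_limit (x : R) : 0 <= x -> exists c Y0, 0 < Y0 /\ forall Y, Y0 <= Y ->
  Cmod (PI * g (RtoC x) - CInt (line_kernel x) (- Y)%R Y) <= c / Y.
Proof.
intros Hx; set (a := sqrt x); assert (Ha : 0 <= a) by apply sqrt_pos.
set (G := Cmod (g (RtoC x))).
exists (8 * r * (B + G) + 3 * r * G), (r + 2 * a + 1 + x + 1); split; [lra|].
intros Y HY; assert (HY0 : 0 < Y) by lra.
destruct (difference_quotient_integral x Y Hx ltac:(lra) ltac:(simpl; nra)) as [q [Hq [l [Hl Hlb]]]].
assert (Hpole := pole_integral x Y Hx HY0); fold a in Hpole.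
set (p := atan ((Y - a) / r) + atan ((Y + a) / r)) in *.
assert (HK : is_CInt (line_kernel x) (- Y) Y (g (RtoC x) * p - l)%C).
(* As - zeta^2 - x is minus the denominator, the kernel is g(x) times the pole term minus zeta q(-
   zeta^2). *)
{ assert (H := is_CInt_minus _ _ _ _ _ _ (is_CInt_mult_l (g (RtoC x)) _ _ _ _ Hpole) Hl).
  revert H; apply is_CInt_ext; [lra|]; intros y _; unfold line_kernel.
  rewrite (Hq (- ((r, y) * (r, y)))%C).
  field; apply line_denominator_neq, Hx. }
rewrite (is_CInt_unique _ _ _ _ HK).
replace (PI * g (RtoC x) - (g (RtoC x) * p - l))%C
  with (l + RtoC (PI - p) * g (RtoC x))%C by (rewrite RtoC_minus; ring).
eapply Rle_trans; [apply Cmod_triangle|]; rewrite Cmod_mult, Cmod_R; fold G.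
assert (Hp1 : 0 < (Y - a) / r) by (apply Rdiv_lt_0_compat; lra).
assert (Hp2 : 0 < (Y + a) / r) by (apply Rdiv_lt_0_compat; lra).
assert (T1 := atan_tail _ Hp1); assert (T2 := atan_tail _ Hp2).
assert (HG : 0 <= G) by apply Cmod_ge_0.
assert (Hpp : Rabs (PI - p) <= 3 * r / Y).
{ unfold p; rewrite Rabs_pos_eq by lra.
  apply Rle_trans with (/ ((Y - a) / r) + / ((Y + a) / r)); [lra|].
  apply Rle_trans with (2 * r / Y + r / Y); [|right; field; lra].
  apply Rplus_le_compat.
  - replace (2 * r / Y) with (/ (Y / 2 / r)) by (field; lra).
    apply Rinv_le_contravar; [repeat apply Rdiv_lt_0_compat; lra|].
    apply Rmult_le_compat_r; [left; apply Rinv_0_lt_compat, Hr|lra].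
  - replace (r / Y) with (/ (Y / r)) by (field; lra).
    apply Rinv_le_contravar; [apply Rdiv_lt_0_compat; lra|].
    apply Rmult_le_compat_r; [left; apply Rinv_0_lt_compat, Hr|lra]. }
apply Rle_trans with (8 * r * (B + G) / Y + 3 * r / Y * G); [|right; field; lra].
apply Rplus_le_compat; [exact Hlb|apply Rmult_le_compat_r; assumption].
Qed.

Definition strip_const : R := (r + 1) * B / r ^ 2.

Lemma strip_const_nonneg : 0 <= strip_const.
Proof.
generalize strip_bound_nonneg; intros HB.
apply Rmult_le_pos; [nra|left; apply Rinv_0_lt_compat, pow_lt, Hr].
Qed.

Lemma g_line_bound (y : R) :
  Cmod ((r, y) * g (- ((r, y) * (r, y)))%C) <= (r + 1) * B / (1 + y ^ 2).
Proof.
generalize strip_bound_nonneg; intros HB; rewrite Cmod_mult.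
assert (Hy : 0 <= y ^ 2) by apply pow2_ge_0.
apply Rle_trans with (((r + 1) * (1 + y ^ 2)) * (B / (1 + y ^ 2) ^ 2)); [|right; field; lra].
apply Rmult_le_compat; try apply Cmod_ge_0.
- eapply Rle_trans; [apply Cmod_le_parts|]; simpl.
  rewrite Rabs_pos_eq by lra.
  assert (Rabs y <= 1 + y ^ 2).
  { rewrite <- pow2_abs; generalize (pow2_ge_0 (Rabs y - 1)); simpl; intros; generalize (Rabs_pos
      y); nra. }
  simpl in *; nra.
- apply (Hbound (r, y)); simpl; lra.
Qed.

Lemma line_kernel_bound (x y : R) : 0 <= x -> Cmod (line_kernel x y) <= strip_const / (1 + y ^ 2).
Proof.
intros Hx; unfold line_kernel; rewrite Cmod_mult, Cmod_inv by (apply line_denominator_neq, Hx).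
assert (Hy : 0 <= y ^ 2) by apply pow2_ge_0.
assert (Hr2 := pow_lt r 2 Hr).
replace (strip_const / (1 + y ^ 2)) with ((r + 1) * B / (1 + y ^ 2) * / r ^ 2)
  by (unfold strip_const; field; lra).
apply Rmult_le_compat; [apply Cmod_ge_0| |apply g_line_bound|].
- left; apply Rinv_0_lt_compat; eapply Rlt_le_trans; [exact Hr2|apply line_denominator, Hx].
- apply Rinv_le_contravar; [exact Hr2|apply line_denominator, Hx].
Qed.

Lemma is_RInt_atan (c a b : R) : is_RInt (fun y => c / (1 + y ^ 2)) a b (c * (atan b - atan a)).
Proof.
replace (c * (atan b - atan a)) with (minus (c * atan b) (c * atan a))
  by (unfold minus, plus, opp; simpl; ring).
apply (is_RInt_derive (V := R_CompleteNormedModule) (fun y => c * atan y)).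
- intros y _; auto_derive; [auto|]; unfold Rsqr; field; generalize (pow2_ge_0 y); simpl; lra.
- intros y _; apply (ex_derive_continuous (V := R_NormedModule)); auto_derive.
  generalize (pow2_ge_0 y); simpl; lra.
Qed.

(** [cauchy_strip_limit] identifies the limit at a rate that depends on x. Comparing the integrals
    over [-Y, Y] and a larger [-Z, Z] through [line_kernel_bound] makes the error uniform in x, so
    that it can be integrated over [0, X]. *)
Lemma cauchy_strip (x Y : R) : 0 <= x -> 0 < Y ->
  Cmod (PI * g (RtoC x) - CInt (line_kernel x) (- Y)%R Y) <=
  strip_const * (PI - 2 * atan Y).
Proof.
intros Hx HY; assert (HC := strip_const_nonneg).
destruct (cauchy_strip_limit x Hx) as [c [Y0 [HY0 Hlim]]].
assert (Hc : forall y, Ccont (line_kernel x) y) by (intros; apply Ccont_line_kernel, Hx).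
apply le_epsilon; intros eps Heps.
set (Z := Rmax Y (Rmax Y0 (c / eps))).
assert (HZ1 : Y <= Z) by apply Rmax_l.
assert (HZ2 : Y0 <= Z) by (eapply Rle_trans; [apply Rmax_l|apply Rmax_r]).
assert (HZ3 : c / eps <= Z) by (eapply Rle_trans; [apply Rmax_r|apply Rmax_r]).
specialize (Hlim Z HZ2).
assert (Hce : c / Z <= eps).
{ apply Rmult_le_reg_r with Z; [lra|]; unfold Rdiv; rewrite Rmult_assoc, Rinv_l, Rmult_1_r by lra.
  apply (Rmult_le_compat_l eps) in HZ3; [|lra].
  replace (eps * (c / eps)) with c in HZ3 by (field; lra); exact HZ3. }
assert (E : CInt (line_kernel x) (- Z) Z = (CInt (line_kernel x) (- Z)%R (- Y)%R + (CInt
    (line_kernel x) (- Y)%R Y + CInt (line_kernel x) Y Z))%C).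
{ rewrite (CInt_Chasles _ (- Z) (- Y) Z), (CInt_Chasles _ (- Y) Y Z) by (try lra; auto); reflexivity. }
assert (H1 : Cmod (CInt (line_kernel x) (- Z) (- Y)) <= strip_const * (atan (- Y) - atan (- Z))).
{ apply (is_CInt_Cmod_le (line_kernel x) (fun y => strip_const / (1 + y ^ 2)) (- Z) (- Y));
    [lra| |apply CInt_correct; [lra|auto]|apply is_RInt_atan].
  intros; apply line_kernel_bound, Hx. }
assert (H2 : Cmod (CInt (line_kernel x) Y Z) <= strip_const * (atan Z - atan Y)).
{ apply (is_CInt_Cmod_le (line_kernel x) (fun y => strip_const / (1 + y ^ 2)) Y Z);
    [lra| |apply CInt_correct; [lra|auto]|apply is_RInt_atan].
  intros; apply line_kernel_bound, Hx. }
rewrite !atan_opp in H1.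
replace (PI * g (RtoC x) - CInt (line_kernel x) (- Y)%R Y)%C with
  (PI * g (RtoC x) - CInt (line_kernel x) (- Z)%R Z + (CInt (line_kernel x) (- Z)%R (- Y)%R + CInt
      (line_kernel x) Y Z))%C by (rewrite E; ring).
eapply Rle_trans; [apply Cmod_triangle|].
eapply Rle_trans; [apply Rplus_le_compat_l, Cmod_triangle|].
assert (HZt := atan_bound Z).
assert (strip_const * (- atan Y - - atan Z) + strip_const * (atan Z - atan Y) <=
  strip_const * (PI - 2 * atan Y)) by nra.
lra.
Qed.

Lemma Ccont_g_axis (x : R) : 0 <= x -> Ccont (fun x => g (RtoC x)) x.
Proof.
intros Hx; apply (Ccont_comp _ RtoC g); [apply Ccont_RtoC, continuous_id|].
apply Cdiff_cont, Cdiff_on_axis, Hx.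
Qed.

(** Duality: by Cauchy's formula, a functional of g on the half-line is an average over the line Re
    zeta = r of its values on the kernels 1 / (zeta^2 + x). The case [lambda = 0] yields
    coefficients, and [lambda = 1] the remainder of the expansion at [x0]. *)
Lemma strip_functional_bound (lambda x0 X T : R) (phi : R -> R) : 0 <= x0 -> 0 <= X ->
  (forall x, continuous phi x) ->
  (forall y, Cmod ((r, y) * g (- ((r, y) * (r, y)))%C) *
     Cmod (lambda * / ((r, y) * (r, y) + x0) - CInt (fun x => (RtoC (phi x) * / ((r, y) * (r, y) +
         x))%C) 0 X)
     <= T / (1 + y ^ 2)) ->
  Cmod (lambda * g (RtoC x0) - CInt (fun x => (RtoC (phi x) * g (RtoC x))%C) 0 X) <= T.
Proof.
intros Hx0 HX Hphi HT.
assert (HC := strip_const_nonneg).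
assert (HT0 : 0 <= T).
{ specialize (HT 0); replace (1 + 0 ^ 2) with 1 in HT by ring; rewrite Rdiv_1_r in HT.
  eapply Rle_trans; [|exact HT]; apply Rmult_le_pos; apply Cmod_ge_0. }
destruct (bounded_continuity (K := R_AbsRing) (V := R_NormedModule) phi 0 X
   (fun x _ => Hphi x)) as [Mphi HM].
assert (HM' : forall x, 0 <= x <= X -> Rabs (phi x) <= Mphi) by (intros x Hx; left; apply (HM x Hx)).
assert (HM0 : 0 <= Mphi) by (eapply Rle_trans; [apply Rabs_pos|apply (HM' 0); lra]).
set (D := (lambda * g (RtoC x0) - CInt (fun x => (RtoC (phi x) * g (RtoC x))%C) 0 X)%C).
assert (HgX : is_CInt (fun x => (RtoC (phi x) * g (RtoC x))%C) 0 X
   (CInt (fun x => (RtoC (phi x) * g (RtoC x))%C) 0 X)).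
{ apply CInt_correct; [exact HX|]; intros x Hx; apply Ccont_mult;
    [apply Ccont_RtoC, Hphi|apply Ccont_g_axis; lra]. }
set (c := strip_const * (Rabs lambda + X * Mphi)).
assert (Hc : 0 <= c).
{ apply Rmult_le_pos; [exact HC|]; generalize (Rabs_pos lambda); nra. }
assert (Hfin : forall Y, 0 < Y -> PI * Cmod D <= T * PI + c * (2 / Y)).
{ intros Y HY.
  (* [fubini_rectangle] asks for continuity on the whole plane; the absolute value keeps the
     denominator away from 0 for negative x. *)
  set (F := fun w : C => (RtoC (phi (fst w)) * ((r, snd w) * g (- ((r, snd w) * (r, snd w)))%C) * /
      ((r, snd w) * (r, snd w) + RtoC (Rabs (fst w))))%C).
  assert (HF : forall w, Ccont (U := C_UniformSpace) F w).
  { intros w; assert (Hfst : continuous (fun w : C_UniformSpace => fst w) w)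
      by (apply (Ccont_Re _ (fun w => w)), Ccont_id).
    assert (Hsnd : continuous (fun w : C_UniformSpace => snd w) w)
      by (apply (Ccont_Im _ (fun w => w)), Ccont_id).
    assert (Hrs : Ccont (U := C_UniformSpace) (fun w => (r, snd w) : C) w)
      by (apply Ccont_pair; [apply continuous_const|exact Hsnd]).
    apply Ccont_mult; [apply Ccont_mult|].
    - apply Ccont_RtoC, (continuous_comp (fun w : C_UniformSpace => fst w) phi); auto.
    - apply (continuous_comp (fun w : C_UniformSpace => snd w)
        (fun y => ((r, y) * g (- ((r, y) * (r, y)))%C)%C : C_UniformSpace)); [exact Hsnd|].
      apply Ccont_g_line.
    - apply Ccont_inv; [|apply line_denominator_neq, Rabs_pos].
      apply Ccont_plus; [apply Ccont_mult; exact Hrs|].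
      apply Ccont_RtoC, (continuous_comp (fun w : C_UniformSpace => fst w) Rabs); [exact Hfst|].
      apply continuous_Rabs. }
  assert (Hfub := fubini_rectangle F 0 X (- Y) Y HX ltac:(lra) HF).
  assert (Hx_in : forall x, 0 <= x -> CInt (fun y => F (x, y)) (- Y) Y =
     (RtoC (phi x) * CInt (line_kernel x) (- Y)%R Y)%C).
  { intros x Hx; apply is_CInt_unique.
    assert (H := is_CInt_mult_l (RtoC (phi x)) _ _ _ _
      (CInt_correct (line_kernel x) (- Y) Y ltac:(lra) (fun y _ => Ccont_line_kernel x y Hx))).
    revert H; apply is_CInt_ext; [lra|]; intros y _; unfold F, line_kernel; cbn [fst snd].
    rewrite Rabs_pos_eq by exact Hx; ring. }
  assert (Hy_in : forall y, CInt (fun x => F (x, y)) 0 X =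
     ((r, y) * g (- ((r, y) * (r, y)))%C * CInt (fun x => (RtoC (phi x) * / ((r, y) * (r, y) +
         x))%C) 0 X)%C).
  { intros y; apply is_CInt_unique.
    assert (H := is_CInt_mult_l ((r, y) * g (- ((r, y) * (r, y)))%C)%C _ _ _ _
      (CInt_correct (fun x => (RtoC (phi x) * / ((r, y) * (r, y) + x))%C) 0 X
       HX (fun x Hx => Ccont_mult _ _ _ _ (Ccont_RtoC _ _ _ (Hphi x))
         (Ccont_inv _ _ _ (Ccont_plus _ _ _ _ (Ccont_const _ ((r, y) * (r, y))%C x)
            (Ccont_RtoC _ _ _ (continuous_id x))) (line_denominator_neq x y (proj1 Hx)))))).
    revert H; apply is_CInt_ext; [exact HX|]; intros x Hx; unfold F; cbn [fst snd].
    rewrite Rabs_pos_eq by lra; ring. }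
  assert (HI2 : is_CInt (fun x => CInt (fun y => F (x, y)) (- Y) Y) 0 X
      (CInt (fun x => CInt (fun y => F (x, y)) (- Y) Y) 0 X)).
  { apply CInt_correct; [exact HX|]; intros; apply Ccont_CInt_param; [lra|exact HF]. }
  assert (HI1 : is_CInt (fun y => CInt (fun x => F (x, y)) 0 X) (- Y) Y
      (CInt (fun y => CInt (fun x => F (x, y)) 0 X) (- Y) Y)).
  { apply CInt_correct; [lra|]; intros; apply Ccont_CInt_param'; [lra|exact HF]. }
  set (I1 := CInt (fun y => CInt (fun x => F (x, y)) 0 X) (- Y) Y) in *.
  set (I0 := CInt (line_kernel x0) (- Y) Y).
  assert (Hmain : Cmod (lambda * I0 - I1) <= T * (atan Y - atan (- Y))).
  { apply (is_CInt_Cmod_le (fun y => (lambda * line_kernel x0 y - CInt (fun x => F (x, y)) 0 X)%C)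
      (fun y => T / (1 + y ^ 2)) (- Y) Y); [lra| | |apply is_RInt_atan].
    - intros y _; rewrite Hy_in; eapply Rle_trans; [|apply HT].
      rewrite <- Cmod_mult; right; f_equal; unfold line_kernel; ring.
    - apply is_CInt_minus; [|exact HI1].
      apply is_CInt_mult_l, CInt_correct; [lra|]; intros; apply Ccont_line_kernel, Hx0. }
  assert (Herr : Cmod (PI * CInt (fun x => (RtoC (phi x) * g (RtoC x))%C) 0 X - I1)
      <= (X - 0) * (Mphi * (strip_const * (PI - 2 * atan Y)))).
  { rewrite <- Hfub.
    apply (is_CInt_Cmod_le_const (fun x => (PI * (RtoC (phi x) * g (RtoC x)) - CInt (fun y => F (x,
        y)) (- Y)%R Y)%C)); [exact HX| |].
    - intros x Hx; rewrite Hx_in by lra.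
      replace (PI * (RtoC (phi x) * g (RtoC x)) - RtoC (phi x) * CInt (line_kernel x) (- Y)%R Y)%C with
         (RtoC (phi x) * (PI * g (RtoC x) - CInt (line_kernel x) (- Y)%R Y))%C by ring.
      rewrite Cmod_mult, Cmod_R; apply Rmult_le_compat; [apply Rabs_pos|apply Cmod_ge_0|auto|].
      apply cauchy_strip; lra.
    - apply is_CInt_minus; [apply is_CInt_mult_l, HgX|exact HI2]. }
  assert (H0 := cauchy_strip x0 Y Hx0 HY); fold I0 in H0.
  rewrite <- (Rabs_pos_eq PI) at 1 by (generalize PI_RGT_0; lra).
  rewrite <- Cmod_R, <- Cmod_mult.
  set (J := CInt (fun x => (RtoC (phi x) * g (RtoC x))%C) 0 X) in *.
  replace (PI * D)%C with (lambda * I0 - I1 + (lambda * (PI * g (RtoC x0) - I0) + - (PI * J -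
      I1)))%C by (unfold D; ring).
  eapply Rle_trans; [apply Cmod_triangle|].
  apply Rplus_le_compat.
  - eapply Rle_trans; [exact Hmain|]; rewrite atan_opp.
    generalize (atan_bound Y); intros; nra.
  - eapply Rle_trans; [apply Cmod_triangle|]; rewrite Cmod_opp, Cmod_mult, Cmod_R.
    assert (Hat : PI - 2 * atan Y <= 2 / Y).
    { generalize (atan_tail Y HY); unfold Rdiv; lra. }
    apply Rle_trans with (c * (PI - 2 * atan Y)).
    + unfold c.
      assert (Rabs lambda * Cmod (PI * g (RtoC x0) - I0) <=
        Rabs lambda * (strip_const * (PI - 2 * atan Y)))
        by (apply Rmult_le_compat_l; [apply Rabs_pos|exact H0]).
      lra.
    + apply Rmult_le_compat_l; [exact Hc|exact Hat]. }
assert (HPI := PI_RGT_0).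
apply Rmult_le_reg_l with PI; [exact HPI|].
apply le_epsilon; intros eps Heps.
eapply Rle_trans; [apply (Hfin (2 * c / eps + 1))|].
{ assert (0 <= 2 * c / eps) by (apply Rmult_le_pos; [lra|left; apply Rinv_0_lt_compat, Heps]); lra. }
rewrite (Rmult_comm T); apply Rplus_le_compat_l.
assert (0 <= 2 * c / eps) by (apply Rmult_le_pos; [lra|left; apply Rinv_0_lt_compat, Heps]).
apply Rmult_le_reg_r with (2 * c / eps + 1); [lra|].
replace (c * (2 / (2 * c / eps + 1)) * (2 * c / eps + 1)) with (2 * c) by (field; lra).
rewrite Rmult_plus_distr_l; replace (eps * (2 * c / eps)) with (2 * c) by (field; lra); lra.
Qed.

End CauchyOnStrip.

(** * Laguerre expansions *)

Fixpoint Csum (a : nat -> C) (n : nat) : C :=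
  match n with
  | O => a 0%nat
  | S n => (Csum a n + a (S n))%C
  end.

Lemma Re_Csum (a : nat -> C) (n : nat) : Re (Csum a n) = sum_f_R0 (fun k => Re (a k)) n.
Proof. induction n as [|n IH]; [reflexivity|]; simpl; rewrite <- IH; reflexivity. Qed.

Lemma Csum_minus_bound (a b : nat -> C) (e : nat -> R) (n : nat) :
  (forall k, (k <= n)%nat -> Cmod (a k - b k) <= e k) ->
  Cmod (Csum a n - Csum b n) <= sum_f_R0 e n.
Proof.
induction n as [|n IH]; intros H; [apply H; lia|].
simpl; replace (Csum a n + a (S n) - (Csum b n + b (S n)))%C with
  (Csum a n - Csum b n + (a (S n) - b (S n)))%C by ring.
eapply Rle_trans; [apply Cmod_triangle|].
apply Rplus_le_compat; [apply IH; intros; apply H; lia|apply H; lia].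
Qed.

(** The weight times the reproducing kernel of the polynomials of degree at most n. *)
Definition laguerre_kernel (x0 : R) (n : nat) (x : R) : R :=
  exp (- x) * sum_f_R0 (fun k => laguerre k x0 * laguerre k x) n.

(** The Fourier-Laguerre coefficient with its integral cut off at [X]. *)
Definition laguerre_moment (h : R -> C) (k : nat) (X : R) : C :=
  CInt (fun x => (RtoC (exp (- x) * laguerre k x) * h x)%C) 0 X.

Lemma continuous_weighted_laguerre (k : nat) (x : R) :
  continuous (fun x => exp (- x) * laguerre k x) x.
Proof.
apply continuous_Rmult; [|apply continuous_laguerre].
apply (ex_derive_continuous (V := R_NormedModule)); auto_derive; auto.
Qed.

Lemma laguerre_moment_correct (h : R -> C) (k : nat) (X : R) : 0 <= X ->
  (forall x, 0 <= x <= X -> Ccont h x) ->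
  is_CInt (fun x => (RtoC (exp (- x) * laguerre k x) * h x)%C) 0 X (laguerre_moment h k X).
Proof.
intros HX Hh; apply CInt_correct; [exact HX|]; intros x Hx; apply Ccont_mult; [|auto].
apply Ccont_RtoC, continuous_weighted_laguerre.
Qed.

Lemma continuous_laguerre_kernel (x0 : R) (n : nat) (x : R) : continuous (laguerre_kernel x0 n) x.
Proof.
apply continuous_Rmult.
- apply (ex_derive_continuous (V := R_NormedModule)); auto_derive; auto.
- induction n as [|n IH]; simpl.
  + apply continuous_Rmult; [apply continuous_const|apply continuous_laguerre].
  + apply continuous_Rplus; [exact IH|].
    apply (continuous_Rmult R_UniformSpace (fun _ => laguerre (S n) x0));
      [apply continuous_const|apply continuous_laguerre].
Qed.

Lemma is_CInt_laguerre_kernel (h : R -> C) (x0 : R) (n : nat) (X : R) : 0 <= X ->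
  (forall x, 0 <= x <= X -> Ccont h x) ->
  is_CInt (fun x => (RtoC (laguerre_kernel x0 n x) * h x)%C) 0 X
    (Csum (fun k => (RtoC (laguerre k x0) * laguerre_moment h k X)%C) n).
Proof.
intros HX Hh; induction n as [|n IH]; simpl.
- assert (H := is_CInt_mult_l (RtoC (laguerre 0 x0)) _ _ _ _ (laguerre_moment_correct h 0 X HX Hh)).
  revert H; apply is_CInt_ext; [exact HX|]; intros x _; unfold laguerre_kernel; simpl.
  rewrite !RtoC_mult; ring.
- assert (H := is_CInt_plus _ _ _ _ _ _ IH (is_CInt_mult_l (RtoC (laguerre (S n) x0)) _ _ _ _
    (laguerre_moment_correct h (S n) X HX Hh))).
  revert H; apply is_CInt_ext; [exact HX|]; intros x _; unfold laguerre_kernel; simpl.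
  rewrite Rmult_plus_distr_l, RtoC_plus, !RtoC_mult; ring.
Qed.

(** Orthogonality to the constants, read off from the Laplace transform (s - 1)^k / s^(k+1) at s =
    1, where 0^0 = 1 is the case of degree 0. *)
Lemma laguerre_moment_1 (k : nat) (X : R) : 0 <= X ->
  Cmod (laguerre_moment (fun _ => RtoC 1) k X - (if k then RtoC 1 else RtoC 0)) <=
  4 * (INR k + 1) ^ 2 * exp (- X / 2).
Proof.
intros HX.
replace (laguerre_moment (fun _ => RtoC 1) k X) with (laguerre_laplace k (RtoC 1) X).
2:{ apply CInt_ext; [exact HX|]; intros x _.
    replace (- (1 * x))%C with (RtoC (- x)) by (rewrite RtoC_opp; ring).
    replace (Cexp (RtoC (- x))) with (RtoC (exp (- x))).
    - rewrite RtoC_mult; ring.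
    - unfold Cexp; simpl; rewrite cos_0, sin_0; apply injective_projections; simpl; ring. }
assert (H := laguerre_laplace_error k (RtoC 1) X HX ltac:(simpl; lra)).
replace (if k then RtoC 1 else RtoC 0) with
  ((1 - 1) ^ k / 1 ^ (S k))%C.
2:{ rewrite Cpow_1_l; replace (1 - 1)%C with (RtoC 0) by ring.
    destruct k; simpl; field. }
eapply Rle_trans; [exact H|].
assert (Hs := sum_laguerre_bound k X HX).
apply Rle_trans with (4 * exp (- X) * ((INR k + 1) ^ 2 * exp (X / 2))).
- simpl Re; rewrite Rmult_1_l; apply Rmult_le_compat_l; [|exact Hs].
  generalize (exp_pos (- X)); lra.
- right; replace (- X / 2) with (- X + X / 2) by field; rewrite exp_plus; ring.
Qed.

Lemma laguerre_kernel_mass (x0 : R) (n : nat) (X : R) : 0 <= X ->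
  Cmod (Csum (fun k => (RtoC (laguerre k x0) * laguerre_moment (fun _ => RtoC 1) k X)%C) n - 1) <=
      sum_f_R0 (fun k => Rabs (laguerre k x0) * (4 * (INR k + 1) ^ 2)) n * exp (- X / 2).
Proof.
intros HX.
assert (E : RtoC 1 = Csum (fun k => (RtoC (laguerre k x0) * (if k then RtoC 1 else RtoC 0))%C) n).
{ induction n as [|n IH]; simpl; [rewrite laguerre_0; ring|rewrite <- IH; ring]. }
match goal with |- Cmod (?a - _) <= _ => replace (a - 1)%C with
  (a - Csum (fun k => (RtoC (laguerre k x0) * (if k then RtoC 1 else RtoC 0))%C) n)%C
  by (rewrite <- E; reflexivity) end.
rewrite Rmult_comm, scal_sum; apply Csum_minus_bound; intros k Hk.
replace (RtoC (laguerre k x0) * laguerre_moment (fun _ => RtoC 1) k X - RtoC (laguerre k x0) * (if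
    k then RtoC 1 else RtoC 0))%C with
  (RtoC (laguerre k x0) * (laguerre_moment (fun _ => RtoC 1) k X - (if k then RtoC 1 else RtoC 0)))%C
  by ring.
rewrite Cmod_mult, Cmod_R, Rmult_assoc; apply Rmult_le_compat_l; [apply Rabs_pos|].
apply laguerre_moment_1, HX.
Qed.

(** Since 1 / (zeta^2 + x) = (1 + (x0 - x) / (zeta^2 + x)) / (zeta^2 + x0), Christoffel-Darboux
    applies to the second term: the remainder on a Cauchy kernel involves only the two transforms of
    degrees n and n + 1. *)
Lemma laguerre_kernel_stieltjes (x0 : R) (n : nat) (zeta : C) (X : R) : 0 <= X ->
  0 <= x0 -> 0 < Re zeta ->
  CInt (fun x => (RtoC (laguerre_kernel x0 n x) * / (zeta * zeta + x))%C) 0 X =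
  (/ (zeta * zeta + x0) * (Csum (fun k => (RtoC (laguerre k x0) * laguerre_moment (fun _ => RtoC 1)
      k X)%C) n + RtoC (INR (S n)) * (RtoC (laguerre n x0) * stieltjes (S n) zeta X - RtoC
          (laguerre (S n) x0) * stieltjes n zeta X)))%C.
Proof.
intros HX Hx0 Hz.
assert (Hne : forall x, 0 <= x -> (zeta * zeta + x)%C <> RtoC 0).
{ intros x Hx; apply Cmod_gt_0; eapply Rlt_le_trans; [|apply half_plane_sqr_plus; eassumption].
  apply pow_lt, Hz. }
assert (Hh : forall x, 0 <= x <= X -> Ccont (fun x : R => (/ (zeta * zeta + x))%C) x).
{ intros x Hx; apply Ccont_inv; [|apply Hne; lra].
  apply Ccont_plus; [apply Ccont_const|apply Ccont_RtoC, continuous_id]. }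
assert (H1 := is_CInt_laguerre_kernel (fun _ => RtoC 1) x0 n X HX (fun x _ => Ccont_const _ (RtoC 1) x)).
assert (HS : forall k, is_CInt (fun x => (RtoC (exp (- x) * laguerre k x) * / (zeta * zeta + x))%C)
    0 X (stieltjes k zeta X)).
{ intros k; apply (laguerre_moment_correct (fun x : R => (/ (zeta * zeta + x))%C) k X HX Hh). }
assert (H2 := is_CInt_mult_l (RtoC (INR (S n))) _ _ _ _ (is_CInt_minus _ _ _ _ _ _
  (is_CInt_mult_l (RtoC (laguerre n x0)) _ _ _ _ (HS (S n)))
  (is_CInt_mult_l (RtoC (laguerre (S n) x0)) _ _ _ _ (HS n)))).
assert (H3 := is_CInt_mult_l (/ (zeta * zeta + x0))%C _ _ _ _
  (is_CInt_plus _ _ _ _ _ _ H1 H2)).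
apply is_CInt_unique; revert H3; apply is_CInt_ext; [exact HX|]; intros x Hx; cbv beta.
assert (E : (RtoC (INR (S n)) * (RtoC (laguerre n x0) * (RtoC (exp (- x) * laguerre (S n) x) * /
    (zeta * zeta + x)) - RtoC (laguerre (S n) x0) * (RtoC (exp (- x) * laguerre n x) * / (zeta *
        zeta + x))))%C =
   (RtoC ((x0 - x) * laguerre_kernel x0 n x) * / (zeta * zeta + x))%C).
{ replace ((x0 - x) * laguerre_kernel x0 n x) with (exp (- x) * ((x0 - x) *
    sum_f_R0 (fun k => laguerre k x0 * laguerre k x) n)) by (unfold laguerre_kernel; ring).
  rewrite christoffel_darboux; rewrite !RtoC_mult, !RtoC_minus, !RtoC_mult; ring. }
rewrite E, RtoC_mult, RtoC_minus.
field; split; [apply Hne; lra|apply Hne; lra].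
Qed.

(** [K] may blow up as eps tends to 0: for each eps the cut-off [X] is taken large enough to beat
    [K eps]. *)
Lemma limiting_bound (a b D : R) (K : R -> R) :
  (forall eps X, 0 < eps <= 1 -> 0 <= X -> a <= b + D * eps + K eps * exp (- (X / 4))) -> a <= b.
Proof.
intros H; apply le_epsilon; intros eta Heta.
set (eps := Rmin 1 (eta / (2 * (Rabs D + 1)))).
assert (HD := Rabs_pos D).
assert (He : 0 < eps) by (apply Rmin_glb_lt; [lra|apply Rdiv_lt_0_compat; lra]).
assert (He1 : eps <= 1) by apply Rmin_l.
assert (He2 : eps <= eta / (2 * (Rabs D + 1))) by apply Rmin_r.
assert (HKp := Rabs_pos (K eps)).
set (X := 4 * (2 * Rabs (K eps) / eta)).
assert (HX : 0 <= 2 * Rabs (K eps) / eta) by (apply Rmult_le_pos; [lra|left; apply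
    Rinv_0_lt_compat, Heta]).
specialize (H eps X (conj He He1) ltac:(unfold X; lra)).
replace (X / 4) with (2 * Rabs (K eps) / eta) in H by (unfold X; field; lra).
assert (H1 : D * eps <= eta / 2).
{ apply Rle_trans with ((Rabs D + 1) * (eta / (2 * (Rabs D + 1)))); [|right; field; lra].
  apply Rle_trans with (Rabs D * eps); [apply Rmult_le_compat_r; [lra|apply Rle_abs]|].
  apply Rmult_le_compat; lra. }
assert (H2 : K eps * exp (- (2 * Rabs (K eps) / eta)) <= eta / 2).
{ set (t := 2 * Rabs (K eps) / eta) in *.
  assert (E : exp t * exp (- t) = 1) by (rewrite <- exp_plus, Rplus_opp_r; apply exp_0).
  assert (Hp := exp_pos (- t)); assert (Ht := exp_ineq1_le t).
  assert (t * exp (- t) <= 1) by nra.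
  apply Rle_trans with (Rabs (K eps) * exp (- t)); [apply Rmult_le_compat_r; [lra|apply Rle_abs]|].
  replace (Rabs (K eps)) with (t * (eta / 2)) by (unfold t; field; lra); nra. }
lra.
Qed.

Lemma exp_quarter_le (X : R) : 0 <= X -> exp (- X / 2) <= exp (- (X / 4)).
Proof. intros; apply exp_le; lra. Qed.

(** * Laguerre expansion of functions of polynomial growth on the strip *)

Section PolynomialGrowth.

Variables (g : C -> C) (r B : R) (N : nat).
Hypothesis Hr : 0 < r.
Hypothesis Hdiff : forall zeta, 0 <= Re zeta <= r -> Cdiff g (- (zeta * zeta))%C.
Hypothesis Hgrow : forall zeta, 0 <= Re zeta <= r ->
  Cmod (g (- (zeta * zeta))%C) <= B * (1 + Im zeta ^ 2) ^ N.

(** At z = - zeta^2 the new factor has modulus e^(eps (Re zeta)^2 - eps (Im zeta)^2): Gaussian decay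
    along the strip, and never more than e^(r^2) when eps <= 1. *)
Definition damped (eps : R) (z : C) : C := (g z * Cexp (- (eps * z)))%C.

Lemma growth_const_nonneg : 0 <= B.
Proof.
assert (H := Hgrow (RtoC 0) ltac:(simpl; lra)); simpl Im in H.
replace ((1 + 0 ^ 2) ^ N) with 1 in H by (replace (1 + 0 ^ 2) with 1 by ring; rewrite pow1; reflexivity).
generalize (Cmod_ge_0 (g (- (0 * 0))%C)); intros; lra.
Qed.

Lemma damped_diff (eps : R) (zeta : C) : 0 <= Re zeta <= r ->
  Cdiff (damped eps) (- (zeta * zeta))%C.
Proof.
intros Hz; apply Cdiff_mult; [apply Hdiff, Hz|].
apply (Cdiff_comp (fun z => (- (eps * z))%C) Cexp); [|apply Cdiff_exp].
apply Cdiff_opp, Cdiff_mult; [apply Cdiff_const|apply Cdiff_id].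
Qed.

Lemma damped_factor (eps : R) (zeta : C) :
  Cmod (Cexp (- (eps * - (zeta * zeta)))) =
  exp (eps * Re zeta ^ 2) * exp (- (eps * Im zeta ^ 2)).
Proof.
rewrite Cmod_Cexp, <- exp_plus; f_equal; destruct zeta as [p q]; simpl; ring.
Qed.

Lemma damped_bound (eps : R) (zeta : C) : 0 < eps <= 1 -> 0 <= Re zeta <= r ->
  Cmod (damped eps (- (zeta * zeta))%C) <=
  B * exp (r ^ 2) * ((1 + Im zeta ^ 2) ^ N * exp (- (eps * Im zeta ^ 2))).
Proof.
intros He Hz; unfold damped; rewrite Cmod_mult, damped_factor.
assert (HB := growth_const_nonneg).
apply Rle_trans with (B * (1 + Im zeta ^ 2) ^ N * (exp (r ^ 2) * exp (- (eps * Im zeta ^ 2))));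
  [|right; ring].
apply Rmult_le_compat; [apply Cmod_ge_0| |apply Hgrow, Hz|].
- apply Rmult_le_pos; left; apply exp_pos.
- apply Rmult_le_compat_r; [left; apply exp_pos|]; apply exp_le.
  apply Rle_trans with (1 * r ^ 2); [|lra].
  apply Rmult_le_compat; [lra|apply pow2_ge_0|lra|apply pow_incr; lra].
Qed.

(** This constant degenerates with eps. It gives access to Cauchy's formula and afterwards
    multiplies only terms that vanish as X grows. *)
Lemma damped_decay (eps : R) : 0 < eps <= 1 -> exists B', forall zeta, 0 <= Re zeta <= r ->
  Cmod (damped eps (- (zeta * zeta))%C) <= B' / (1 + Im zeta ^ 2) ^ 2.
Proof.
intros He; assert (HB := growth_const_nonneg).
destruct (poly_exp_bound eps (N + 2) (proj1 He)) as [C1 [HC1 HC]].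
exists (B * exp (r ^ 2) * C1); intros zeta Hz.
eapply Rle_trans; [apply damped_bound; assumption|].
assert (Hq := pow2_ge_0 (Im zeta)).
unfold Rdiv; rewrite (Rmult_assoc _ C1).
apply Rmult_le_compat_l; [apply Rmult_le_pos; [exact HB|left; apply exp_pos]|].
apply Rmult_le_reg_r with ((1 + Im zeta ^ 2) ^ 2); [apply pow_lt; lra|].
rewrite (Rmult_assoc C1), Rinv_l, Rmult_1_r by (apply pow_nonzero; lra).
eapply Rle_trans; [|apply (HC (Im zeta ^ 2) Hq)].
rewrite Rmult_assoc, (Rmult_comm (exp _)), <- Rmult_assoc, <- pow_add.
apply Rmult_le_compat_r; [left; apply exp_pos|].
apply pow_incr; lra.
Qed.

(** The estimate uniform in eps; it determines the constants that survive. *)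
Lemma damped_line_bound (eps y : R) : 0 < eps <= 1 ->
  Cmod ((r, y) * damped eps (- ((r, y) * (r, y)))%C) <=
  (r + 1) * (B * exp (r ^ 2)) * (1 + y ^ 2) ^ (N + 1).
Proof.
intros He; assert (HB := growth_const_nonneg); rewrite Cmod_mult.
assert (Hq := pow2_ge_0 y).
rewrite pow_add, pow_1.
apply Rle_trans with ((r + 1) * (1 + y ^ 2) * (B * exp (r ^ 2) * (1 + y ^ 2) ^ N)); [|right; ring].
apply Rmult_le_compat; try apply Cmod_ge_0.
- eapply Rle_trans; [apply Cmod_le_parts|]; simpl Re; simpl Im.
  rewrite Rabs_pos_eq by lra.
  assert (Rabs y <= 1 + y ^ 2).
  { rewrite <- pow2_abs; generalize (pow2_ge_0 (Rabs y - 1)) (Rabs_pos y); simpl; intros; nra. }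
  nra.
- eapply Rle_trans; [apply (damped_bound eps (r, y)); [exact He|simpl; lra]|].
  apply Rmult_le_compat_l; [apply Rmult_le_pos; [exact HB|left; apply exp_pos]|].
  simpl Im; rewrite <- (Rmult_1_r ((1 + y ^ 2) ^ N)) at 2.
  apply Rmult_le_compat_l; [apply pow_le; lra|].
  rewrite <- exp_0; apply exp_le; assert (0 <= eps * y ^ 2) by (apply Rmult_le_pos; lra); lra.
Qed.

Lemma g_axis_bound (x : R) : 0 <= x -> Cmod (g (RtoC x)) <= B * (1 + x) ^ N.
Proof.
intros Hx; assert (H := Hgrow (0, sqrt x) ltac:(simpl; lra)).
rewrite (sqr_sqrt_imag x Hx) in H; simpl Im in H.
rewrite pow2_sqrt in H by exact Hx; exact H.
Qed.

Lemma Ccont_growth_axis (x : R) : 0 <= x -> Ccont (fun x => g (RtoC x)) x.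
Proof.
intros Hx; apply (Ccont_comp _ RtoC g); [apply Ccont_RtoC, continuous_id|].
apply Cdiff_cont; rewrite <- (sqr_sqrt_imag x Hx); apply Hdiff; simpl; lra.
Qed.

Lemma Ccont_damped_axis (eps x : R) : 0 <= x -> Ccont (fun x => damped eps (RtoC x)) x.
Proof.
intros Hx; apply (Ccont_comp _ RtoC (damped eps)); [apply Ccont_RtoC, continuous_id|].
apply Cdiff_cont; rewrite <- (sqr_sqrt_imag x Hx); apply damped_diff; simpl; lra.
Qed.

Lemma damped_axis_error (eps x : R) : 0 < eps -> 0 <= x ->
  Cmod (g (RtoC x) - damped eps (RtoC x)) <= eps * (B * (1 + x) ^ (N + 1)).
Proof.
intros He Hx; unfold damped.
replace (Cexp (- (eps * x))) with (RtoC (exp (- (eps * x)))).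
2:{ unfold Cexp; simpl; replace (- (eps * 0 + 0 * x)) with 0 by ring.
    rewrite cos_0, sin_0; apply injective_projections; simpl; [|ring].
    rewrite Rmult_1_r; f_equal; ring. }
replace (g (RtoC x) - g (RtoC x) * RtoC (exp (- (eps * x))))%C with
  (g (RtoC x) * RtoC (1 - exp (- (eps * x))))%C by (rewrite RtoC_minus; ring).
rewrite Cmod_mult, Cmod_R.
assert (H1 := exp_ineq1_le (- (eps * x))).
assert (H2 : exp (- (eps * x)) <= 1) by (rewrite <- exp_0; apply exp_le; nra).
rewrite Rabs_pos_eq by lra.
rewrite pow_add, pow_1.
apply Rle_trans with (B * (1 + x) ^ N * (eps * (1 + x))); [|right; ring].
apply Rmult_le_compat; [apply Cmod_ge_0|lra|apply g_axis_bound, Hx|nra].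
Qed.

Let moment (k : nat) (X : R) : C := laguerre_moment (fun x => g (RtoC x)) k X.
Let damped_moment (eps : R) (k : nat) (X : R) : C :=
  laguerre_moment (fun x => damped eps (RtoC x)) k X.

(** Of the weight e^(-x), one half is spent on the Laguerre polynomial and a quarter on the growth
    of g; the last quarter is the e^(-x/4) of all truncation errors. *)
Lemma growth_weight_bound : exists W, 0 < W /\ forall k x, 0 <= x ->
  Rabs (exp (- x) * laguerre k x) * (B * (1 + x) ^ (N + 1)) <= W * (INR k + 1) * exp (- (x / 4)).
Proof.
assert (HB := growth_const_nonneg).
destruct (poly_exp_bound (1 / 4) (N + 1) ltac:(lra)) as [C1 [HC1 HC]].
exists ((B + 1) * C1); split; [nra|]; intros k x Hx.
assert (Hk : 0 <= INR k) by apply pos_INR.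
rewrite Rabs_mult, (Rabs_pos_eq (exp _)) by (left; apply exp_pos).
apply Rle_trans with (exp (- x) * ((INR k + 1) * exp (x / 2)) * (B * (x + 2) ^ (N + 1))).
- apply Rmult_le_compat.
  + apply Rmult_le_pos; [left; apply exp_pos|apply Rabs_pos].
  + apply Rmult_le_pos; [exact HB|apply pow_le; lra].
  + apply Rmult_le_compat_l; [left; apply exp_pos|apply laguerre_abs_bound, Hx].
  + apply Rmult_le_compat_l; [exact HB|apply pow_incr; lra].
- assert (E : exp (- x) * exp (x / 2) = exp (- (1 / 4 * x)) * exp (- (x / 4)))
    by (rewrite <- !exp_plus; f_equal; field).
  replace (exp (- x) * ((INR k + 1) * exp (x / 2)) * (B * (x + 2) ^ (N + 1))) with
    ((exp (- x) * exp (x / 2)) * ((INR k + 1) * (B * (x + 2) ^ (N + 1)))) by ring.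
  rewrite E.
  replace (exp (- (1 / 4 * x)) * exp (- (x / 4)) * ((INR k + 1) * (B * (x + 2) ^ (N + 1)))) with
    ((B * ((x + 2) ^ (N + 1) * exp (- (1 / 4 * x)))) * ((INR k + 1) * exp (- (x / 4)))) by ring.
  replace ((B + 1) * C1 * (INR k + 1) * exp (- (x / 4))) with
    (((B + 1) * C1) * ((INR k + 1) * exp (- (x / 4)))) by ring.
  apply Rmult_le_compat_r; [apply Rmult_le_pos; [lra|left; apply exp_pos]|].
  specialize (HC x Hx).
  apply Rle_trans with (B * C1); [apply Rmult_le_compat_l; assumption|nra].
Qed.

Lemma is_RInt_exp_quarter (c a b : R) :
  is_RInt (fun x => c * exp (- (x / 4))) a b (4 * c * (exp (- (a / 4)) - exp (- (b / 4)))).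
Proof.
replace (4 * c * (exp (- (a / 4)) - exp (- (b / 4)))) with
  (minus (- (4 * c) * exp (- (b / 4))) (- (4 * c) * exp (- (a / 4))))
  by (unfold minus, plus, opp; simpl; ring).
apply (is_RInt_derive (V := R_CompleteNormedModule) (fun x => - (4 * c) * exp (- (x / 4)))).
- intros x _; auto_derive; [auto|unfold Rdiv; field].
- intros x _; apply (ex_derive_continuous (V := R_NormedModule)); auto_derive; auto.
Qed.

(** The coefficients are limits of the real parts of the truncated moments of g itself, so they do
    not depend on eps. The damped moments approach them with an error linear in eps, uniformly in
    X. *)
Lemma moment_limits : exists (D : R) (c : nat -> R), 0 < D /\
  (forall k X, 0 <= X -> Rabs (Re (moment k X) - c k) <= D * (INR k + 1) * exp (- (X / 4))) /\
  (forall k X eps, 0 <= X -> 0 < eps ->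
     Cmod (moment k X - damped_moment eps k X) <= eps * (D * (INR k + 1))).
Proof.
assert (HB := growth_const_nonneg).
destruct growth_weight_bound as [W [HW Hweight]].
assert (Hcauchy : forall k X X', 0 <= X -> X <= X' ->
  Cmod (moment k X' - moment k X) <= 4 * W * (INR k + 1) * exp (- (X / 4))).
{ intros k X X' HX HXX.
  assert (Hc : forall x, 0 <= x <= X' -> Ccont (fun x => (RtoC (exp (- x) * laguerre k x) * g (RtoC
      x))%C) x).
  { intros x Hx; apply Ccont_mult; [apply Ccont_RtoC, continuous_weighted_laguerre|].
    apply Ccont_growth_axis; lra. }
  unfold moment, laguerre_moment; rewrite (CInt_Chasles _ 0 X X') by auto.
  match goal with |- Cmod (?p + ?q - ?p) <= _ => replace (p + q - p)%C with q by ring end.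
  apply Rle_trans with (4 * (W * (INR k + 1)) * (exp (- (X / 4)) - exp (- (X' / 4)))).
  - apply (is_CInt_Cmod_le (fun x => (RtoC (exp (- x) * laguerre k x) * g (RtoC x))%C)
      (fun x => W * (INR k + 1) * exp (- (x / 4))) X X'); [exact HXX| | |apply is_RInt_exp_quarter].
    + intros x Hx; rewrite Cmod_mult, Cmod_R.
      eapply Rle_trans; [|apply Hweight; lra].
      apply Rmult_le_compat_l; [apply Rabs_pos|].
      eapply Rle_trans; [apply g_axis_bound; lra|].
      apply Rmult_le_compat_l; [exact HB|apply Rle_pow; [lra|lia]].
    + apply CInt_correct; [exact HXX|]; intros; apply Hc; lra.
  - assert (Hk : 0 <= INR k) by apply pos_INR; assert (Hp := exp_pos (- (X' / 4))).
    assert (0 <= W * (INR k + 1)) by nra; nra. }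
assert (Hlim : forall k, exists l, forall X, 0 <= X ->
  Rabs (Re (moment k X) - l) <= 4 * W * (INR k + 1) * exp (- (X / 4))).
{ intros k; assert (Hk : 0 <= INR k) by apply pos_INR.
  set (K := 4 * W * (INR k + 1)); assert (HK : 0 < K) by (unfold K; nra).
  assert (HRe : forall X X', 0 <= X -> X <= X' -> Rabs (Re (moment k X') - Re (moment k X)) <= K *
      exp (- (X / 4))).
  { intros X X' HX HXX; eapply Rle_trans; [|apply (Hcauchy k X X' HX HXX)].
    apply (re_le_Cmod (moment k X' - moment k X)%C). }
  assert (Hsmall : forall eps, 0 < eps -> exists n : nat, forall X, INR n <= X -> K * exp (- (X /
      4)) < eps).
  { intros eps He.
    destruct (INR_unbounded (4 * (K / eps))) as [n Hn]; exists n; intros X HX.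
    assert (HKe : 0 < K / eps) by (apply Rdiv_lt_0_compat; assumption).
    assert (E : exp (X / 4) * exp (- (X / 4)) = 1) by (rewrite <- exp_plus, Rplus_opp_r; apply exp_0).
    assert (H1 := exp_ineq1_le (X / 4)); assert (Hp := exp_pos (- (X / 4))).
    assert (K / eps * exp (- (X / 4)) < 1) by nra.
    replace K with (K / eps * eps) by (field; lra); nra. }
  destruct (Rcomplete.R_complete (fun n => Re (moment k (INR n)))) as [l Hl].
  { intros eps He; destruct (Hsmall eps He) as [n0 Hn0]; exists n0.
    assert (Hw : forall n m, (n >= n0)%nat -> (n <= m)%nat ->
      Rdist (Re (moment k (INR m))) (Re (moment k (INR n))) < eps).
    { intros n m Hn Hm; unfold Rdist; eapply Rle_lt_trans; [apply HRe; [apply pos_INR|apply le_INR,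
        Hm]|].
      apply Hn0, le_INR; lia. }
    intros n m Hn Hm; destruct (Nat.le_ge_cases n m); [rewrite Rdist_sym|]; apply Hw; assumption. }
  exists l; intros X HX; apply le_epsilon; intros eps He.
  destruct (Hl eps He) as [n1 Hn1].
  destruct (INR_unbounded X) as [n2 Hn2].
  set (n := max n1 n2); specialize (Hn1 n ltac:(unfold n; lia)); unfold Rdist in Hn1.
  assert (Hnx : X <= INR n).
  { apply Rle_trans with (INR n2); [lra|apply le_INR; unfold n; lia]. }
  specialize (HRe X (INR n) HX Hnx).
  replace (Re (moment k X) - l) with ((Re (moment k (INR n)) - l) + - (Re (moment k (INR n)) - Re
      (moment k X))) by ring.
  eapply Rle_trans; [apply Rabs_triang|]; rewrite Rabs_Ropp; lra. }
destruct (choice _ Hlim) as [c Hc].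
exists (4 * W), c; split; [lra|split; [exact Hc|]].
intros k X eps HX He.
assert (Hk : 0 <= INR k) by apply pos_INR.
apply Rle_trans with (4 * (eps * (W * (INR k + 1))) * (exp (- (0 / 4)) - exp (- (X / 4)))).
- apply (is_CInt_Cmod_le (fun x => (RtoC (exp (- x) * laguerre k x) * g (RtoC x) - RtoC (exp (- x)
    * laguerre k x) * damped eps (RtoC x))%C)
      (fun x => eps * (W * (INR k + 1)) * exp (- (x / 4))) 0 X); [exact HX| | |apply
          is_RInt_exp_quarter].
  + intros x Hx.
    match goal with |- Cmod (?p * ?q - ?p * ?s) <= _ =>
      replace (p * q - p * s)%C with (p * (q - s))%C by ring end.
    rewrite Cmod_mult, Cmod_R.
    apply Rle_trans with (Rabs (exp (- x) * laguerre k x) * (eps * (B * (1 + x) ^ (N + 1)))).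
    * apply Rmult_le_compat_l; [apply Rabs_pos|apply damped_axis_error; lra].
    * specialize (Hweight k x (proj1 Hx)); nra.
  + apply is_CInt_minus; apply laguerre_moment_correct; try exact HX; intros x Hx.
    * apply Ccont_growth_axis; lra.
    * apply Ccont_damped_axis; lra.
- replace (0 / 4) with 0 by field; rewrite Ropp_0, exp_0.
  assert (Hp := exp_pos (- (X / 4))).
  assert (0 <= eps * (W * (INR k + 1))) by (apply Rmult_le_pos; nra); nra.
Qed.

(** N + 1 powers of 1 + y^2 pay for the growth of zeta g on the line; one more leaves the 1 / (1 +
    y^2) required by [strip_functional_bound]. *)
Let M : nat := (N + 2)%nat.

(** The order of the quantifiers is the point: [A] and [D] are fixed before eps, and only [K] may
    depend on it. *)
Lemma damped_functional : exists A, 0 < A /\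
  (forall k eps, (2 * M <= k)%nat -> 0 < eps <= 1 -> exists K, forall X, 0 <= X ->
     Cmod (damped_moment eps k X) <= A * coef_rate r k + K * exp (- (X / 4))) /\
  (forall x0, 0 <= x0 -> exists D, 0 <= D /\ forall n eps, (2 * M <= n)%nat -> 0 < eps <= 1 ->
     exists K, forall X, 0 <= X ->
     Cmod (damped eps (RtoC x0) - Csum (fun k => (RtoC (laguerre k x0) * damped_moment eps k X)%C) n) <=
       D * (INR n + 1) * (coef_rate r n + coef_rate r (S n)) + K * exp (- (X / 4))).
Proof.
assert (HB := growth_const_nonneg).
destruct (stieltjes_decay r M Hr ltac:(unfold M; lia)) as [Bs [HBs Hst]].
set (B3 := (r + 1) * (B * exp (r ^ 2))).
assert (HB3 : 0 <= B3).
{ unfold B3; apply Rmult_le_pos; [lra|apply Rmult_le_pos; [exact HB|left; apply exp_pos]]. }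
assert (Hr2 := pow_lt r 2 Hr).
assert (Hline : forall eps y, 0 < eps <= 1 -> forall K, 0 <= K ->
  Cmod ((r, y) * damped eps (- ((r, y) * (r, y)))%C) * (K / (1 + y ^ 2) ^ M) <=
  B3 * K / (1 + y ^ 2)).
{ intros eps y He K HK; assert (Hy := pow2_ge_0 y).
  apply Rle_trans with (B3 * (1 + y ^ 2) ^ (N + 1) * (K / (1 + y ^ 2) ^ M)).
  - apply Rmult_le_compat_r; [|apply damped_line_bound, He].
    apply Rmult_le_pos; [exact HK|left; apply Rinv_0_lt_compat, pow_lt; lra].
  - right; unfold M; replace (N + 2)%nat with (N + 1 + 1)%nat by lia.
    rewrite (pow_add _ (N + 1) 1), pow_1; field; repeat split; try apply pow_nonzero; lra. }
exists (B3 * Bs + 1); split; [nra|split].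
- intros k eps Hk He.
  destruct (damped_decay eps He) as [B' HB'].
  exists ((r + 1) * B' * (4 * (INR k + 1) ^ 2 / r ^ 2)); intros X HX.
  assert (HB'0 : 0 <= B') by (apply (strip_bound_nonneg (damped eps) r B' Hr HB')).
  assert (Hrate := coef_rate_pos r k ltac:(unfold M in Hk; lia)).
  set (E := 4 * (INR k + 1) ^ 2 / r ^ 2).
  assert (HE : 0 <= E).
  { apply Rmult_le_pos; [generalize (pow2_ge_0 (INR k + 1)); lra|left; apply Rinv_0_lt_compat, Hr2]. }
  apply Rle_trans with (B3 * (Bs * coef_rate r k) + (r + 1) * B' * E * exp (- X / 2)).
  + replace (Cmod (damped_moment eps k X)) with
      (* The coefficient as a functional with [lambda = 0]; on the kernels it is minus the truncated
         Q_k. *)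
      (Cmod (0 * damped eps (RtoC 0) - damped_moment eps k X))
      by (rewrite <- Cmod_opp; f_equal; ring).
    apply (strip_functional_bound (damped eps) r B' Hr (damped_diff eps) HB' 0 0 X _
      (fun x => exp (- x) * laguerre k x)); [lra|exact HX|apply continuous_weighted_laguerre|].
    intros y; fold (stieltjes k (r, y) X).
    replace (0 * / ((r, y) * (r, y) + 0) - stieltjes k (r, y) X)%C
      with (- stieltjes k (r, y) X)%C by ring.
    rewrite Cmod_opp.
    eapply Rle_trans; [apply Rmult_le_compat_l; [apply Cmod_ge_0|apply Hst; assumption]|].
    rewrite Rmult_plus_distr_l; fold E.
    match goal with |- _ <= (?p + ?q) / ?s =>
      replace ((p + q) / s) with (p / s + q / s) by (unfold Rdiv; ring) end.
    apply Rplus_le_compat.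
    * apply Hline; [exact He|nra].
    * apply Rle_trans with ((r + 1) * B' / (1 + y ^ 2) * (E * exp (- X / 2))); [|right; unfold
        Rdiv; ring].
      apply Rmult_le_compat_r; [apply Rmult_le_pos; [exact HE|left; apply exp_pos]|].
      apply (g_line_bound (damped eps) r B' Hr HB').
  + assert (0 <= (r + 1) * B' * E) by (apply Rmult_le_pos; [apply Rmult_le_pos; lra|exact HE]).
    assert (Hq := exp_quarter_le X HX).
    rewrite Rmult_plus_distr_r, Rmult_1_l.
    assert ((r + 1) * B' * E * exp (- X / 2) <= (r + 1) * B' * E * exp (- (X / 4)))
      by (apply Rmult_le_compat_l; assumption).
    unfold E in *; lra.
- intros x0 Hx0.
  destruct (laguerre_bounded_in_degree x0 Hx0) as [L [HL HLk]].
  exists (B3 * (Bs * L / r ^ 2)); split.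
  { apply Rmult_le_pos; [exact HB3|].
    apply Rmult_le_pos; [nra|left; apply Rinv_0_lt_compat, Hr2]. }
  intros n eps Hn He.
  destruct (damped_decay eps He) as [B' HB'].
  assert (HB'0 : 0 <= B') by (apply (strip_bound_nonneg (damped eps) r B' Hr HB')).
  assert (Hrate := coef_rate_pos r n ltac:(unfold M in Hn; lia)).
  assert (Hrate' := coef_rate_pos r (S n) ltac:(lia)).
  set (R1 := coef_rate r n + coef_rate r (S n)).
  set (E := sum_f_R0 (fun k => Rabs (laguerre k x0) * (4 * (INR k + 1) ^ 2)) n +
     INR (S n) * L * (4 * (INR (S n) + 1) ^ 2 / r ^ 2 + 4 * (INR n + 1) ^ 2 / r ^ 2)).
  assert (HSn : 0 < INR (S n)) by (apply lt_0_INR; lia).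
  assert (HE : 0 <= E).
  { unfold E; apply Rplus_le_le_0_compat.
    - apply cond_pos_sum; intros k; apply Rmult_le_pos; [apply Rabs_pos|].
      generalize (pow2_ge_0 (INR k + 1)); lra.
    - apply Rmult_le_pos; [nra|]; apply Rplus_le_le_0_compat;
        (apply Rmult_le_pos; [|left; apply Rinv_0_lt_compat, Hr2]).
      + generalize (pow2_ge_0 (INR (S n) + 1)); lra.
      + generalize (pow2_ge_0 (INR n + 1)); lra. }
  exists ((r + 1) * B' * (E / r ^ 2)); intros X HX.
  assert (HE' : 0 <= E / r ^ 2) by (apply Rmult_le_pos; [exact HE|left; apply Rinv_0_lt_compat, Hr2]).
  apply Rle_trans with (B3 * (INR (S n) * (Bs * L / r ^ 2) * R1) + (r + 1) * B' * (E / r ^ 2) * exp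
      (- X / 2)).
  + assert (Hker := is_CInt_laguerre_kernel (fun x => damped eps (RtoC x)) x0 n X HX
      (fun x Hx => Ccont_damped_axis eps x (proj1 Hx))).
    unfold damped_moment; rewrite <- (is_CInt_unique _ _ _ _ Hker).
    (* The remainder as a functional with [lambda = 1] and the Laguerre kernel as [phi]. *)
    replace (damped eps (RtoC x0)) with (1 * damped eps (RtoC x0))%C by ring.
    apply (strip_functional_bound (damped eps) r B' Hr (damped_diff eps) HB' 1 x0 X _
      (laguerre_kernel x0 n)); [exact Hx0|exact HX|apply continuous_laguerre_kernel|].
    intros y.
    rewrite laguerre_kernel_stieltjes by (simpl; assumption).
    set (P := ((r, y) * (r, y) + x0)%C).
    set (m := Csum _ n).
    set (Z := (RtoC (INR (S n)) * _)%C).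
    replace (1 * / P - / P * (m + Z))%C with
      (/ P * - (m - 1 + Z))%C by ring.
    assert (HP : r ^ 2 <= Cmod P) by (apply line_denominator; assumption).
    assert (Hbr : Cmod (/ P * - (m - 1 + Z)) <=
      (INR (S n) * (Bs * L / r ^ 2) * R1) / (1 + y ^ 2) ^ M + E / r ^ 2 * exp (- X / 2)).
    { rewrite Cmod_mult, Cmod_opp, Cmod_inv by (apply Cmod_gt_0; lra).
      apply Rle_trans with (/ r ^ 2 * ((INR (S n) * (Bs * L) * R1) / (1 + y ^ 2) ^ M + E * exp (- X
          / 2)));
        [|right; field; repeat split; try apply pow_nonzero; generalize (pow2_ge_0 y); lra].
      apply Rmult_le_compat.
      - left; apply Rinv_0_lt_compat; lra.
      - apply Cmod_ge_0.
      - apply Rinv_le_contravar; assumption.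
      - eapply Rle_trans; [apply Cmod_triangle|].
        assert (K1 := laguerre_kernel_mass x0 n X HX); fold m in K1.
        assert (K2 := Hst n y X Hn HX); assert (K3 := Hst (S n) y X ltac:(lia) HX).
        assert (K4 : Cmod Z <= INR (S n) * L * (Cmod (stieltjes (S n) (r, y) X) + Cmod (stieltjes n
            (r, y) X))).
        { unfold Z; rewrite Cmod_mult, Cmod_R, Rabs_pos_eq by lra.
          rewrite Rmult_assoc; apply Rmult_le_compat_l; [lra|].
          unfold Cminus; eapply Rle_trans; [apply Cmod_triangle|]; rewrite Cmod_opp, !Cmod_mult, !Cmod_R.
          rewrite Rmult_plus_distr_l; apply Rplus_le_compat;
            (apply Rmult_le_compat_r; [apply Cmod_ge_0|apply HLk]). }
        assert (K5 : Cmod Z <= INR (S n) * L *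
          ((Bs * coef_rate r (S n) / (1 + y ^ 2) ^ M + 4 * (INR (S n) + 1) ^ 2 / r ^ 2 * exp (- X / 2)) +
           (Bs * coef_rate r n / (1 + y ^ 2) ^ M + 4 * (INR n + 1) ^ 2 / r ^ 2 * exp (- X / 2)))).
        { eapply Rle_trans; [exact K4|]; apply Rmult_le_compat_l; [nra|lra]. }
        unfold E, R1, Rdiv in *; lra. }
    eapply Rle_trans; [apply Rmult_le_compat_l; [apply Cmod_ge_0|exact Hbr]|].
    rewrite Rmult_plus_distr_l.
    match goal with |- _ <= (?p + ?q) / ?s =>
      replace ((p + q) / s) with (p / s + q / s) by (unfold Rdiv; ring) end.
    apply Rplus_le_compat.
    * apply Hline; [exact He|]; apply Rmult_le_pos; [apply Rmult_le_pos; [lra|]|unfold R1; lra].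
      apply Rmult_le_pos; [nra|left; apply Rinv_0_lt_compat, Hr2].
    * apply Rle_trans with ((r + 1) * B' / (1 + y ^ 2) * (E / r ^ 2 * exp (- X / 2))); [|right;
        unfold Rdiv; ring].
      apply Rmult_le_compat_r; [apply Rmult_le_pos; [exact HE'|left; apply exp_pos]|].
      apply (g_line_bound (damped eps) r B' Hr HB').
  + rewrite S_INR; fold R1.
    assert (0 <= (r + 1) * B' * (E / r ^ 2)) by (apply Rmult_le_pos; [apply Rmult_le_pos; lra|exact
        HE']).
    assert (Hq := exp_quarter_le X HX).
    apply Rplus_le_compat; [right; ring|].
    apply Rmult_le_compat_l; assumption.
Qed.

Theorem laguerre_expansion : exists (c : nat -> R) (A : R) (k0 : nat), 0 < A /\
  (forall k, (k0 <= k)%nat -> Rabs (c k) <= A * coef_rate r k) /\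
  (forall x, 0 <= x -> exists D, 0 <= D /\ forall n, (k0 <= n)%nat ->
     Rabs (Re (g (RtoC x)) - sum_f_R0 (fun k => c k * laguerre k x) n) <=
     D * (INR n + 1) * (coef_rate r n + coef_rate r (S n))).
Proof.
assert (HB := growth_const_nonneg).
destruct moment_limits as [D [c [HD [Hc Hm]]]].
destruct damped_functional as [A [HA [Hk Hx]]].
assert (Hstep : forall k eps X, 0 < eps -> 0 <= X ->
  Rabs (c k - Re (damped_moment eps k X)) <= D * (INR k + 1) * (eps + exp (- (X / 4)))).
{ intros k eps X He HX.
  replace (c k - Re (damped_moment eps k X)) with
    (- (Re (moment k X) - c k) + (Re (moment k X) - Re (damped_moment eps k X))) by ring.
  eapply Rle_trans; [apply Rabs_triang|]; rewrite Rabs_Ropp.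
  specialize (Hc k X HX); specialize (Hm k X eps HX He).
  assert (H := re_le_Cmod (moment k X - damped_moment eps k X)%C).
  change (Re (moment k X - damped_moment eps k X))
    with (Re (moment k X) - Re (damped_moment eps k X)) in H.
  lra. }
exists c, A, (2 * M)%nat; split; [exact HA|split].
- intros k Hk2.
  (* [limiting_bound] takes [K] as a function of eps. It is chosen on the admissible eps and
     completed elsewhere by a default value that is never reached. *)
  destruct (choice (fun (e : {eps : R | 0 < eps <= 1}) K => forall X, 0 <= X ->
     Cmod (damped_moment (proj1_sig e) k X) <= A * coef_rate r k + K * exp (- (X / 4)))
     (fun e => Hk k (proj1_sig e) Hk2 (proj2_sig e))) as [K HK].
  apply (limiting_bound _ _ (D * (INR k + 1)) (fun eps =>
    D * (INR k + 1) + match excluded_middle_informative (0 < eps <= 1) with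
    | left H => K (exist _ eps H) | right _ => 0 end)).
  intros eps X He HX.
  destruct (excluded_middle_informative (0 < eps <= 1)) as [He'|]; [|tauto].
  specialize (HK (exist _ eps He') X HX); simpl in HK.
  specialize (Hstep k eps X (proj1 He) HX).
  assert (H := re_le_Cmod (damped_moment eps k X)).
  replace (c k) with ((c k - Re (damped_moment eps k X)) + Re (damped_moment eps k X)) by ring.
  eapply Rle_trans; [apply Rabs_triang|]; lra.
- intros x0 Hx0; destruct (Hx x0 Hx0) as [D' [HD' Hn]].
  exists D'; split; [exact HD'|]; intros n Hn2.
  set (bnd := D' * (INR n + 1) * (coef_rate r n + coef_rate r (S n))).
  destruct (choice (fun (e : {eps : R | 0 < eps <= 1}) K => forall X, 0 <= X ->
     Cmod (damped (proj1_sig e) (RtoC x0) - Csum (fun k => (RtoC (laguerre k x0) * damped_moment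
         (proj1_sig e) k X)%C) n) <=
      bnd + K * exp (- (X / 4)))
     (fun e => Hn n (proj1_sig e) Hn2 (proj2_sig e))) as [K HK].
  set (S1 := sum_f_R0 (fun k => D * (INR k + 1) * Rabs (laguerre k x0)) n).
  apply (limiting_bound _ _ (S1 + B * (1 + x0) ^ (N + 1)) (fun eps =>
    S1 + match excluded_middle_informative (0 < eps <= 1) with
    | left H => K (exist _ eps H) | right _ => 0 end)).
  intros eps X He HX.
  destruct (excluded_middle_informative (0 < eps <= 1)) as [He'|]; [|tauto].
  specialize (HK (exist _ eps He') X HX); simpl in HK.
  set (Sd := Csum (fun k => (RtoC (laguerre k x0) * damped_moment eps k X)%C) n) in *.
  assert (H1 := re_le_Cmod (damped eps (RtoC x0) - Sd)%C).
  assert (H2 := damped_axis_error eps x0 (proj1 He) Hx0).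
  assert (H3 := re_le_Cmod (g (RtoC x0) - damped eps (RtoC x0))%C).
  change (Re (damped eps (RtoC x0) - Sd)) with (Re (damped eps (RtoC x0)) - Re Sd) in H1.
  change (Re (g (RtoC x0) - damped eps (RtoC x0))) with (Re (g (RtoC x0)) - Re (damped eps (RtoC
      x0))) in H3.
  assert (H4 : Rabs (Re Sd - sum_f_R0 (fun k => c k * laguerre k x0) n) <= S1 * (eps + exp (- (X / 4)))).
  { unfold Sd; rewrite Re_Csum, <- minus_sum.
    eapply Rle_trans; [apply Rsum_abs|].
    unfold S1; rewrite (Rmult_comm _ (eps + _)), scal_sum; apply sum_Rle; intros k _.
    replace (Re (RtoC (laguerre k x0) * damped_moment eps k X) - c k * laguerre k x0)
      with (- ((c k - Re (damped_moment eps k X)) * laguerre k x0)) by (simpl; unfold Re; ring).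
    rewrite Rabs_Ropp, Rabs_mult.
    specialize (Hstep k eps X (proj1 He) HX).
    apply Rle_trans with (D * (INR k + 1) * (eps + exp (- (X / 4))) * Rabs (laguerre k x0));
        [|right; ring].
    apply Rmult_le_compat_r; [apply Rabs_pos|exact Hstep]. }
  replace (Re (g (RtoC x0)) - sum_f_R0 (fun k => c k * laguerre k x0) n) with
    ((Re (g (RtoC x0)) - Re (damped eps (RtoC x0))) + ((Re (damped eps (RtoC x0)) - Re Sd) +
     (Re Sd - sum_f_R0 (fun k => c k * laguerre k x0) n))) by ring.
  eapply Rle_trans; [apply Rabs_triang|].
  eapply Rle_trans; [apply Rplus_le_compat_l, Rabs_triang|].
  lra.
Qed.

End PolynomialGrowth.

(** * Tails and Laplace transforms of Laguerre series *)

Definition tail_rate (r : R) (x : R) : R := sqrt (sqrt x) * exp (- (2 * r * sqrt x)).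

(** The derivative of [tail_rate] at x is -(r - 1/(4 sqrt x)) x^(-1/4) e^(-2 r sqrt x). Once sqrt x
    >= 1/(2r) its modulus is at least r/2 times the rate of the coefficients, so their sum
    telescopes. *)
Lemma coef_rate_telescope (r : R) (k : nat) : 0 < r -> (1 <= k)%nat ->
  1 / (4 * r ^ 2) <= INR k ->
  coef_rate r (S k) <= 2 / r * (tail_rate r (INR k) - tail_rate r (INR (S k))).
Proof.
intros Hr Hk Hk2.
assert (Hk0 : 1 <= INR k) by (change 1 with (INR 1); apply le_INR, Hk).
destruct (MVT_gen (tail_rate r) (INR k) (INR (S k)) (fun x =>
   exp (- (2 * r * sqrt x)) * (/ sqrt (sqrt x) * (/ (4 * sqrt x) - r)))) as [xi [Hxi E]].
{ rewrite Rmin_left, Rmax_right by (apply le_INR; lia).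
  intros x Hx; unfold tail_rate.
  assert (Hs : 0 < sqrt x) by (apply sqrt_lt_R0; lra).
  assert (Hss : 0 < sqrt (sqrt x)) by (apply sqrt_lt_R0; lra).
  auto_derive; [repeat split; lra|].
  assert (Es : sqrt (sqrt x) * sqrt (sqrt x) = sqrt x) by (apply sqrt_sqrt; lra).
  set (w := sqrt (sqrt x)) in *; rewrite <- Es; field; lra. }
{ rewrite Rmin_left, Rmax_right by (apply le_INR; lia).
  intros x Hx; apply continuity_pt_filterlim, (ex_derive_continuous (V := R_NormedModule)).
  unfold tail_rate; auto_derive; repeat split; try lra; apply sqrt_lt_R0; lra. }
rewrite Rmin_left, Rmax_right in Hxi by (apply le_INR; lia).
rewrite S_INR in *; replace (INR k + 1 - INR k) with 1 in E by ring; rewrite Rmult_1_r in E.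
replace (tail_rate r (INR k) - tail_rate r (INR k + 1)) with
  (- (tail_rate r (INR k + 1) - tail_rate r (INR k))) by ring.
rewrite E; clear E.
assert (Hs : 0 < sqrt xi) by (apply sqrt_lt_R0; lra).
assert (Hss : 0 < sqrt (sqrt xi)) by (apply sqrt_lt_R0; lra).
assert (Hsk : sqrt xi <= sqrt (INR k + 1)) by (apply sqrt_le_1_alt; lra).
assert (Hssk : sqrt (sqrt xi) <= sqrt (sqrt (INR k + 1))) by (apply sqrt_le_1_alt, Hsk).
assert (H2r : 1 / (2 * r) <= sqrt xi).
{ rewrite <- (sqrt_pow2 (1 / (2 * r))) by (apply Rlt_le, Rdiv_lt_0_compat; lra).
  apply sqrt_le_1_alt; apply Rle_trans with (1 / (4 * r ^ 2)); [right; field; lra|lra]. }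
assert (Hq : / (4 * sqrt xi) <= r / 2).
{ replace (r / 2) with (/ (4 * (1 / (2 * r)))) by (field; lra).
  apply Rinv_le_contravar; [|lra]; apply Rmult_lt_0_compat; [lra|apply Rdiv_lt_0_compat; lra]. }
unfold coef_rate; rewrite S_INR.
apply Rle_trans with (/ sqrt (sqrt xi) * exp (- (2 * r * sqrt xi))).
- apply Rmult_le_compat; [left; apply Rinv_0_lt_compat; lra|left; apply exp_pos| |].
  + apply Rinv_le_contravar; lra.
  + apply exp_le; nra.
- set (e := exp (- (2 * r * sqrt xi))); set (i := / sqrt (sqrt xi)).
  assert (He : 0 < e) by apply exp_pos.
  assert (Hi : 0 < i) by (apply Rinv_0_lt_compat; lra).
  replace (2 / r * - (e * (i * (/ (4 * sqrt xi) - r)))) with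
    ((i * e) * (2 / r * (r - / (4 * sqrt xi)))) by ring.
  rewrite <- (Rmult_1_r (i * e)) at 1; apply Rmult_le_compat_l; [nra|].
  apply Rle_trans with (2 / r * (r / 2)); [right; field; lra|].
  apply Rmult_le_compat_l; [left; apply Rdiv_lt_0_compat; lra|lra].
Qed.

Lemma tail_rate_nonneg (r x : R) : 0 <= tail_rate r x.
Proof. apply Rmult_le_pos; [apply sqrt_pos|left; apply exp_pos]. Qed.

Lemma coef_rate_tail (r : R) : 0 < r -> exists n0, (1 <= n0)%nat /\ forall n N, (n0 <= n)%nat ->
  (n <= N)%nat -> sum_f_R0 (coef_rate r) N - sum_f_R0 (coef_rate r) n <= 2 / r * tail_rate r (INR n).
Proof.
intros Hr; destruct (INR_unbounded (1 / (4 * r ^ 2))) as [n1 Hn1].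
exists (S n1); split; [lia|]; intros n N Hn HN.
assert (K : sum_f_R0 (coef_rate r) N - sum_f_R0 (coef_rate r) n <=
  2 / r * (tail_rate r (INR n) - tail_rate r (INR N))).
{ induction HN as [|N HN IH]; [rewrite !Rminus_diag, Rmult_0_r; lra|].
  rewrite tech5.
  assert (H := coef_rate_telescope r N Hr ltac:(lia)).
  assert (INR n1 <= INR N) by (apply le_INR; lia).
  specialize (H ltac:(lra)); lra. }
assert (H2 := tail_rate_nonneg r (INR N)).
assert (0 < 2 / r) by (apply Rdiv_lt_0_compat; lra); nra.
Qed.

Lemma coef_rate_poly (r : R) (m : nat) : 0 < r ->
  exists B, 0 < B /\ forall k, (1 <= k)%nat -> coef_rate r k * (INR k + 1) ^ m <= B.
Proof.
intros Hr; destruct (poly_exp_bound (2 * r) (2 * m) ltac:(lra)) as [B [HB H]].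
exists B; split; [exact HB|]; intros k Hk.
assert (Hk1 : 1 <= INR k) by (change 1 with (INR 1); apply le_INR, Hk).
assert (Hs : 1 <= sqrt (INR k)) by (rewrite <- sqrt_1; apply sqrt_le_1_alt, Hk1).
assert (Hss : 1 <= sqrt (sqrt (INR k))) by (rewrite <- sqrt_1; apply sqrt_le_1_alt, Hs).
assert (Es : sqrt (INR k) * sqrt (INR k) = INR k) by (apply sqrt_sqrt; lra).
eapply Rle_trans; [|apply (H (sqrt (INR k))); lra].
unfold coef_rate; rewrite Rmult_comm.
apply Rmult_le_compat.
- apply pow_le; lra.
- apply Rmult_le_pos; [left; apply Rinv_0_lt_compat; lra|left; apply exp_pos].
- rewrite pow_mult; apply pow_incr; split; [lra|]; simpl; nra.
- rewrite <- (Rmult_1_l (exp _)) at 2; apply Rmult_le_compat_r; [left; apply exp_pos|].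
  rewrite <- Rinv_1; apply Rinv_le_contravar; lra.
Qed.

Lemma laguerre_poly_growth (k : nat) : exists K, 0 < K /\ forall x, 0 <= x ->
  Rabs (laguerre k x) <= K * (1 + x) ^ k /\ Rabs (laguerre_deriv k x) <= K * (1 + x) ^ k.
Proof.
induction k as [|k [K [HK IH]]].
- exists 1; split; [lra|]; intros x Hx; rewrite laguerre_0; simpl.
  rewrite Rabs_R1, Rabs_R0; lra.
- exists (3 * K); split; [lra|]; intros x Hx; destruct (IH x Hx) as [H1 H2].
  assert (Hp : 0 < (1 + x) ^ k) by (apply pow_lt; lra).
  assert (HD : Rabs (laguerre_deriv (S k) x) <= 2 * K * (1 + x) ^ k).
  { simpl; unfold Rminus; eapply Rle_trans; [apply Rabs_triang|]; rewrite Rabs_Ropp; lra. }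
  assert (Hk : 1 <= INR (S k)) by (rewrite S_INR; generalize (pos_INR k); lra).
  assert (HKp : 0 < K * (1 + x) ^ k) by (apply Rmult_lt_0_compat; assumption).
  assert (Hmono : K * (1 + x) ^ k <= K * (1 + x) ^ k * (1 + x)).
  { rewrite <- (Rmult_1_r (K * (1 + x) ^ k)) at 1; apply Rmult_le_compat_l; lra. }
  split.
  + rewrite laguerre_S; eapply Rle_trans; [apply Rabs_triang|].
    unfold Rdiv; rewrite !Rabs_mult, (Rabs_pos_eq x) by exact Hx.
    assert (Rabs (/ INR (S k)) <= 1).
    { rewrite Rabs_pos_eq by (left; apply Rinv_0_lt_compat; lra).
      rewrite <- Rinv_1; apply Rinv_le_contravar; lra. }
    assert (x * Rabs (laguerre_deriv (S k) x) * Rabs (/ INR (S k)) <=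
      x * (2 * K * (1 + x) ^ k) * 1).
    { apply Rmult_le_compat; [apply Rmult_le_pos; [lra|apply Rabs_pos]|apply Rabs_pos| |assumption].
      apply Rmult_le_compat_l; lra. }
    replace (3 * K * (1 + x) ^ S k) with (K * (1 + x) ^ k + 2 * (x * (K * (1 + x) ^ k)) +
      (2 * (K * (1 + x) ^ k) + x * (K * (1 + x) ^ k))) by (simpl; ring).
    assert (0 <= x * (K * (1 + x) ^ k)) by (apply Rmult_le_pos; lra).
    unfold Rdiv in *; lra.
  + eapply Rle_trans; [exact HD|].
    replace (3 * K * (1 + x) ^ S k) with (3 * (K * (1 + x) ^ k * (1 + x))) by (simpl; ring).
    lra.
Qed.

(** On Re P = 1/2 the factor e^(-X/2) is used up entirely by [laguerre_abs_bound], which leaves no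
    decay in X. Polynomial growth at fixed degree restores it, with a constant that depends on k. *)
Lemma laguerre_weighted_vanish (k : nat) : exists K, 0 < K /\ forall X, 0 <= X ->
  exp (- X / 2) * Rabs (laguerre k X) <= K * exp (- (X / 4)).
Proof.
destruct (laguerre_poly_growth k) as [K [HK H]].
destruct (poly_exp_bound (1 / 4) k ltac:(lra)) as [B [HB HP]].
exists (K * B); split; [nra|]; intros X HX.
destruct (H X HX) as [H1 _]; specialize (HP X HX).
replace (exp (- X / 2)) with (exp (- (1 / 4 * X)) * exp (- (X / 4)))
  by (rewrite <- exp_plus; f_equal; field).
assert (He := exp_pos (- (X / 4))); assert (He' := exp_pos (- (1 / 4 * X))).
replace (exp (- (1 / 4 * X)) * exp (- (X / 4)) * Rabs (laguerre k X)) with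
  (exp (- (1 / 4 * X)) * Rabs (laguerre k X) * exp (- (X / 4))) by ring.
apply Rmult_le_compat_r; [lra|].
apply Rle_trans with (exp (- (1 / 4 * X)) * (K * (X + 2) ^ k)).
- apply Rmult_le_compat_l; [lra|]; eapply Rle_trans; [exact H1|].
  apply Rmult_le_compat_l; [lra|apply pow_incr; lra].
- replace (exp (- (1 / 4 * X)) * (K * (X + 2) ^ k)) with
    (K * ((X + 2) ^ k * exp (- (1 / 4 * X)))) by ring.
  apply Rmult_le_compat_l; lra.
Qed.

Lemma inverse_square_tail (a : nat -> R) (B : R) (n N : nat) :
  0 <= B -> (forall k, Rabs (a k) * (INR k + 1) ^ 2 <= B) -> (n <= N)%nat ->
  Rabs (sum_f_R0 a N - sum_f_R0 a n) <= B / (INR n + 1).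
Proof.
intros HB Ha HN.
assert (K : Rabs (sum_f_R0 a N - sum_f_R0 a n) <= B / (INR n + 1) - B / (INR N + 1)).
{ induction HN as [|N HN IH]; [rewrite !Rminus_diag, Rabs_R0; lra|].
  rewrite tech5.
  replace (sum_f_R0 a N + a (S N) - sum_f_R0 a n) with (sum_f_R0 a N - sum_f_R0 a n + a (S N)) by ring.
  eapply Rle_trans; [apply Rabs_triang|].
  specialize (Ha (S N)); rewrite S_INR in *; assert (HN0 := pos_INR N).
  assert (Rabs (a (S N)) <= B / (INR N + 1) - B / (INR N + 1 + 1)); [|lra].
  apply Rle_trans with (B / (INR N + 1 + 1) ^ 2).
  - apply Rmult_le_reg_r with ((INR N + 1 + 1) ^ 2); [apply pow_lt; lra|].
    unfold Rdiv; rewrite Rmult_assoc, Rinv_l by (apply pow_nonzero; lra); lra.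
  - replace (B / (INR N + 1) - B / (INR N + 1 + 1)) with (B / ((INR N + 1) * (INR N + 1 + 1)))
      by (field; lra).
    apply Rmult_le_compat_l; [exact HB|]; apply Rinv_le_contravar; nra. }
assert (0 <= B / (INR N + 1)); [|lra].
apply Rmult_le_pos; [exact HB|left; apply Rinv_0_lt_compat; generalize (pos_INR N); lra].
Qed.

Lemma le_of_inv_INR (a b B : R) : 0 <= B -> (forall n0 : nat, exists n, (n0 <= n)%nat /\ a <= b + B
    / (INR n + 1)) ->
  a <= b.
Proof.
intros HB H; apply le_epsilon; intros eps He.
destruct (INR_unbounded (B / eps)) as [n0 Hn0].
destruct (H n0) as [n [Hn Hab]].
assert (Hn' : INR n0 <= INR n) by (apply le_INR, Hn).
assert (HBe : 0 <= B / eps) by (apply Rmult_le_pos; [exact HB|left; apply Rinv_0_lt_compat, He]).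
assert (B / (INR n + 1) <= eps); [|lra].
apply Rmult_le_reg_r with (INR n + 1); [lra|].
unfold Rdiv; rewrite Rmult_assoc, Rinv_l, Rmult_1_r by lra.
replace B with (eps * (B / eps)) by (field; lra).
apply Rmult_le_compat_l; lra.
Qed.

Lemma Csum_limit (a : nat -> C) (B : R) : 0 <= B ->
  (forall k, Cmod (a k) * (INR k + 1) ^ 2 <= B) ->
  exists V, forall n, Cmod (V - Csum a n) <= 2 * B / (INR n + 1).
Proof.
intros HB Ha.
assert (Hreal : forall b : nat -> R, (forall k, Rabs (b k) <= Cmod (a k)) ->
  exists l, forall n, Rabs (l - sum_f_R0 b n) <= B / (INR n + 1)).
{ intros b Hb.
  assert (Hb2 : forall k, Rabs (b k) * (INR k + 1) ^ 2 <= B).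
  { intros k; eapply Rle_trans; [|apply (Ha k)].
    apply Rmult_le_compat_r; [apply pow2_ge_0|apply Hb]. }
  destruct (Rcomplete.R_complete (sum_f_R0 b)) as [l Hl].
  { intros eps He; destruct (INR_unbounded (B / eps)) as [n0 Hn0]; exists n0.
    assert (Hw : forall n m, (n >= n0)%nat -> (n <= m)%nat -> Rdist (sum_f_R0 b m) (sum_f_R0 b n) < eps).
    { intros n m Hn Hm; unfold Rdist; eapply Rle_lt_trans; [apply (inverse_square_tail b B n m HB
        Hb2 Hm)|].
      assert (INR n0 <= INR n) by (apply le_INR; lia).
      assert (HBe : 0 <= B / eps) by (apply Rmult_le_pos; [exact HB|left; apply Rinv_0_lt_compat, He]).
      apply Rmult_lt_reg_r with (INR n + 1); [lra|].
      unfold Rdiv; rewrite Rmult_assoc, Rinv_l, Rmult_1_r by lra.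
      replace B with (eps * (B / eps)) by (field; lra).
      apply Rmult_lt_compat_l; lra. }
    intros n m Hn Hm; destruct (Nat.le_ge_cases n m); [rewrite Rdist_sym|]; apply Hw; assumption. }
  exists l; intros n; apply le_epsilon; intros eps He.
  destruct (Hl eps He) as [n1 Hn1].
  specialize (Hn1 (max n n1) ltac:(lia)); unfold Rdist in Hn1.
  assert (H := inverse_square_tail b B n (max n n1) HB Hb2 ltac:(lia)).
  replace (l - sum_f_R0 b n) with (- (sum_f_R0 b (max n n1) - l) + (sum_f_R0 b (max n n1) -
      sum_f_R0 b n)) by ring.
  eapply Rle_trans; [apply Rabs_triang|]; rewrite Rabs_Ropp; lra. }
destruct (Hreal (fun k => Re (a k)) (fun k => re_le_Cmod (a k))) as [l1 H1].
destruct (Hreal (fun k => Im (a k)) (fun k => Im_le_Cmod (a k))) as [l2 H2].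
exists (l1, l2); intros n; eapply Rle_trans; [apply Cmod_le_parts|].
assert (EI : Im (Csum a n) = sum_f_R0 (fun k => Im (a k)) n).
{ clear; induction n as [|n IH]; [reflexivity|]; simpl; rewrite <- IH; reflexivity. }
specialize (H1 n); specialize (H2 n); rewrite <- Re_Csum in H1; rewrite <- EI in H2.
change (Re ((l1, l2) - Csum a n)) with (l1 - Re (Csum a n)).
change (Im ((l1, l2) - Csum a n)) with (l2 - Im (Csum a n)).
unfold Rdiv in *; lra.
Qed.

(** * Laplace transform of a Laguerre series on the line Re P = 1/2 *)

Section LaguerreSeries.

Variables (h : R -> R) (c : nat -> R) (B : R).
Hypothesis HB : 0 <= B.
Hypothesis Hcont : forall x, 0 <= x -> Ccont (fun x => RtoC (h x)) x.
Hypothesis Hc : forall k, Rabs (c k) * (INR k + 1) ^ 4 <= B.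
Hypothesis Hsum : forall x n, 0 <= x ->
  Rabs (h x - sum_f_R0 (fun k => c k * laguerre k x) n) <= exp (x / 2) * (B / (INR n + 1)).

Lemma coef_square_decay (k : nat) : Rabs (c k) * (INR k + 1) ^ 2 <= B.
Proof.
eapply Rle_trans; [|apply (Hc k)].
apply Rmult_le_compat_l; [apply Rabs_pos|]; apply Rle_pow; [generalize (pos_INR k); lra|lia].
Qed.

Variable P : C.
Hypothesis HP : Re P = 1 / 2.

Let integral (X : R) : C :=
  CInt (fun x => (Cexp (- (P * x)) * RtoC (h x))%C) 0 X.

Let term (k : nat) : C :=
  (RtoC (c k) * ((P - 1) ^ k / P ^ (S k)))%C.

Lemma half_line_facts : P <> RtoC 0 /\ 1 / 2 <= Cmod P /\ Cmod (P - 1) <= Cmod P.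
Proof.
assert (H : 1 / 2 <= Cmod P).
{ eapply Rle_trans; [|apply re_le_Cmod]; rewrite HP, Rabs_pos_eq; lra. }
split; [apply Cmod_gt_0; lra|split; [exact H|apply Cmod_minus_1_le; lra]].
Qed.

Lemma term_bound (k : nat) : Cmod (term k) <= 2 * Rabs (c k).
Proof.
destruct half_line_facts as [H0 [H1 H2]]; unfold term.
rewrite Cmod_mult, Cmod_R, Cmod_div, !Cmod_pow by (apply Cpow_nz, H0).
rewrite Rmult_comm; apply Rmult_le_compat_r; [apply Rabs_pos|].
assert (Hp : 0 < Cmod P ^ k) by (apply pow_lt; lra).
apply Rle_trans with (Cmod P ^ k / Cmod P ^ S k).
- apply Rmult_le_compat_r; [left; apply Rinv_0_lt_compat, pow_lt; lra|].
  apply pow_incr; split; [apply Cmod_ge_0|exact H2].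
- replace (Cmod P ^ k / Cmod P ^ S k) with (/ Cmod P) by (simpl; field; lra).
  replace 2 with (/ (1 / 2)) by field; apply Rinv_le_contravar; lra.
Qed.

(** The e^(x/2) of [Hsum] cancels |e^(-P x)| exactly. The bound grows with X but tends to 0 in n at
    fixed X, the order in which it is used. *)
Lemma truncated_laplace_error (X : R) (n : nat) : 0 <= X ->
  Cmod (integral X - Csum (fun k => (RtoC (c k) * laguerre_laplace k P X)%C) n) <=
  X * (B / (INR n + 1)).
Proof.
intros HX.
assert (HI : is_CInt (fun x => (Cexp (- (P * x)) * RtoC (h x))%C) 0 X (integral X)).
{ apply CInt_correct; [exact HX|]; intros x Hx; apply Ccont_mult; [|apply Hcont; lra].
  apply Ccont_exp, Ccont_opp, Ccont_mult; [apply Ccont_const|apply Ccont_RtoC, continuous_id]. }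
assert (HS : is_CInt (fun x => (Cexp (- (P * x)) * RtoC (sum_f_R0 (fun k => c k * laguerre k x)
    n)%R)%C) 0 X
   (Csum (fun k => (RtoC (c k) * laguerre_laplace k P X)%C) n)).
{ induction n as [|n IH]; simpl.
  - assert (H := is_CInt_mult_l (RtoC (c 0%nat)) _ _ _ _ (laguerre_laplace_correct 0 P X HX)).
    revert H; apply is_CInt_ext; [exact HX|]; intros x _; rewrite RtoC_mult; ring.
  - assert (H := is_CInt_plus _ _ _ _ _ _ IH (is_CInt_mult_l (RtoC (c (S n))) _ _ _ _
      (laguerre_laplace_correct (S n) P X HX))).
    revert H; apply is_CInt_ext; [exact HX|]; intros x _; rewrite RtoC_plus, RtoC_mult; ring. }
replace (X * (B / (INR n + 1))) with ((X - 0) * (B / (INR n + 1))) by ring.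
apply (is_CInt_Cmod_le_const _ 0 X _ _ HX) with (2 := is_CInt_minus _ _ _ _ _ _ HI HS).
intros x Hx.
match goal with |- Cmod (?p * RtoC ?q - ?p * RtoC ?s) <= _ =>
  replace (p * q - p * s)%C with (p * RtoC (q - s))%C
  by (rewrite RtoC_minus; ring) end.
rewrite Cmod_mult, Cmod_R, Cmod_Cexp, Re_scal_exponent, HP.
apply Rle_trans with (exp (- (1 / 2 * x)) * (exp (x / 2) * (B / (INR n + 1)))).
- apply Rmult_le_compat_l; [left; apply exp_pos|apply Hsum; lra].
- rewrite <- Rmult_assoc, <- exp_plus; replace (- (1 / 2 * x) + x / 2) with 0 by field.
  rewrite exp_0; lra.
Qed.

(** Of the four powers in [Hc], two pay for the sum of Laguerre bounds and two leave a majorant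
    summable in k, uniformly in X. *)
Lemma laplace_error_uniform (k : nat) (X : R) : 0 <= X ->
  Cmod (RtoC (c k) * laguerre_laplace k P X - term k) * (INR k + 1) ^ 2 <= 4 * B.
Proof.
intros HX; unfold term.
match goal with |- Cmod (?p * ?q - ?p * ?s) * _ <= _ =>
  replace (p * q - p * s)%C with (p * (q - s))%C by ring end.
rewrite Cmod_mult, Cmod_R.
assert (H := laguerre_laplace_error k P X HX ltac:(lra)); rewrite HP in H.
assert (H2 := sum_laguerre_bound k X HX).
assert (Hk := pos_INR k).
assert (H3 : Cmod (laguerre_laplace k P X - (P - 1) ^ k / P ^ (S k)) <= 4 * (INR k + 1) ^ 2).
{ eapply Rle_trans; [exact H|].
  apply Rle_trans with (4 * exp (- (1 / 2 * X)) * ((INR k + 1) ^ 2 * exp (X / 2))).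
  - apply Rmult_le_compat_l; [generalize (exp_pos (- (1 / 2 * X))); lra|exact H2].
  - replace (4 * exp (- (1 / 2 * X)) * ((INR k + 1) ^ 2 * exp (X / 2))) with
      (4 * (INR k + 1) ^ 2 * (exp (- (1 / 2 * X)) * exp (X / 2))) by ring.
    rewrite <- exp_plus; replace (- (1 / 2 * X) + X / 2) with 0 by field; rewrite exp_0; lra. }
apply Rle_trans with (Rabs (c k) * (4 * (INR k + 1) ^ 2) * (INR k + 1) ^ 2).
- apply Rmult_le_compat_r; [apply pow2_ge_0|].
  apply Rmult_le_compat_l; [apply Rabs_pos|exact H3].
- replace (Rabs (c k) * (4 * (INR k + 1) ^ 2) * (INR k + 1) ^ 2) with
    (4 * (Rabs (c k) * (INR k + 1) ^ 4)) by ring.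
  specialize (Hc k); lra.
Qed.

Lemma laplace_error_vanish (n : nat) : exists K, 0 <= K /\ forall X, 0 <= X ->
  sum_f_R0 (fun k => Cmod (RtoC (c k) * laguerre_laplace k P X - term k)) n <=
  K * exp (- (X / 4)).
Proof.
assert (Hone : forall k, exists K, 0 <= K /\ forall X, 0 <= X ->
  Cmod (RtoC (c k) * laguerre_laplace k P X - term k) <= K * exp (- (X / 4))).
{ intros k.
  assert (Hs : forall m, exists K, 0 <= K /\ forall X, 0 <= X ->
    exp (- X / 2) * sum_f_R0 (fun j => Rabs (laguerre j X)) m <= K * exp (- (X / 4))).
  { induction m as [|m [K [HK IH]]].
    - destruct (laguerre_weighted_vanish 0) as [K [HK H]]; exists K; split; [lra|exact H].
    - destruct (laguerre_weighted_vanish (S m)) as [K' [HK' H]]; exists (K + K'); split; [lra|].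
      intros X HX; rewrite tech5, Rmult_plus_distr_l; specialize (IH X HX); specialize (H X HX); lra. }
  destruct (Hs k) as [K [HK H]].
  exists (Rabs (c k) * (4 * K)); split; [apply Rmult_le_pos; [apply Rabs_pos|lra]|]; intros X HX.
  unfold term.
  match goal with |- Cmod (?p * ?q - ?p * ?s) <= _ =>
    replace (p * q - p * s)%C with (p * (q - s))%C by ring end.
  rewrite Cmod_mult, Cmod_R, Rmult_assoc; apply Rmult_le_compat_l; [apply Rabs_pos|].
  eapply Rle_trans; [apply (laguerre_laplace_error k P X HX ltac:(lra))|].
  rewrite HP; replace (- (1 / 2 * X)) with (- X / 2) by field.
  specialize (H X HX); lra. }
induction n as [|n [K [HK IH]]]; [exact (Hone 0%nat)|].
destruct (Hone (S n)) as [K' [HK' H]]; exists (K + K'); split; [lra|]; intros X HX.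
rewrite tech5; specialize (IH X HX); specialize (H X HX); lra.
Qed.

(** Tannery's argument: each term converges as X grows ([laplace_error_vanish]) under the summable
    majorant of [laplace_error_uniform]. The existence of the improper integral is obtained along
    with its value. *)
Lemma laplace_series : exists V,
  (forall eps, 0 < eps -> exists X0, 0 <= X0 /\ forall X, X0 <= X -> Cmod (integral X - V) <= eps) /\
  (forall n, Cmod (P * V - Csum (fun k => (RtoC (c k) * ((P - 1) / P) ^ k)%C) n)
     <= Cmod P * (4 * B / (INR n + 1))).
Proof.
destruct half_line_facts as [HP0 [HP1 HP2]].
destruct (Csum_limit term (2 * B) ltac:(lra)) as [V HV].
{ intros k; apply Rle_trans with (2 * Rabs (c k) * (INR k + 1) ^ 2).
  - apply Rmult_le_compat_r; [apply pow2_ge_0|apply term_bound].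
  - generalize (coef_square_decay k); lra. }
exists V; split.
- intros eps He.
  destruct (INR_unbounded (8 * B / eps)) as [n Hn].
  destruct (laplace_error_vanish n) as [K [HK HKn]].
  set (X0 := 4 * (2 * K / eps)).
  assert (HX0 : 0 <= 2 * K / eps) by (apply Rmult_le_pos; [lra|left; apply Rinv_0_lt_compat, He]).
  exists X0; split; [unfold X0; lra|]; intros X HX.
  assert (HX' : 0 <= X) by (unfold X0 in HX; lra).
  assert (Htail : 4 * B / (INR n + 1) <= eps / 2).
  { assert (HBe : 0 <= 8 * B / eps) by (apply Rmult_le_pos; [lra|left; apply Rinv_0_lt_compat, He]).
    apply Rmult_le_reg_r with (INR n + 1); [lra|].
    unfold Rdiv at 1; rewrite Rmult_assoc, Rinv_l, Rmult_1_r by lra.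
    replace (4 * B) with (eps / 2 * (8 * B / eps)) by (field; lra).
    apply Rmult_le_compat_l; lra. }
  assert (Hexp : K * exp (- (X / 4)) <= eps / 2).
  { assert (E : exp (X / 4) * exp (- (X / 4)) = 1) by (rewrite <- exp_plus, Rplus_opp_r; apply exp_0).
    assert (H1 := exp_ineq1_le (X / 4)); assert (Hp := exp_pos (- (X / 4))).
    assert (H2 : 2 * K / eps <= X / 4) by (unfold X0 in HX; lra).
    assert (H3 : 2 * K / eps * exp (- (X / 4)) <= 1) by nra.
    replace K with (2 * K / eps * (eps / 2)) by (field; lra); nra. }
  (* [X] is fixed here while the degree [m] tends to infinity; [n] only separates the head of the
     series from its tail. *)
  apply (le_of_inv_INR _ _ (X * B + 4 * B)); [nra|]; intros n0.
  exists (max n n0); split; [lia|]; set (m := max n n0).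
  assert (H1 := truncated_laplace_error X m HX').
  assert (H2 := HV m).
  set (err := fun k => Cmod (RtoC (c k) * laguerre_laplace k P X - term k)).
  assert (H3 : Cmod (Csum (fun k => (RtoC (c k) * laguerre_laplace k P X)%C) m - Csum term m) <= eps).
  { eapply Rle_trans; [apply (Csum_minus_bound _ _ err); intros; right; reflexivity|].
    assert (T := inverse_square_tail err (4 * B) n m ltac:(lra)
      ltac:(intros k; unfold err; rewrite Rabs_pos_eq by apply Cmod_ge_0; apply
          laplace_error_uniform, HX')
      ltac:(unfold m; lia)).
    apply Rabs_le_between in T; specialize (HKn X HX'); fold err in HKn; lra. }
  replace (integral X - V)%C with
    (integral X - Csum (fun k => (RtoC (c k) * laguerre_laplace k P X)%C) m + (Csum (fun k => (RtoC
        (c k) * laguerre_laplace k P X)%C) m - Csum term m + - (V - Csum term m)))%C by ring.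
  eapply Rle_trans; [apply Cmod_triangle|].
  eapply Rle_trans; [apply Rplus_le_compat_l, Cmod_triangle|]; rewrite Cmod_opp.
  replace ((X * B + 4 * B) / (INR m + 1)) with (X * (B / (INR m + 1)) + 2 * (2 * B) / (INR m + 1))
    by (field; generalize (pos_INR m); lra).
  lra.
- intros n.
  replace (P * V - Csum (fun k => (RtoC (c k) * ((P - 1) / P) ^ k)%C) n)%C
    with (P * (V - Csum term n))%C.
  + rewrite Cmod_mult; apply Rmult_le_compat_l; [apply Cmod_ge_0|].
    specialize (HV n); replace (4 * B) with (2 * (2 * B)) by ring; exact HV.
  + assert (E : (P * Csum term n)%C = Csum (fun k => (RtoC (c k) * ((P - 1) / P) ^ k)%C) n).
    { assert (Ht : forall k, (P * term k)%C = (RtoC (c k) * ((P - 1) / P) ^ k)%C).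
      { intros k; unfold term, Cdiv at 2; rewrite Cpow_mult_l, Cpow_inv by exact HP0; simpl.
        field; split; [apply Cpow_nz, HP0|exact HP0]. }
      clear -Ht; induction n as [|n IH]; simpl; [apply Ht|].
      rewrite <- IH, <- Ht; ring. }
    rewrite <- E; ring.
Qed.

End LaguerreSeries.

(** * Discrete cosine transform and aliasing *)

Lemma weeks_node_full_turn (n j : nat) :
  INR (2 * (n + 1)) * weeks_node n j = 2 * INR j * PI + PI.
Proof.
unfold weeks_node; rewrite mult_INR, plus_INR; simpl.
field; generalize (pos_INR n); lra.
Qed.

Lemma cos_odd_pi_plus (j : nat) (y : R) : cos (y + (2 * INR j * PI + PI)) = - cos y.
Proof.
rewrite <- Rplus_assoc, neg_cos; f_equal; apply cos_period.
Qed.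

(** At the nodes, lowering the frequency by 2 (n + 1) reverses the sign, frequency n + 1 vanishes,
    and a frequency between n + 1 and 2 (n + 1) is minus its mirror image about n + 1. *)
Lemma cos_alias (n m : nat) : exists (k : nat) (s : R), (k <= n)%nat /\ Rabs s <= 1 /\
  forall j, cos (INR m * weeks_node n j) = s * cos (INR k * weeks_node n j).
Proof.
induction m as [m IH] using (well_founded_induction Wf_nat.lt_wf).
destruct (Nat.le_gt_cases m n) as [Hm|Hm].
{ exists m, 1; rewrite Rabs_R1; split; [exact Hm|split; [lra|intros; ring]]. }
destruct (Nat.le_gt_cases (2 * (n + 1)) m) as [H2|H2].
- destruct (IH (m - 2 * (n + 1))%nat ltac:(lia)) as [k [s [Hk [Hs H]]]].
  exists k, (- s); rewrite Rabs_Ropp; split; [exact Hk|split; [exact Hs|]]; intros j.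
  replace (INR m) with (INR (m - 2 * (n + 1)) + INR (2 * (n + 1)))
    by (rewrite <- plus_INR; f_equal; lia).
  rewrite Rmult_plus_distr_r, weeks_node_full_turn, cos_odd_pi_plus, H; ring.
- destruct (Nat.eq_dec m (n + 1)) as [->|Hne].
  + exists 0%nat, 0; rewrite Rabs_R0; split; [lia|split; [lra|]]; intros j.
    rewrite Rmult_0_l; apply cos_eq_0_1; exists (Z.of_nat j).
    rewrite <- INR_IZR_INZ; unfold weeks_node; rewrite plus_INR; simpl.
    field; generalize (pos_INR n); lra.
  + exists (2 * (n + 1) - m)%nat, (-1).
    split; [lia|split; [rewrite Rabs_left; lra|]]; intros j.
    rewrite minus_INR by lia.
    rewrite Rmult_minus_distr_r, weeks_node_full_turn.
    replace (2 * INR j * PI + PI - INR m * weeks_node n j) with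
      (- (INR m * weeks_node n j) + (2 * INR j * PI + PI)) by ring.
    rewrite cos_odd_pi_plus, cos_neg; ring.
Qed.

Lemma sum_cos_nodes (n m : nat) : (0 < m)%nat -> (m < 2 * (n + 1))%nat ->
  sum_f_R0 (fun j => cos (INR m * weeks_node n j)) n = 0.
Proof.
intros Hm Hm2.
set (al := INR m * PI / (INR n + 1)).
assert (Hn := pos_INR n); assert (HPI := PI_RGT_0).
assert (Hm0 : 0 < INR m) by (apply lt_0_INR, Hm).
assert (Hm3 : INR m < 2 * (INR n + 1)).
{ replace (2 * (INR n + 1)) with (INR (2 * (n + 1))) by (rewrite mult_INR, plus_INR; simpl; ring).
  apply lt_INR, Hm2. }
assert (Hs : 0 < sin (al / 2)).
{ assert (E2 : al / 2 = INR m / (2 * (INR n + 1)) * PI) by (unfold al; field; lra).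
  assert (H1 : 0 < INR m / (2 * (INR n + 1))) by (apply Rdiv_lt_0_compat; lra).
  assert (H2 : INR m / (2 * (INR n + 1)) < 1).
  { apply Rmult_lt_reg_r with (2 * (INR n + 1)); [lra|].
    unfold Rdiv; rewrite Rmult_assoc, Rinv_l by lra; lra. }
  apply sin_gt_0; rewrite E2; nra. }
(* The half-step offset of the nodes makes each product a difference of sines at multiples of [al];
   the last one is sin(m PI) = 0. *)
assert (Hstep : forall N, 2 * sin (al / 2) * sum_f_R0 (fun j => cos (INR m * weeks_node n j)) N =
  sin (INR (S N) * al)).
{ assert (Hone : forall j, 2 * sin (al / 2) * cos (INR m * weeks_node n j) =
    sin (INR (S j) * al) - sin (INR j * al)).
  { intros j; replace (INR m * weeks_node n j) with (INR j * al + al / 2)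
      by (unfold weeks_node, al; field; lra).
    replace (INR (S j) * al) with ((INR j * al + al / 2) + al / 2) by (rewrite S_INR; field).
    replace (sin (INR j * al)) with (sin ((INR j * al + al / 2) - al / 2)) by (f_equal; ring).
    rewrite sin_plus, sin_minus; ring. }
  induction N as [|N IH].
  - simpl sum_f_R0; rewrite Hone; change (INR 0) with 0; rewrite Rmult_0_l, sin_0; ring.
  - rewrite tech5, Rmult_plus_distr_l, IH, Hone; ring. }
specialize (Hstep n).
replace (INR (S n) * al) with (INR m * PI) in Hstep by (unfold al; rewrite S_INR; field; lra).
assert (E : sin (INR m * PI) = 0).
{ apply sin_eq_0_1; exists (Z.of_nat m); rewrite <- INR_IZR_INZ; reflexivity. }
rewrite E in Hstep.
apply Rmult_integral in Hstep; destruct Hstep; lra.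
Qed.

Definition dct (n k : nat) (psi : nat -> R) : R :=
  2 * weeks_tau k / (INR n + 1) * sum_f_R0 (fun j => psi j * cos (INR k * weeks_node n j)) n.

(** Discrete orthogonality. For k = m = 0 both halves of the product formula contribute n + 1, which
    the value 1/2 of [weeks_tau 0] compensates. *)
Lemma dct_cos (n k m : nat) : (k <= n)%nat -> (m <= n)%nat ->
  dct n k (fun j => cos (INR m * weeks_node n j)) = if Nat.eqb k m then 1 else 0.
Proof.
intros Hk Hm; unfold dct; assert (Hn := pos_INR n).
assert (Hprod : forall p q, (q <= p)%nat -> sum_f_R0 (fun j => cos (INR p * weeks_node n j) * cos
    (INR q * weeks_node n j)) n =
   / 2 * (sum_f_R0 (fun j => cos (INR (p - q) * weeks_node n j)) n +
          sum_f_R0 (fun j => cos (INR (p + q) * weeks_node n j)) n)).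
{ intros p q Hpq; rewrite <- plus_sum, scal_sum; apply sum_eq; intros j _.
  rewrite minus_INR, plus_INR by exact Hpq.
  rewrite (Rmult_minus_distr_r (INR p)), (Rmult_plus_distr_r (INR p)), cos_minus, cos_plus; field. }
assert (H0 : sum_f_R0 (fun j => cos (INR 0 * weeks_node n j)) n = INR n + 1).
{ rewrite (sum_eq _ (fun _ => 1)); [rewrite sum_cte, S_INR; ring|].
  intros j _; simpl; rewrite Rmult_0_l; apply cos_0. }
destruct (Nat.eqb_spec k m) as [<-|Hne].
- rewrite Hprod, Nat.sub_diag, H0 by lia.
  destruct (Nat.eq_dec k 0) as [->|Hk0].
  + change (INR (0 + 0)) with (INR 0); rewrite H0; unfold weeks_tau; simpl; field; lra.
  + rewrite sum_cos_nodes by lia; unfold weeks_tau.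
    destruct (Nat.eqb_spec k 0); [contradiction|]; field; lra.
- assert (E : sum_f_R0 (fun j => cos (INR m * weeks_node n j) * cos (INR k * weeks_node n j)) n = 0);
    [|rewrite E; ring].
  destruct (Nat.le_ge_cases k m).
  + rewrite Hprod by assumption; rewrite !sum_cos_nodes by lia; ring.
  + rewrite (sum_eq _ (fun j => cos (INR k * weeks_node n j) * cos (INR m * weeks_node n j)))
      by (intros; apply Rmult_comm).
    rewrite Hprod by assumption; rewrite !sum_cos_nodes by lia; ring.
Qed.

Lemma dct_scal (n k : nat) (a : R) (psi psi' : nat -> R) : (forall j, psi' j = a * psi j) ->
  dct n k psi' = a * dct n k psi.
Proof.
intros H; unfold dct.
rewrite (sum_eq _ (fun j => (psi j * cos (INR k * weeks_node n j)) * a)).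
- rewrite <- scal_sum; ring.
- intros j _; rewrite H; ring.
Qed.

Lemma dct_plus (n k : nat) (psi psi' : nat -> R) :
  dct n k (fun j => psi j + psi' j) = dct n k psi + dct n k psi'.
Proof.
unfold dct; rewrite <- Rmult_plus_distr_l, <- plus_sum; f_equal.
apply sum_eq; intros; ring.
Qed.

Lemma sum_kronecker (n m : nat) (f : nat -> R) : (m <= n)%nat ->
  sum_f_R0 (fun k => if Nat.eqb k m then f k else 0) n = f m.
Proof.
intros H; induction n as [|n IH].
- replace m with 0%nat by lia; reflexivity.
- rewrite tech5; destruct (Nat.eq_dec m (S n)) as [->|Hne].
  + rewrite Nat.eqb_refl, (sum_eq _ (fun _ => 0)); [rewrite sum_cte; ring|].
    intros k Hk; destruct (Nat.eqb_spec k (S n)); [lia|reflexivity].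
  + rewrite IH by lia; destruct (Nat.eqb_spec (S n) m); [lia|ring].
Qed.

Lemma dct_cos_l1 (n m : nat) :
  sum_f_R0 (fun k => Rabs (dct n k (fun j => cos (INR m * weeks_node n j)))) n <= 1.
Proof.
destruct (cos_alias n m) as [k0 [s [Hk0 [Hs H]]]].
rewrite (sum_eq _ (fun k => if Nat.eqb k k0 then Rabs s else 0)).
- rewrite (sum_kronecker n k0 (fun _ => Rabs s)) by exact Hk0; exact Hs.
- intros k Hk; rewrite (dct_scal n k s (fun j => cos (INR k0 * weeks_node n j))) by exact H.
  rewrite dct_cos by assumption; rewrite Rabs_mult.
  destruct (Nat.eqb k k0); [rewrite Rabs_R1|rewrite Rabs_R0]; ring.
Qed.

(** Frequencies up to n are reproduced exactly. Each higher one is aliased onto at most one of them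
    with weight at most 1, so in the l1 norm it costs no more than its own coefficient. *)
Lemma dct_partial_sum_error (n N : nat) (c : nat -> R) : (n <= N)%nat ->
  sum_f_R0 (fun k => Rabs (dct n k (fun j => sum_f_R0 (fun m => c m * cos (INR m * weeks_node n j))
      N) - c k)) n
  <= sum_f_R0 (fun m => Rabs (c m)) N - sum_f_R0 (fun m => Rabs (c m)) n.
Proof.
assert (Hlin : forall k N, dct n k (fun j => sum_f_R0 (fun m => c m * cos (INR m * weeks_node n j)) N) =
  sum_f_R0 (fun m => c m * dct n k (fun j => cos (INR m * weeks_node n j))) N).
{ intros k N'; induction N' as [|N' IH]; cbn [sum_f_R0].
  - exact (dct_scal n k (c 0%nat) _ _ (fun j => eq_refl)).
  - rewrite dct_plus, IH; f_equal; exact (dct_scal n k (c (S N')) _ _ (fun j => eq_refl)). }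
intros HN; induction HN as [|N HN IH].
- rewrite Rminus_diag, (sum_eq _ (fun _ => 0)); [rewrite sum_cte; lra|].
  intros k Hk; rewrite Hlin.
  rewrite (sum_eq _ (fun m => if Nat.eqb m k then c m else 0)).
  + rewrite sum_kronecker by exact Hk; rewrite Rminus_diag; apply Rabs_R0.
  + intros m Hm; rewrite dct_cos, Nat.eqb_sym by assumption; destruct (Nat.eqb m k); ring.
- rewrite tech5.
  apply Rle_trans with (sum_f_R0 (fun k => Rabs (dct n k (fun j => sum_f_R0 (fun m => c m * cos
      (INR m * weeks_node n j)) N) - c k)
     + Rabs (dct n k (fun j => cos (INR (S N) * weeks_node n j))) * Rabs (c (S N))) n).
  + apply sum_Rle; intros k Hk; rewrite !Hlin, tech5.
    match goal with |- Rabs (?p + ?q * ?s - ?t) <= _ =>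
      replace (p + q * s - t) with ((p - t) + s * q) by ring end.
    eapply Rle_trans; [apply Rabs_triang|]; rewrite Rabs_mult; lra.
  + rewrite sum_plus, <- scal_sum.
    assert (H := dct_cos_l1 n (S N)); assert (H2 := Rabs_pos (c (S N))); nra.
Qed.

Lemma dct_bound (n k : nat) (psi psi' : nat -> R) (e : R) :
  (forall j, (j <= n)%nat -> Rabs (psi j - psi' j) <= e) ->
  Rabs (dct n k psi - dct n k psi') <= 2 * e.
Proof.
intros H; unfold dct; assert (Hn := pos_INR n).
rewrite <- Rmult_minus_distr_l, <- minus_sum, Rabs_mult.
assert (Htau : 0 <= weeks_tau k <= 1) by (unfold weeks_tau; destruct (Nat.eqb k 0); lra).
assert (He : 0 <= e) by (eapply Rle_trans; [apply Rabs_pos|apply (H 0%nat); lia]).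
assert (Hf : 0 <= 2 * weeks_tau k / (INR n + 1)).
{ apply Rmult_le_pos; [lra|left; apply Rinv_0_lt_compat; lra]. }
rewrite (Rabs_pos_eq _ Hf).
apply Rle_trans with (2 * weeks_tau k / (INR n + 1) * ((INR n + 1) * e)).
- apply Rmult_le_compat_l; [exact Hf|].
  eapply Rle_trans; [apply Rsum_abs|].
  replace ((INR n + 1) * e) with (sum_f_R0 (fun _ => e) n) by (rewrite sum_cte, S_INR; ring).
  apply sum_Rle; intros j Hj.
  rewrite <- Rmult_minus_distr_r, Rabs_mult.
  rewrite <- (Rmult_1_r e); apply Rmult_le_compat; try apply Rabs_pos; [apply H, Hj|].
  apply Rabs_le, COS_bound.
- replace (2 * weeks_tau k / (INR n + 1) * ((INR n + 1) * e)) with (2 * (weeks_tau k * e)) by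
    (field; lra).
  nra.
Qed.

(** * Rescaling to the strip *)

Lemma rectangle_bounded (G : C -> C) (a b c d : R) : a <= b -> c <= d ->
  (forall x y, a <= x <= b -> c <= y <= d -> Ccont (U := C_UniformSpace) G (x, y)) ->
  exists B, 0 <= B /\ forall x y, a <= x <= b -> c <= y <= d -> Cmod (G (x, y)) <= B.
Proof.
intros Hab Hcd HG.
apply (rectangle_bisection (fun a b c d => exists B, 0 <= B /\
  forall x y, a <= x <= b -> c <= y <= d -> Cmod (G (x, y)) <= B) a b c d Hab Hcd).
- intros a' b' c' d' _ _ _ _ _ _ [B1 [P1 Q1]] [B2 [P2 Q2]] [B3 [P3 Q3]] [B4 [P4 Q4]].
  exists (B1 + B2 + B3 + B4); split; [lra|]; intros x y Hx Hy.
  destruct (Rle_dec x ((a' + b') / 2)); destruct (Rle_dec y ((c' + d') / 2)).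
  + specialize (Q1 x y ltac:(lra) ltac:(lra)); lra.
  + specialize (Q3 x y ltac:(lra) ltac:(lra)); lra.
  + specialize (Q2 x y ltac:(lra) ltac:(lra)); lra.
  + specialize (Q4 x y ltac:(lra) ltac:(lra)); lra.
- intros x y Hx Hy.
  destruct (Ccont_eps _ _ (HG x y Hx Hy) 1 Rlt_0_1) as [delta [Hd H]].
  exists delta; split; [exact Hd|]; intros a' b' c' d' Ha Hb Hc Hd' H1 H2.
  exists (Cmod (G (x, y)) + 1); split; [generalize (Cmod_ge_0 (G (x, y))); lra|].
  intros u v Hu Hv.
  replace (G (u, v)) with (G (x, y) + (G (u, v) - G (x, y)))%C by ring.
  eapply Rle_trans; [apply Cmod_triangle|]; apply Rplus_le_compat_l; left.
  apply H; simpl; apply Rabs_lt_between; lra.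
Qed.

Lemma Re_Csqrt_sqr (xi : C) : 0 <= Re xi -> Re (Csqrt (- (- (xi * xi)))) = Re xi.
Proof.
intros H; replace (- (- (xi * xi)))%C with (xi * xi)%C by ring.
unfold Csqrt; cbn [Re fst].
rewrite Cmod_mult; replace (Cmod xi * Cmod xi) with (Cmod xi ^ 2) by ring.
rewrite Cmod2_alt; rewrite <- (sqrt_pow2 (Re xi)) at 2 by exact H; f_equal.
destruct xi as [p q]; simpl; field.
Qed.

Lemma Rpower_le_pow (beta x : R) (N : nat) : 1 <= x -> beta <= INR N -> Rpower x beta <= x ^ N.
Proof.
intros Hx Hb; rewrite <- Rpower_pow by lra; apply Rle_Rpower; lra.
Qed.

Lemma finite_upper_bound (a : nat -> R) (n : nat) : exists B, 0 <= B /\ forall k, (k <= n)%nat -> a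
    k <= B.
Proof.
induction n as [|n [B [HB IH]]].
- exists (Rabs (a 0%nat)); split; [apply Rabs_pos|].
  intros k Hk; replace k with 0%nat by lia; apply Rle_abs.
- exists (B + Rabs (a (S n))); split; [generalize (Rabs_pos (a (S n))); lra|].
  intros k Hk; destruct (Nat.eq_dec k (S n)) as [->|].
  + generalize (Rle_abs (a (S n))); lra.
  + specialize (IH k ltac:(lia)); generalize (Rabs_pos (a (S n))); lra.
Qed.

Section GrowthTransfer.

Variables (f : C -> C) (nu sigma rho beta K : R).
Hypothesis hnu : 0 < nu.
Hypothesis hrho : 0 < rho.
Hypothesis hK : 0 < K.
Hypothesis hanalytic :
  analytic_in_nbhd_of (fun z => in_parabola rho z \/ on_parabola rho z) f.
Hypothesis hgrowth : exists M : R, 0 < M /\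
  forall z : C, in_parabola rho z -> M < Cmod z ->
    Cmod (f z) <= K * Rpower (Cmod z) beta * exp ((sigma - nu / 2) * Re z).

Let kappa : R := (sigma - nu / 2) / nu.

Definition rescaled (z : C) : C :=
  (f (RtoC (/ nu) * z)%C * Cexp (- (kappa * z)))%C.

Lemma f_parabola_diff (xi : C) : 0 <= Re xi <= rho -> Cdiff f (- (xi * xi))%C.
Proof.
intros Hxi; destruct hanalytic as [U [_ [HU Hd]]].
apply ex_derive_Cdiff, Hd, HU; unfold in_parabola, on_parabola.
rewrite Re_Csqrt_sqr by lra; lra.
Qed.

Lemma rescaled_arg (zeta : C) :
  (RtoC (/ nu) * - (zeta * zeta))%C =
  (- (RtoC (/ sqrt nu) * zeta * (RtoC (/ sqrt nu) * zeta)))%C.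
Proof.
assert (Hs : 0 < sqrt nu) by (apply sqrt_lt_R0, hnu).
replace (/ nu) with (/ sqrt nu * / sqrt nu).
- rewrite RtoC_mult; ring.
- rewrite <- Rinv_mult, sqrt_sqrt by lra; reflexivity.
Qed.

Lemma rescaled_strip (zeta : C) : 0 <= Re zeta <= rho * sqrt nu ->
  0 <= Re (RtoC (/ sqrt nu) * zeta) <= rho.
Proof.
assert (Hs : 0 < sqrt nu) by (apply sqrt_lt_R0, hnu).
assert (Hi : 0 < / sqrt nu) by (apply Rinv_0_lt_compat, Hs).
intros H; simpl; unfold Re in H; split; [nra|].
replace rho with (/ sqrt nu * (rho * sqrt nu)) by (field; lra); nra.
Qed.

Lemma rescaled_diff (zeta : C) : 0 <= Re zeta <= rho * sqrt nu ->
  Cdiff rescaled (- (zeta * zeta))%C.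
Proof.
intros Hz; apply Cdiff_mult.
- apply (Cdiff_comp (fun z => (RtoC (/ nu) * z)%C) f).
  + apply Cdiff_mult; [apply Cdiff_const|apply Cdiff_id].
  + rewrite rescaled_arg; apply f_parabola_diff, rescaled_strip, Hz.
- apply (Cdiff_comp (fun z => (- (kappa * z))%C) Cexp); [|apply Cdiff_exp].
  apply Cdiff_opp, Cdiff_mult; [apply Cdiff_const|apply Cdiff_id].
Qed.

(** Far along the strip the growth hypothesis applies and its exponential cancels the one in
    [rescaled]; the remaining rectangle is compact. *)
Lemma rescaled_growth : exists (B : R) (N : nat), forall zeta, 0 <= Re zeta <= rho * sqrt nu ->
  Cmod (rescaled (- (zeta * zeta))%C) <= B * (1 + Im zeta ^ 2) ^ N.
Proof.
destruct hgrowth as [M [HM HfM]].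
destruct (INR_unbounded beta) as [N HN].
assert (Hs : 0 < sqrt nu) by (apply sqrt_lt_R0, hnu).
assert (Es : sqrt nu * sqrt nu = nu) by (apply sqrt_sqrt; lra).
assert (Hr : 0 < rho * sqrt nu) by nra.
set (G := fun zeta : C => rescaled (- (zeta * zeta))%C).
assert (HGc : forall zeta, 0 <= Re zeta <= rho * sqrt nu -> Ccont (U := C_UniformSpace) G zeta).
{ intros zeta Hz; apply (Ccont_comp _ (fun z => (- (z * z))%C) rescaled).
  - apply Ccont_opp, Ccont_mult; apply Ccont_id.
  - apply Cdiff_cont, rescaled_diff, Hz. }
set (C1 := rho ^ 2 + / nu).
assert (Hinu : 0 < / nu) by (apply Rinv_0_lt_compat, hnu).
assert (Hrho2 : 0 < rho ^ 2) by (apply pow_lt, hrho).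
(* Beyond [Y0] the point z satisfies |z| >= M + 1: past the threshold [M], and at least 1, so that
   |z|^beta is at most an integer power. *)
set (Y0 := (nu + 1) * (M + 1) + 1).
assert (Hfar : forall zeta, 0 <= Re zeta < rho * sqrt nu -> Y0 < Rabs (Im zeta) ->
  Cmod (G zeta) <= K * C1 ^ N * (1 + Im zeta ^ 2) ^ N).
{ intros zeta Hz Him.
  set (xi := (RtoC (/ sqrt nu) * zeta)%C).
  assert (Hxi : 0 <= Re xi < rho).
  { destruct (rescaled_strip zeta ltac:(lra)) as [H1 H2]; fold xi in H1, H2; split; [exact H1|].
    unfold xi; simpl; unfold Re in Hz.
    replace rho with (/ sqrt nu * (rho * sqrt nu)) by (field; lra).
    assert (0 < / sqrt nu) by (apply Rinv_0_lt_compat, Hs); nra. }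
  assert (Hmod : Cmod (RtoC (/ nu) * - (zeta * zeta)) = / nu * (Re zeta ^ 2 + Im zeta ^ 2)).
  { rewrite Cmod_mult, Cmod_R, Rabs_pos_eq, Cmod_opp, Cmod_mult, <- Cmod2_alt by lra; ring. }
  assert (HIm2 : (nu + 1) * (M + 1) <= Im zeta ^ 2).
  { rewrite <- pow2_abs; apply Rle_trans with (1 * Rabs (Im zeta)); [unfold Y0 in Him; lra|].
    assert (1 <= Rabs (Im zeta)) by (unfold Y0 in Him; nra); simpl; nra. }
  assert (Hbig : M + 1 <= / nu * (Re zeta ^ 2 + Im zeta ^ 2)).
  { apply Rmult_le_reg_l with nu; [exact hnu|].
    rewrite <- Rmult_assoc, Rinv_r, Rmult_1_l by lra.
    generalize (pow2_ge_0 (Re zeta)); nra. }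
  unfold G, rescaled; rewrite Cmod_mult, Cmod_Cexp.
  set (z := (RtoC (/ nu) * - (zeta * zeta))%C) in *.
  assert (Hin : in_parabola rho z).
  { unfold in_parabola, z; rewrite rescaled_arg; fold xi; rewrite Re_Csqrt_sqr by lra; lra. }
  specialize (HfM z Hin ltac:(rewrite Hmod; lra)).
  assert (Ere : Re (- (kappa * - (zeta * zeta))) = - ((sigma - nu / 2) * Re z)).
  { unfold z, kappa; destruct zeta as [p q]; simpl; field; lra. }
  rewrite Ere.
  apply Rle_trans with (K * Rpower (Cmod z) beta * exp ((sigma - nu / 2) * Re z) * exp (- ((sigma -
      nu / 2) * Re z))).
  { apply Rmult_le_compat_r; [left; apply exp_pos|exact HfM]. }
  rewrite Rmult_assoc, <- exp_plus, Rplus_opp_r, exp_0, Rmult_1_r, Rmult_assoc.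
  apply Rmult_le_compat_l; [lra|].
  eapply Rle_trans; [apply Rpower_le_pow with (N := N); [rewrite Hmod; lra|lra]|].
  rewrite <- Rpow_mult_distr; apply pow_incr; split; [apply Cmod_ge_0|].
  rewrite Hmod; unfold C1.
  assert (HIm0 := pow2_ge_0 (Im zeta)).
  assert (/ nu * Re zeta ^ 2 <= rho ^ 2).
  { apply Rmult_le_reg_l with nu; [exact hnu|].
    rewrite <- Rmult_assoc, Rinv_r, Rmult_1_l by lra.
    replace (nu * rho ^ 2) with ((rho * sqrt nu) ^ 2) by (rewrite <- Es at 2; ring).
    apply pow_incr; lra. }
  nra. }
assert (HC1 : 0 < K * C1 ^ N) by (apply Rmult_lt_0_compat; [exact hK|apply pow_lt; unfold C1; lra]).
(* The growth hypothesis concerns the open interior of the parabola; continuity extends the bound to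
   the line Re zeta = rho sqrt nu, where Cauchy's formula is used. *)
assert (Hfar' : forall zeta, 0 <= Re zeta <= rho * sqrt nu -> Y0 < Rabs (Im zeta) ->
  Cmod (G zeta) <= K * C1 ^ N * (1 + Im zeta ^ 2) ^ N).
{ intros [p q] Hz Him; simpl in Hz, Him; simpl Im.
  destruct (Rlt_dec p (rho * sqrt nu)) as [Hp|Hp]; [apply (Hfar (p, q)); simpl; lra|].
  apply le_epsilon; intros eps He.
  destruct (Ccont_eps G (p, q) (HGc (p, q) ltac:(simpl; lra)) eps He) as [delta [Hd H]].
  set (t := Rmin (delta / 2) (rho * sqrt nu)).
  assert (Ht : 0 < t) by (apply Rmin_glb_lt; lra).
  assert (Ht1 : t <= delta / 2) by apply Rmin_l; assert (Ht2 : t <= rho * sqrt nu) by apply Rmin_r.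
  specialize (H (p - t, q)); simpl in H.
  assert (Hn : Cmod (G (p - t, q)%R - G (p, q)) < eps).
  { apply H; apply Rabs_lt_between; lra. }
  assert (Hf := Hfar (p - t, q) ltac:(simpl; lra) ltac:(simpl; lra)); simpl Im in Hf.
  replace (G (p, q)) with (G (p - t, q)%R + - (G (p - t, q)%R - G (p, q)))%C by ring.
  eapply Rle_trans; [apply Cmod_triangle|]; rewrite Cmod_opp; lra. }
assert (HY0 : 0 < Y0) by (unfold Y0; nra).
destruct (rectangle_bounded G 0 (rho * sqrt nu) (- Y0) Y0 ltac:(lra) ltac:(lra)) as [B [HB HBd]].
{ intros x y Hx Hy; apply HGc; simpl; lra. }
exists (B + K * C1 ^ N), N; intros zeta Hz; fold (G zeta).
assert (H1 : 1 <= (1 + Im zeta ^ 2) ^ N) by (apply pow_R1_Rle; generalize (pow2_ge_0 (Im zeta)); lra).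
destruct (Rlt_dec Y0 (Rabs (Im zeta))) as [Hy|Hy].
- specialize (Hfar' zeta Hz Hy); nra.
- assert (Hle : Rabs (Im zeta) <= Y0) by lra; apply Rabs_le_between in Hle.
  specialize (HBd (Re zeta) (Im zeta) Hz Hle); rewrite <- surjective_pairing in HBd; nra.
Qed.

End GrowthTransfer.

(** * Error of the Weeks method *)

Lemma sum_abs_tail (a b : nat -> R) (A : R) (n0 n N : nat) :
  (forall k, (n0 <= k)%nat -> Rabs (a k) <= A * b k) -> (n0 <= n)%nat -> (n <= N)%nat ->
  sum_f_R0 (fun k => Rabs (a k)) N - sum_f_R0 (fun k => Rabs (a k)) n <=
  A * (sum_f_R0 b N - sum_f_R0 b n).
Proof.
intros H Hn HN; induction HN as [|N HN IH]; [rewrite !Rminus_diag; lra|].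
rewrite !tech5; specialize (H (S N) ltac:(lia)); lra.
Qed.

Lemma sum_tail_le (a : nat -> R) (n N : nat) : (n <= N)%nat ->
  Rabs (sum_f_R0 a N - sum_f_R0 a n) <=
  sum_f_R0 (fun k => Rabs (a k)) N - sum_f_R0 (fun k => Rabs (a k)) n.
Proof.
intros HN; induction HN as [|N HN IH]; [rewrite !Rminus_diag, Rabs_R0; lra|].
rewrite !tech5.
replace (sum_f_R0 a N + a (S N) - sum_f_R0 a n) with (sum_f_R0 a N - sum_f_R0 a n + a (S N)) by ring.
eapply Rle_trans; [apply Rabs_triang|]; lra.
Qed.

Lemma unit_circle_pow (th : R) (k : nat) :
  ((cos th, sin th) ^ k)%C = (cos (INR k * th), sin (INR k * th)).
Proof.
induction k as [|k IH].
- simpl; rewrite Rmult_0_l, cos_0, sin_0; reflexivity.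
- rewrite S_INR, Rmult_plus_distr_r, Rmult_1_l, cos_plus, sin_plus; simpl; rewrite IH.
  apply injective_projections; simpl; ring.
Qed.

(** P = 1/2 + (i/2) cot(th/2) is i e^(-i th/2) / (2 sin(th/2)) and P - 1 is i e^(i th/2) / (2
    sin(th/2)). The k-th term of the Laplace series thus has real part c_k cos(k th). *)
Lemma cayley_cot (th : R) : sin (th / 2) <> 0 ->
  (((1 / 2, cot (th / 2) / 2)%R - 1) / (1 / 2, cot (th / 2) / 2)%R)%C = (cos th, sin th).
Proof.
intros Hs.
assert (E1 : cos th = cos (th / 2) ^ 2 - sin (th / 2) ^ 2).
{ replace th with (2 * (th / 2)) at 1 by field; rewrite cos_2a; ring. }
assert (E2 : sin th = 2 * sin (th / 2) * cos (th / 2)).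
{ replace th with (2 * (th / 2)) at 1 by field; apply sin_2a. }
rewrite E1, E2; unfold cot; assert (E := sin2_cos2 (th / 2)); unfold Rsqr in E.
set (s := sin (th / 2)) in *; set (c := cos (th / 2)) in *.
assert (H0 : ((1 / 2, c / s / 2) : C) <> RtoC 0).
{ intros H; injection H; intros; lra. }
assert (E3 : ((1 / 2, c / s / 2)%R - 1)%C =
  ((c ^ 2 - s ^ 2, 2 * s * c)%R * (1 / 2, c / s / 2)%R)%C).
{ apply injective_projections; simpl; apply Rmult_eq_reg_r with (2 * s); try lra.
  - transitivity (- s); [field; exact Hs|].
    transitivity (- s * (s * s + c * c)); [rewrite E; ring|field; exact Hs].
  - transitivity c; [field; exact Hs|].
    transitivity (c * (s * s + c * c)); [rewrite E; ring|field; exact Hs]. }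
rewrite E3; field; exact H0.
Qed.

Lemma is_RInt_gen_of_limit (F : R -> C) (V : C) :
  (forall eps, 0 < eps -> exists T0, forall T, T0 < T ->
     exists l, is_CInt F 0 T l /\ Cmod (l - V) < eps) ->
  is_RInt_gen (V := C_R_NormedModule) F (at_point 0) (Rbar_locally p_infty) V.
Proof.
intros H P [eps HP].
destruct (H eps (cond_pos eps)) as [T0 HT].
apply (Filter_prod _ _ _ (fun a => a = 0) (fun b => T0 < b)); [reflexivity|exists T0; auto|].
intros a b -> Hb; destruct (HT b Hb) as [l [Hl Hm]].
exists l; split; [exact Hl|]; apply HP; split.
- change (Rabs (Re l - Re V) < eps).
  eapply Rle_lt_trans; [|exact Hm]; apply (re_le_Cmod (l - V)%C).
- change (Rabs (Im l - Im V) < eps).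
  eapply Rle_lt_trans; [|exact Hm]; apply (Im_le_Cmod (l - V)%C).
Qed.

Lemma weeks_node_sin (n j : nat) : (j <= n)%nat -> 0 < sin (weeks_node n j / 2).
Proof.
intros Hj; assert (Hn := pos_INR n); assert (Hj0 := pos_INR j); assert (HPI := PI_RGT_0).
assert (Hjn : INR j <= INR n) by (apply le_INR, Hj).
assert (E : weeks_node n j / 2 = (INR j + 1 / 2) / (2 * (INR n + 1)) * PI)
  by (unfold weeks_node; field; lra).
assert (H1 : 0 < (INR j + 1 / 2) / (2 * (INR n + 1))) by (apply Rdiv_lt_0_compat; lra).
assert (H2 : (INR j + 1 / 2) / (2 * (INR n + 1)) < 1).
{ apply Rmult_lt_reg_r with (2 * (INR n + 1)); [lra|].
  unfold Rdiv; rewrite Rmult_assoc, Rinv_l by lra; lra. }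
apply sin_gt_0; rewrite E; nra.
Qed.

Section WeeksCoefficients.

Variables (f : C -> C) (nu sigma : R) (h : R -> R) (c : nat -> R) (B : R).
Hypothesis hnu : 0 < nu.
Hypothesis HB : 0 <= B.
Hypothesis Hcont : forall x, 0 <= x -> Ccont (fun x => RtoC (h x)) x.
Hypothesis Hc : forall k, Rabs (c k) * (INR k + 1) ^ 4 <= B.
Hypothesis Hsum : forall x n, 0 <= x ->
  Rabs (h x - sum_f_R0 (fun k => c k * laguerre k x) n) <= exp (x / 2) * (B / (INR n + 1)).
Hypothesis Hf : forall t, 0 <= t ->
  f (RtoC t) = RtoC (exp ((sigma - nu / 2) * t) * h (nu * t)).

(** [laplace] is informative only where its improper integral exists. The substitution x = nu t
    turns that integral into the one of [laplace_series], which provides both its existence and its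
    value. *)
Lemma weeks_phi_series (th : R) : sin (th / 2) <> 0 -> exists E, 0 <= E /\ forall N,
  Rabs (weeks_phi f sigma nu th - sum_f_R0 (fun m => c m * cos (INR m * th)) N) <= E / (INR N + 1).
Proof.
intros Hs.
set (P := (1 / 2, cot (th / 2) / 2) : C).
destruct (laplace_series h c B HB Hcont Hc Hsum P eq_refl) as [V [HV1 HV2]].
set (s := (sigma + Ci * RtoC (nu / 2 * cot (th / 2)))%C).
assert (Hlap : laplace f s = (RtoC (/ nu) * V)%C).
{ assert (Hgen : is_RInt_gen (V := C_R_NormedModule) (laplace_integrand f s) (at_point 0)
    (Rbar_locally p_infty) (RtoC (/ nu) * V)%C);
    [|exact (is_RInt_gen_unique (V := C_R_CompleteNormedModule) (laplace_integrand f s) _ Hgen)].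
  apply is_RInt_gen_of_limit; intros eps He.
  assert (Hne : 0 < nu * eps / 2) by nra.
  destruct (HV1 _ Hne) as [X0 [HX0 HX]].
  exists (X0 / nu); intros T HT.
  assert (HT' : X0 < nu * T).
  { apply (Rmult_lt_compat_l nu) in HT; [|exact hnu].
    replace (nu * (X0 / nu)) with X0 in HT by (field; lra); exact HT. }
  assert (HT0 : 0 <= T) by nra.
  set (I := CInt (fun x => (Cexp (- (P * x)) * RtoC (h x))%C) 0 (nu * T)).
  assert (HI : is_CInt (fun x => (Cexp (- (P * x)) * RtoC (h x))%C)
     (nu * 0 + 0) (nu * T + 0) I).
  { rewrite Rmult_0_r, !Rplus_0_r; apply CInt_correct; [lra|]; intros x Hx.
    apply Ccont_mult; [|apply Hcont; lra].
    apply Ccont_exp, Ccont_opp, Ccont_mult; [apply Ccont_const|apply Ccont_RtoC, continuous_id]. }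
  apply (is_RInt_comp_lin (V := C_R_NormedModule)) in HI.
  exists (RtoC (/ nu) * I)%C; split.
  - assert (H := is_CInt_mult_l (RtoC (/ nu)) _ _ _ _ HI).
    revert H; apply is_CInt_ext; [exact HT0|]; intros t Ht; cbv beta.
    rewrite Rplus_0_r, scal_R_Cmult.
    unfold laplace_integrand; rewrite Hf by lra.
    rewrite (RtoC_mult (exp _)).
    replace (RtoC (exp ((sigma - nu / 2) * t))) with (Cexp (RtoC ((sigma - nu / 2) * t))).
    2:{ unfold Cexp; simpl; rewrite cos_0, sin_0; apply injective_projections; simpl; ring. }
    rewrite !Cmult_assoc, <- RtoC_mult, Rinv_l, Cmult_1_l by lra.
    rewrite <- Cexp_plus; f_equal; f_equal.
    apply injective_projections; simpl; field.
  - replace (RtoC (/ nu) * I - RtoC (/ nu) * V)%C with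
      (RtoC (/ nu) * (I - V))%C by ring.
    assert (Hinu : 0 < / nu) by (apply Rinv_0_lt_compat, hnu).
    rewrite Cmod_mult, Cmod_R, Rabs_pos_eq by lra.
    apply Rle_lt_trans with (/ nu * (nu * eps / 2)); [apply Rmult_le_compat_l; [lra|]|].
    + apply HX; lra.
    + replace (/ nu * (nu * eps / 2)) with (eps / 2) by (field; lra); lra. }
assert (Hphi : weeks_phi f sigma nu th = Re (P * V)).
{ unfold weeks_phi; fold s; rewrite Hlap; f_equal.
  replace (P * V)%C with (nu * P * (RtoC (/ nu) * V))%C.
  - f_equal; unfold P; apply injective_projections; simpl; field.
  - replace (nu * P * (RtoC (/ nu) * V))%C with
      (nu * RtoC (/ nu) * (P * V))%C by ring.
    rewrite <- RtoC_mult, Rinv_r by lra; ring. }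
exists (Cmod P * (4 * B)); split; [apply Rmult_le_pos; [apply Cmod_ge_0|lra]|]; intros N.
specialize (HV2 N); unfold P in HV2 at 2 3; rewrite (cayley_cot th Hs) in HV2.
assert (E : Re (Csum (fun k => (RtoC (c k) * (cos th, sin th) ^ k)%C) N) =
  sum_f_R0 (fun m => c m * cos (INR m * th)) N).
{ rewrite Re_Csum; apply sum_eq; intros k _; rewrite unit_circle_pow; simpl; ring. }
rewrite Hphi, <- E.
match goal with |- Rabs (Re ?a - Re ?b) <= _ =>
  change (Re a - Re b) with (Re (a - b)) end.
eapply Rle_trans; [apply re_le_Cmod|].
eapply Rle_trans; [exact HV2|]; right; unfold Rdiv; ring.
Qed.

Lemma weeks_coef_error (n : nat) (b : R) :
  (forall N, (n <= N)%nat -> sum_f_R0 (fun m => Rabs (c m)) N - sum_f_R0 (fun m => Rabs (c m)) n <= b) ->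
  sum_f_R0 (fun k => Rabs (weeks_coef f sigma nu n k - c k)) n <= b.
Proof.
intros Hb.
assert (Hnodes : forall j, (j <= n)%nat -> exists E, 0 <= E /\ forall N,
  Rabs (weeks_phi f sigma nu (weeks_node n j) -
    sum_f_R0 (fun m => c m * cos (INR m * weeks_node n j)) N) <= E / (INR N + 1)).
{ intros j Hj; apply weeks_phi_series; generalize (weeks_node_sin n j Hj); lra. }
(* The constant of [weeks_phi_series] depends on the angle; as n is fixed while N grows, one
   constant serves the finitely many nodes. *)
assert (Hunif : exists E, 0 <= E /\ forall j N, (j <= n)%nat ->
  Rabs (weeks_phi f sigma nu (weeks_node n j) -
    sum_f_R0 (fun m => c m * cos (INR m * weeks_node n j)) N) <= E / (INR N + 1)).
{ assert (Hind : forall p, (p <= n)%nat -> exists E, 0 <= E /\ forall j N, (j <= p)%nat ->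
    Rabs (weeks_phi f sigma nu (weeks_node n j) -
    sum_f_R0 (fun m => c m * cos (INR m * weeks_node n j)) N) <= E / (INR N + 1)).
  { induction p as [|p IH]; intros Hp.
    - destruct (Hnodes 0%nat Hp) as [E [HE H]]; exists E; split; [exact HE|].
      intros j N Hj; replace j with 0%nat by lia; apply H.
    - destruct (IH ltac:(lia)) as [E1 [HE1 H1]]; destruct (Hnodes (S p) Hp) as [E2 [HE2 H2]].
      exists (E1 + E2); split; [lra|]; intros j N Hj.
      assert (HN : 0 < / (INR N + 1)) by (apply Rinv_0_lt_compat; generalize (pos_INR N); lra).
      destruct (Nat.eq_dec j (S p)) as [->|].
      + eapply Rle_trans; [apply H2|]; apply Rmult_le_compat_r; lra.
      + eapply Rle_trans; [apply H1; lia|]; apply Rmult_le_compat_r; lra. }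
  apply Hind; lia. }
destruct Hunif as [E [HE HEj]].
apply (le_of_inv_INR _ _ ((INR n + 1) * (2 * E))).
{ apply Rmult_le_pos; [generalize (pos_INR n); lra|lra]. }
intros n0; exists (max n n0); split; [lia|]; set (N := max n n0).
assert (HnN : (n <= N)%nat) by (unfold N; lia).
assert (H1 := dct_partial_sum_error n N c HnN).
specialize (Hb N HnN).
apply Rle_trans with (sum_f_R0 (fun k => Rabs (dct n k (fun j => sum_f_R0 (fun m => c m * cos (INR
    m * weeks_node n j)) N) - c k)
  + 2 * (E / (INR N + 1))) n).
- apply sum_Rle; intros k Hk.
  change (weeks_coef f sigma nu n k) with (dct n k (fun j => weeks_phi f sigma nu (weeks_node n j))).
  assert (H2 := dct_bound n k (fun j => weeks_phi f sigma nu (weeks_node n j))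
    (fun j => sum_f_R0 (fun m => c m * cos (INR m * weeks_node n j)) N) _ (fun j Hj => HEj j N Hj)).
  match goal with |- Rabs (?p - ?q) <= Rabs (?s - ?q) + _ =>
    replace (p - q) with ((s - q) + (p - s)) by ring end.
  eapply Rle_trans; [apply Rabs_triang|]; lra.
- rewrite sum_plus, sum_cte, S_INR.
  replace (2 * (E / (INR N + 1)) * (INR n + 1)) with ((INR n + 1) * (2 * E) / (INR N + 1))
    by (unfold Rdiv; ring).
  lra.
Qed.

End WeeksCoefficients.

Theorem theorem6p6 (f : C -> C) (nu sigma rho beta K : R)
  (hnu : 0 < nu)
  (hsigma : Rbar_lt (laplace_sigma0 f) (Finite sigma))
  (hrho : 0 < rho)
  (hK : 0 < K)
  (hreal : forall x : R, 0 <= x -> Im (f (RtoC x)) = 0)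
  (hanalytic :
     analytic_in_nbhd_of (fun z => in_parabola rho z \/ on_parabola rho z) f)
  (hgrowth : exists M : R, 0 < M /\
     forall z : C, in_parabola rho z -> M < Cmod z ->
       Cmod (f z) <= K * Rpower (Cmod z) beta * exp ((sigma - nu / 2) * Re z))
  (t : R) (ht : 0 <= t) :
  bigO_seq
    (fun n => Cmod (Cminus (f (RtoC t)) (RtoC (weeks_approx f sigma nu n t))))
    (fun n => Rpower (INR n) (1 / 4) * exp (- 2 * rho * sqrt (nu * INR n))).
Proof.
set (g := rescaled f nu sigma); set (r := rho * sqrt nu).
assert (Hsn : 0 < sqrt nu) by (apply sqrt_lt_R0, hnu).
assert (Hr : 0 < r) by (apply Rmult_lt_0_compat; assumption).
assert (Hgd : forall zeta, 0 <= Re zeta <= r -> Cdiff g (- (zeta * zeta))%C)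
  by exact (rescaled_diff f nu sigma rho hnu hanalytic).
destruct (rescaled_growth f nu sigma rho beta K hnu hrho hK hanalytic hgrowth) as [Bg [Ng Hgg]].
destruct (laguerre_expansion g r Bg Ng Hr Hgd Hgg) as [c [A [k0 [HA [HcA Hexp]]]]].
set (h := fun x => Re (g (RtoC x))).
assert (Hcont : forall x, 0 <= x -> Ccont (fun x => RtoC (h x)) x).
{ intros x Hx; apply Ccont_RtoC, Ccont_Re.
  apply (Ccont_growth_axis g r Hr Hgd x Hx). }
assert (Hf : forall t, 0 <= t -> f (RtoC t) = RtoC (exp ((sigma - nu / 2) * t) * h (nu * t))).
{ intros u Hu; unfold h, g, rescaled.
  replace (RtoC (/ nu) * RtoC (nu * u))%C with (RtoC u)
    by (rewrite <- RtoC_mult; f_equal; field; lra).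
  rewrite (surjective_pairing (f (RtoC u))).
  replace (snd (f (RtoC u))) with 0 by (symmetry; apply (hreal u Hu)).
  unfold Cexp; simpl.
  replace (- ((sigma - nu / 2) / nu * 0 + 0 * (nu * u))) with 0 by ring.
  replace (- ((sigma - nu / 2) / nu * (nu * u) - 0 * 0)) with (- ((sigma - nu / 2) * u)) by (field; lra).
  rewrite cos_0, sin_0, exp_Ropp; apply injective_projections; simpl; [|ring].
  field; generalize (exp_pos ((sigma - nu / 2) * u)); lra. }
set (k1 := max k0 1).
(* The power 4 is the one required by the [LaguerreSeries] section; the initial degrees, without a
   rate, are covered by a maximum. *)
destruct (coef_rate_poly r 4 Hr) as [B4 [HB4 Hp4]].
destruct (finite_upper_bound (fun k => Rabs (c k) * (INR k + 1) ^ 4) k1) as [Bf [HBf Hfin]].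
set (B1 := A * B4 + Bf).
assert (HB1 : 0 <= B1) by (unfold B1; nra).
assert (Hc4 : forall k, Rabs (c k) * (INR k + 1) ^ 4 <= B1).
{ intros k; unfold B1; destruct (Nat.le_gt_cases k k1) as [Hk|Hk].
  - specialize (Hfin k Hk); simpl in Hfin |- *; nra.
  - specialize (HcA k ltac:(lia)); specialize (Hp4 k ltac:(lia)).
    assert (H0 : 0 <= (INR k + 1) ^ 4) by (apply pow_le; generalize (pos_INR k); lra).
    apply Rle_trans with (A * coef_rate r k * (INR k + 1) ^ 4); [apply Rmult_le_compat_r; assumption|].
    rewrite Rmult_assoc; assert (A * (coef_rate r k * (INR k + 1) ^ 4) <= A * B4)
      by (apply Rmult_le_compat_l; lra); lra. }
(* The constant of [laguerre_expansion] depends on x without control. That estimate is used only to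
   identify the limit as N grows; the decay of the coefficients then gives a bound explicit in x. *)
assert (Hsum : forall x n, 0 <= x ->
  Rabs (h x - sum_f_R0 (fun k => c k * laguerre k x) n) <= exp (x / 2) * (B1 / (INR n + 1))).
{ intros x n Hx; destruct (Hexp x Hx) as [D [HD HDn]].
  assert (Hex := exp_pos (x / 2)).
  apply (le_of_inv_INR _ _ (D * (2 * B4))); [apply Rmult_le_pos; lra|]; intros n0.
  exists (max n (max n0 k1)); split; [lia|]; set (N := max n (max n0 k1)).
  specialize (HDn N ltac:(unfold N, k1; lia)); fold (h x) in HDn.
  assert (Hdecay : forall k, Rabs (c k * laguerre k x) * (INR k + 1) ^ 2 <= exp (x / 2) * B1).
  { intros k; rewrite Rabs_mult; assert (Hk := pos_INR k).
    apply Rle_trans with (Rabs (c k) * ((INR k + 1) * exp (x / 2)) * (INR k + 1) ^ 2).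
    - apply Rmult_le_compat_r; [apply pow2_ge_0|].
      apply Rmult_le_compat_l; [apply Rabs_pos|apply laguerre_abs_bound, Hx].
    - replace (Rabs (c k) * ((INR k + 1) * exp (x / 2)) * (INR k + 1) ^ 2) with
        (exp (x / 2) * (Rabs (c k) * (INR k + 1) ^ 3)) by ring.
      apply Rmult_le_compat_l; [lra|]; eapply Rle_trans; [|apply (Hc4 k)].
      apply Rmult_le_compat_l; [apply Rabs_pos|apply Rle_pow; [lra|lia]]. }
  assert (Ht := inverse_square_tail (fun k => c k * laguerre k x) (exp (x / 2) * B1) n N
    ltac:(apply Rmult_le_pos; lra) Hdecay ltac:(unfold N; lia)).
  replace (h x - sum_f_R0 (fun k => c k * laguerre k x) n) with
    ((sum_f_R0 (fun k => c k * laguerre k x) N - sum_f_R0 (fun k => c k * laguerre k x) n) +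
     (h x - sum_f_R0 (fun k => c k * laguerre k x) N)) by ring.
  eapply Rle_trans; [apply Rabs_triang|]; apply Rplus_le_compat.
  - unfold Rdiv in *; rewrite <- Rmult_assoc; exact Ht.
  - eapply Rle_trans; [exact HDn|].
    assert (HN := pos_INR N).
    assert (Hq : forall k, (N <= k)%nat -> (INR N + 1) * coef_rate r k <= B4 / (INR N + 1)).
    { intros k Hk; assert (HNk : INR N <= INR k) by (apply le_INR, Hk).
      assert (Hk1 : (1 <= k)%nat) by (unfold N, k1 in Hk; lia).
      assert (Hrk := coef_rate_pos r k Hk1).
      specialize (Hp4 k Hk1).
      apply Rmult_le_reg_r with (INR N + 1); [lra|].
      unfold Rdiv; rewrite (Rmult_assoc B4), Rinv_l, Rmult_1_r by lra.
      eapply Rle_trans; [|exact Hp4].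
      replace ((INR N + 1) * coef_rate r k * (INR N + 1)) with (coef_rate r k * (INR N + 1) ^ 2) by ring.
      apply Rmult_le_compat_l; [lra|].
      apply Rle_trans with ((INR k + 1) ^ 2); [apply pow_incr; lra|apply Rle_pow; [lra|lia]]. }
    assert (Q1 := Hq N ltac:(lia)); assert (Q2 := Hq (S N) ltac:(lia)).
    replace (D * (2 * B4) / (INR N + 1)) with (D * (B4 / (INR N + 1) + B4 / (INR N + 1)))
      by (field; lra).
    rewrite Rmult_assoc; apply Rmult_le_compat_l; [exact HD|lra]. }
set (x := nu * t); assert (Hx : 0 <= x) by (apply Rmult_le_pos; lra).
destruct (laguerre_bounded_in_degree x Hx) as [L [HL HLk]].
destruct (coef_rate_tail r Hr) as [n1 [Hn1 Htail]].
set (et := exp ((sigma - nu / 2) * t)); assert (Het : 0 < et) by apply exp_pos.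
(* The tail of the coefficients, at most A (2/r) times the rate, counts twice, for truncation and
   for aliasing; [L] bounds the polynomials and [et] undoes the rescaling. *)
exists (et * (2 * (L * (A * (2 / r))))), (max n1 k0); intros n Hn.
assert (Hn1' : (n1 <= n)%nat) by lia.
set (v := tail_rate r (INR n)).
assert (Hv : 0 <= v) by apply tail_rate_nonneg.
assert (Htarget : Rpower (INR n) (1 / 4) * exp (- 2 * rho * sqrt (nu * INR n)) = v).
{ assert (Hn0 : 0 < INR n) by (apply lt_0_INR; lia).
  unfold v, tail_rate, r; rewrite sqrt_mult by lra; f_equal.
  - replace (1 / 4) with (/ 2 * / 2) by field.
    rewrite <- Rpower_mult, !Rpower_sqrt; [reflexivity|exact Hn0|rewrite Rpower_sqrt by exact Hn0;
        apply sqrt_lt_R0, Hn0].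
  - f_equal; ring. }
rewrite Htarget.
rewrite (Rabs_pos_eq v Hv), (Rabs_pos_eq (Cmod _)) by apply Cmod_ge_0.
set (b := A * (2 / r * v)).
assert (Hctail : forall N, (n <= N)%nat ->
  sum_f_R0 (fun m => Rabs (c m)) N - sum_f_R0 (fun m => Rabs (c m)) n <= b).
{ intros N HN; eapply Rle_trans; [apply (sum_abs_tail c (coef_rate r) A k0 n N HcA ltac:(lia) HN)|].
  apply Rmult_le_compat_l; [lra|apply Htail; assumption]. }
assert (Hcoef := weeks_coef_error f nu sigma h c B1 hnu HB1 Hcont Hc4 Hsum Hf n b Hctail).
(* The direct estimate of the remainder carries a factor n + 1 that is too large for the rate;
   convergence combined with the tail of the coefficients gives the sharp bound. *)
assert (Htrunc : Rabs (h x - sum_f_R0 (fun k => c k * laguerre k x) n) <= L * b).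
{ apply (le_of_inv_INR _ _ (exp (x / 2) * B1)); [apply Rmult_le_pos; [left; apply exp_pos|exact HB1]|].
  intros n0; exists (max n n0); split; [lia|]; set (N := max n n0).
  assert (HnN : (n <= N)%nat) by (unfold N; lia).
  replace (h x - sum_f_R0 (fun k => c k * laguerre k x) n) with
    ((sum_f_R0 (fun k => c k * laguerre k x) N - sum_f_R0 (fun k => c k * laguerre k x) n) +
     (h x - sum_f_R0 (fun k => c k * laguerre k x) N)) by ring.
  eapply Rle_trans; [apply Rabs_triang|]; apply Rplus_le_compat.
  - eapply Rle_trans; [apply (sum_tail_le _ n N HnN)|].
    eapply Rle_trans; [apply (sum_abs_tail (fun k => c k * laguerre k x) (fun k => Rabs (c k)) L 0
        n N)|];
      [|lia|exact HnN|].
    + intros k _; rewrite Rabs_mult, Rmult_comm; apply Rmult_le_compat_r; [apply Rabs_pos|apply HLk].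
    + apply Rmult_le_compat_l; [lra|apply Hctail, HnN].
  - unfold Rdiv; rewrite Rmult_assoc; apply (Hsum x N Hx). }
rewrite (Hf t ht); fold x; fold et.
rewrite <- RtoC_minus, Cmod_R.
assert (Happ : weeks_approx f sigma nu n t =
  et * sum_f_R0 (fun k => weeks_coef f sigma nu n k * laguerre k x) n).
{ unfold weeks_approx; rewrite !scal_sum; apply sum_eq; intros k _.
  replace et with (exp (sigma * t) * exp (- nu * t / 2)); [fold x; ring|].
  unfold et; rewrite <- exp_plus; f_equal; field. }
rewrite Happ, <- Rmult_minus_distr_l, Rabs_mult, (Rabs_pos_eq et) by lra.
replace (et * (2 * (L * (A * (2 / r)))) * v) with (et * (L * b + L * b)) by (unfold b; ring).
apply Rmult_le_compat_l; [lra|].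
replace (h x - sum_f_R0 (fun k => weeks_coef f sigma nu n k * laguerre k x) n) with
  ((h x - sum_f_R0 (fun k => c k * laguerre k x) n) +
   - (sum_f_R0 (fun k => weeks_coef f sigma nu n k * laguerre k x) n - sum_f_R0 (fun k => c k *
       laguerre k x) n)) by ring.
eapply Rle_trans; [apply Rabs_triang|]; rewrite Rabs_Ropp; apply Rplus_le_compat; [exact Htrunc|].
rewrite <- minus_sum; eapply Rle_trans; [apply Rsum_abs|].
apply Rle_trans with (L * sum_f_R0 (fun k => Rabs (weeks_coef f sigma nu n k - c k)) n);
  [|apply Rmult_le_compat_l; lra].
rewrite scal_sum; apply sum_Rle; intros k _.
rewrite <- Rmult_minus_distr_r, Rabs_mult; apply Rmult_le_compat_l; [apply Rabs_pos|apply HLk].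
Qed.
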